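(* Let $B$ be a poset, let $\pi:S\to B$ be the fibration of posets constructed from a functor $\Psi$ from $B^{op}$ to the category of posets, let $\mathcal{F}$ be a presheaf on $S$ and let $\mathcal{G}$ be a free copresheaf on $B$. Then there is a spectral sequence with $$E^2_{p,q}=\mathrm{Tor}^B_q(H_p(\Psi;\mathcal{F}),\mathcal{G})$$ which converges to $\mathrm{Tor}^S_{*}(\mathcal{F},\pi^*\mathcal{G})$ (with $*=p+q$).
   Context: A poset $P$ is regarded as a category with an arrow $x\to y$ iff $x\le y$. A presheaf on $P$ is a functor $P^{op}\to Ab$; a copresheaf on $P$ is a functor $P\to Ab$; it is free if all its values are free abelian groups. For order preserving $f:P\to Q$ and a (co)presheaf $\mathcal{E}$ on $Q$, $f^*\mathcal{E}=\mathcal{E}\circ f$. The tensor product $\mathcal{F}\otimes_P\mathcal{G}$ of a presheaf and a copresheaf on $P$ is the coequalizer of the two maps $\bigoplus_{y\le x}\mathcal{F}(x)\otimes\mathcal{G}(y)\rightrightarrows\bigoplus_p\mathcal{F}(p)\otimes\mathcal{G}(p)$ induced by $\mathcal{F}(y\le x)\otimes1$ and $1\otimes\mathcal{G}(y\le x)$. $\mathrm{Tor}_n^P(\mathcal{F},\mathcal{G})=L_n(-\otimes_P\mathcal{G})(\mathcal{F})$ (left derived functors on the category of presheaves). $H_n(P;\mathcal{F})=\mathrm{Tor}^P_n(\mathcal{F},\overline{\mathbb{Z}})$, $\overline{\mathbb{Z}}$ the constant copresheaf; it is the $n$-th left derived functor of $\mathrm{colim}_{P^{op}}$. Fibration of posets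 constructed by $\Psi:B^{op}\to\mathrm{Poset}$: $S=\bigsqcup_{x\in B}\Psi(x)$ with order: for $a\in\Psi(x)$, $b\in\Psi(y)$, $a\le b$ iff $x\le y$ and $a\le\Psi(x\le y)(b)$ in $\Psi(x)$; $\pi:S\to B$ sends $\Psi(x)$ to $x$. $H_n(\Psi;\mathcal{F})$ is the presheaf on $B$ given by $x\mapsto H_n(\Psi(x);\mathcal{F}|_{\Psi(x)})$, whose restriction map for $x\le y$ is induced by the map $\Psi(x\le y):\Psi(y)\to\Psi(x)$ and the restriction maps $\mathcal{F}(b)\to\mathcal{F}(\Psi(x\le y)(b))$, $b\in\Psi(y)$. *)

(* Defs.v *)
From HB Require Import structures.
From mathcomp Require Import all_boot all_order all_algebra.
From mathcomp Require Import boolp classical_sets functions cardinality fsbigop.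

Set Implicit Arguments.
Unset Strict Implicit.
Unset Printing Implicit Defensive.
Import Order.TTheory GRing.Theory.
Local Open Scope ring_scope.

(* Abelian groups are [zmodType]s and the subgroups of [A] are the terms of type
   [zmodClosed A]; [{ideal_quot S}] is the quotient of [A] by the subgroup [S],
   also when [A] is just a [zmodType]. *)

Definition additive_of (A B : zmodType) (f : A -> B) (h : zmod_morphism f) :
    {additive A -> B} :=
  HB.pack_for {additive A -> B} f (GRing.isZmodMorphism.Build A B f h).

Definition add_id (A : zmodType) : {additive A -> A} :=
  @additive_of A A id (fun _ _ => erefl).

Definition add_comp (A B C : zmodType) (g : {additive B -> C}) (f : {additive A -> B}) :
  {additive A -> C} := g \o f.

Lemma add_compE (A B C : zmodType) (g : {additive B -> C}) (f : {additive A -> B}) x :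
  add_comp g f x = g (f x).
Proof. by []. Qed.

Definition add_sub (A B : zmodType) (f g : {additive A -> B}) : {additive A -> B} :=
  f \- g.

Lemma add_subE (A B : zmodType) (f g : {additive A -> B}) x : add_sub f g x = f x - g x.
Proof. by []. Qed.

Definition add_zero (A B : zmodType) : {additive A -> B} :=
  @additive_of A B (fun=> 0) (fun _ _ => esym (subrr 0)).

Definition zmod_iso (A B : zmodType) : Prop :=
  exists f : {additive A -> B}, bijective f.

Definition subgroup_of (A : zmodType) (S : pred A) (h : zmod_closed S) :
    zmodClosed A :=
  HB.pack_for (zmodClosed A) S (GRing.isZmodClosed.Build A S h).

Section Subgroups.
Variables A B : zmodType.

Fact kernel_zmod_closed (f : {additive A -> B}) :
  zmod_closed (fun x => f x == 0).
Proof.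
split=> [|x y]; rewrite !unfold_in ?raddf0 // raddfB.
by move=> /eqP-> /eqP->; rewrite subrr.
Qed.

Definition kernel f : zmodClosed A := subgroup_of (kernel_zmod_closed f).

Lemma kernelP f x : x \in kernel f <-> f x = 0.
Proof. by split=> /eqP. Qed.

Fact image_zmod_closed (f : {additive A -> B}) :
  zmod_closed (fun y => `[< exists x, f x = y >]).
Proof.
split=> [|_ _ /asboolP[x <-] /asboolP[y <-]]; apply/asboolP.
  by exists 0; rewrite raddf0.
by exists (x - y); rewrite raddfB.
Qed.

Definition image_of f : zmodClosed B := subgroup_of (image_zmod_closed f).

Lemma imageP f y : y \in image_of f <-> exists x, f x = y.
Proof. by split=> /asboolP. Qed.

Fact preimage_zmod_closed (f : {additive A -> B}) (S : zmodClosed B) :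
  zmod_closed (fun x => f x \in S).
Proof.
have E z : (z \in (fun x => f x \in S : bool)) = (f z \in S) by [].
by split=> [|x y]; rewrite !E ?raddf0 ?rpred0 // raddfB; exact: rpredB.
Qed.

Definition preimage_of f S : zmodClosed A := subgroup_of (preimage_zmod_closed f S).

Fact generated_zmod_closed (X : A -> Prop) : zmod_closed
  (fun y => `[< forall S : zmodClosed A, (forall x, X x -> x \in S) -> y \in S >]).
Proof.
split=> [|x y /asboolP Hx /asboolP Hy]; apply/asboolP => S XS.
  exact: rpred0.
by rewrite rpredB ?Hx ?Hy.
Qed.

Definition generated X : zmodClosed A := subgroup_of (generated_zmod_closed X).

Lemma generated_incl (X : A -> Prop) x : X x -> x \in generated X.
Proof. by move=> Xx; apply/asboolP => S; apply. Qed.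

Lemma generated_min (X : A -> Prop) (S : zmodClosed A) :
  (forall x, X x -> x \in S) -> forall x, x \in generated X -> x \in S.
Proof. by move=> XS x /asboolP; apply. Qed.

Definition whole : zmodClosed A := @subgroup_of A predT (conj isT (fun _ _ _ _ => isT)).

End Subgroups.

Section SubgroupType.
Variables (A : zmodType) (S : zmodClosed A).

Record sub_of := SubOf { sub_val : A; sub_valP : sub_val \in S }.

HB.instance Definition _ := [isSub for sub_val].
HB.instance Definition _ := [Choice of sub_of by <:].
HB.instance Definition _ := [SubChoice_isSubZmodule of sub_of by <:].

Fact sub_val_is_zmod_morphism : zmod_morphism sub_val.
Proof. exact: (raddfB (val : sub_of -> A)). Qed.

HB.instance Definition _ :=
  GRing.isZmodMorphism.Build sub_of A sub_val sub_val_is_zmod_morphism.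

End SubgroupType.

Section SubgroupMap.
Variables (A B : zmodType) (S : zmodClosed A) (T : zmodClosed B).
Variable f : {additive A -> B}.
Hypothesis fS : forall x, x \in S -> f x \in T.

Definition sub_map_fun (x : sub_of S) : sub_of T := SubOf (fS (sub_valP x)).

Fact sub_map_is_zmod_morphism : zmod_morphism sub_map_fun.
Proof. by move=> x y; apply: val_inj; rewrite /= !raddfB. Qed.

Definition sub_map := additive_of sub_map_is_zmod_morphism.

End SubgroupMap.

Section Quotients.
Variables (A : zmodType) (S : zmodClosed A).

Definition quot_pi_fun (x : A) : {ideal_quot S} := \pi_({ideal_quot S})%qT x.

Fact quot_pi_is_zmod_morphism : zmod_morphism quot_pi_fun.
Proof. by move=> x y; rewrite /quot_pi_fun !piE. Qed.

Definition quot_pi := additive_of quot_pi_is_zmod_morphism.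

Lemma quot_piP (q : {ideal_quot S}) : exists x, quot_pi x = q.
Proof. by exists (repr q); rewrite /quot_pi /= /quot_pi_fun reprK. Qed.

Lemma quot_eqP x y : quot_pi x = quot_pi y <-> x - y \in S.
Proof.
rewrite Quotient.idealrBE; split=> [h|/eqP h]; last exact: h.
by apply/eqP.
Qed.

Lemma quot_eq0 x : quot_pi x = 0 <-> x \in S.
Proof. by rewrite -{1}(raddf0 quot_pi) quot_eqP subr0. Qed.

Section Lift.
Variables (C : zmodType) (f : {additive A -> C}).
Hypothesis fS : forall x, x \in S -> f x = 0.

Definition quot_lift_fun (q : {ideal_quot S}) : C := f (repr q).

Fact quot_lift_fun_pi x : quot_lift_fun (quot_pi x) = f x.
Proof.
apply/eqP; rewrite -subr_eq0 -raddfB; apply/eqP/fS.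
by apply/quot_eqP; rewrite /quot_pi /= /quot_pi_fun reprK.
Qed.

Fact quot_lift_is_zmod_morphism : zmod_morphism quot_lift_fun.
Proof.
move=> p q; have [x <-] := quot_piP p; have [y <-] := quot_piP q.
by rewrite -raddfB !quot_lift_fun_pi raddfB.
Qed.

Definition quot_lift := additive_of quot_lift_is_zmod_morphism.

Lemma quot_liftE x : quot_lift (quot_pi x) = f x.
Proof. exact: quot_lift_fun_pi. Qed.

End Lift.
End Quotients.

Section QuotientMap.
Variables (A B : zmodType) (S : zmodClosed A) (T : zmodClosed B).
Variable f : {additive A -> B}.
Hypothesis fS : forall x, x \in S -> f x \in T.

Fact quot_map_subproof x : x \in S -> add_comp (quot_pi T) f x = 0.
Proof. by move=> /fS fx; apply/quot_eq0. Qed.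

Definition quot_map : {additive {ideal_quot S} -> {ideal_quot T}} :=
  quot_lift quot_map_subproof.

Lemma quot_mapE x : quot_map (quot_pi S x) = quot_pi T (f x).
Proof. exact: quot_liftE. Qed.

End QuotientMap.

(* [Z / N] for subgroups [N] and [Z] of the same group; [N] is first intersected
   with [Z], so that no proof of [N <= Z] is needed. *)
Definition subquot_rel (A : zmodType) (Z N : zmodClosed A) : zmodClosed (sub_of Z) :=
  preimage_of (@sub_val A Z) N.

Definition subquot (A : zmodType) (Z N : zmodClosed A) : zmodType :=
  {ideal_quot subquot_rel Z N}.

Section SubquotMap.
Variables (A B : zmodType) (Z N : zmodClosed A) (Z' N' : zmodClosed B).
Variable f : {additive A -> B}.
Hypothesis fZ : forall x, x \in Z -> f x \in Z'.
Hypothesis fN : forall x, x \in N -> f x \in N'.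

Fact subquot_map_subproof x :
  x \in subquot_rel Z N -> sub_map fZ x \in subquot_rel Z' N'.
Proof. exact: fN. Qed.

Definition subquot_map : {additive subquot Z N -> subquot Z' N'} :=
  quot_map subquot_map_subproof.

End SubquotMap.

Section DirectSum.
Variables (I : choiceType) (A : I -> zmodType).

Record dsum := DSum {
  dsum_val :> forall i, A i;
  dsum_fin : finite_set [set i | dsum_val i != 0] }.

Lemma dsumP (x y : dsum) : (forall i, x i = y i) -> x = y.
Proof.
case: x y => [x xf] [y yf] /= xy.
have {}xy : x = y by exact: functional_extensionality_dep.
by subst y; congr DSum; exact: Prop_irrelevance.
Qed.

HB.instance Definition _ := gen_eqMixin dsum.
HB.instance Definition _ := gen_choiceMixin dsum.

Fact dsum0_fin : finite_set [set i : I | (0 : A i) != 0].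
Proof. by apply: (sub_finite_set _ (finite_set0 I)) => i /=; rewrite eqxx. Qed.

Fact dsumN_fin (x : dsum) : finite_set [set i | - x i != 0].
Proof. by apply: (sub_finite_set _ (dsum_fin x)) => i /=; rewrite oppr_eq0. Qed.

Fact dsumD_fin (x y : dsum) : finite_set [set i | x i + y i != 0].
Proof.
have : finite_set ([set i | x i != 0] `|` [set i | y i != 0])%classic.
  by rewrite finite_setU; split; exact: dsum_fin.
apply: sub_finite_set => i /=.
have [->|xi _] := eqVneq (x i) 0; last by left.
by rewrite add0r; right.
Qed.

Definition dsum0 := DSum dsum0_fin.
Definition dsumN x := DSum (dsumN_fin x).
Definition dsumD x y := DSum (dsumD_fin x y).

Fact dsumDA : associative dsumD.
Proof. by move=> x y z; apply: dsumP => i /=; rewrite addrA. Qed.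
Fact dsumDC : commutative dsumD.
Proof. by move=> x y; apply: dsumP => i /=; rewrite addrC. Qed.
Fact dsum0D : left_id dsum0 dsumD.
Proof. by move=> x; apply: dsumP => i /=; rewrite add0r. Qed.
Fact dsumND : left_inverse dsum0 dsumN dsumD.
Proof. by move=> x; apply: dsumP => i /=; rewrite addNr. Qed.

HB.instance Definition _ := GRing.isZmodule.Build dsum dsumDA dsumDC dsum0D dsumND.

Lemma dsumBE (x y : dsum) i : (x - y) i = x i - y i. Proof. by []. Qed.
Lemma dsumDE (x y : dsum) i : (x + y) i = x i + y i. Proof. by []. Qed.

Section Injection.
Variable i : I.

Definition din_val (a : A i) : forall j, A j := dfwith (fun j => 0 : A j) a.

Fact din_fin a : finite_set [set j | din_val a j != 0].
Proof.
apply: (sub_finite_set _ (finite_set1 i)) => j /=; rewrite /din_val.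
by case: dfwithP => // k _; rewrite eqxx.
Qed.

Definition din_fun a := DSum (din_fin a).

Fact din_is_zmod_morphism : zmod_morphism din_fun.
Proof.
move=> a b; apply: dsumP => j; rewrite dsumBE /= /din_val.
have [<-|ij] := eqVneq i j; first by rewrite !dfwith_in.
by rewrite !dfwith_out // subrr.
Qed.

Definition din : {additive A i -> dsum} := additive_of din_is_zmod_morphism.

End Injection.

Lemma dsum_sum_din (x : dsum) (r : seq I) : uniq r ->
  (forall i, x i != 0 -> i \in r) -> x = \sum_(i <- r) din i (x i).
Proof.
move=> ur xr; apply: dsumP => j.
have -> : (\sum_(i <- r) din i (x i)) j = \sum_(i <- r) din_val (x i) j.
  by elim: (r) => [|i s IHs]; rewrite ?big_nil // !big_cons dsumDE IHs.
have [jr|jr] := boolP (j \in r).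
  rewrite (bigD1_seq j) //= {1}/din_val dfwith_in big1 ?addr0 // => i ij.
  by rewrite /din_val dfwith_out.
rewrite big_seq big1 => [|i ir].
  by apply/eqP/negPn; apply: contraNN jr => /xr.
by rewrite /din_val dfwith_out //; apply: contraNneq jr => <-.
Qed.

Lemma dsum_support (x : dsum) :
  exists2 r : seq I, uniq r & forall i, x i != 0 -> i \in r.
Proof.
have [r rP] := (@finite_seqP I _).1 (dsum_fin x).
exists (undup r); first exact: undup_uniq.
move=> i xi; rewrite mem_undup.
by have : [set i | x i != 0]%classic i by []; rewrite rP.
Qed.

Lemma dsum_ext (C : zmodType) (f g : {additive dsum -> C}) :
  (forall i a, f (din i a) = g (din i a)) -> f =1 g.
Proof.
move=> fg x; have [r ur xr] := dsum_support x.
rewrite (dsum_sum_din ur xr) !raddf_sum; exact: eq_bigr.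
Qed.

Section Lift.
Variables (C : zmodType) (f : forall i, {additive A i -> C}).

Definition dsum_lift_fun (x : dsum) : C := \sum_(i \in [set: I]) f i (x i).

Fact dsum_lift_funE (x : dsum) (r : seq I) : uniq r ->
  (forall i, x i != 0 -> i \in r) -> dsum_lift_fun x = \sum_(i <- r) f i (x i).
Proof.
move=> ur xr; rewrite /dsum_lift_fun (fsbigE r) //.
  by apply: eq_bigl => i; rewrite in_setT.
move=> i _ ir; have [->|/xr] := eqVneq (x i) 0; first by rewrite raddf0.
by rewrite (negPf ir).
Qed.

Fact dsum_lift_is_zmod_morphism : zmod_morphism dsum_lift_fun.
Proof.
move=> x y; have [r ur xr] := dsum_support x; have [s us ys] := dsum_support y.
have ut : uniq (undup (r ++ s)) by exact: undup_uniq.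
have tE i : (i \in undup (r ++ s)) = (i \in r) || (i \in s).
  by rewrite mem_undup mem_cat.
have {}xr i : x i != 0 -> i \in undup (r ++ s) by rewrite tE => /xr->.
have {}ys i : y i != 0 -> i \in undup (r ++ s).
  by rewrite tE orbC => /ys->.
rewrite (dsum_lift_funE ut xr) (dsum_lift_funE ut ys) (dsum_lift_funE ut).
  by rewrite -sumrB; apply: eq_bigr => i _; rewrite dsumBE raddfB.
move=> i; apply: contraR => it; rewrite dsumBE subr_eq0.
have /eqP-> : x i == 0 by apply: contraNT it => /xr.
by have /eqP-> : y i == 0 by apply: contraNT it => /ys.
Qed.

Definition dsum_lift : {additive dsum -> C} := additive_of dsum_lift_is_zmod_morphism.

Lemma dsum_liftE i (a : A i) : dsum_lift (din i a) = f i a.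
Proof.
rewrite /dsum_lift /= (@dsum_lift_funE _ [:: i]) //.
  by rewrite big_seq1 /= /din_val dfwith_in.
move=> j /=; rewrite /din_val inE; case: dfwithP => [|k _]; first by rewrite eqxx.
by rewrite eqxx.
Qed.

End Lift.
End DirectSum.

Section FreeAbelian.
Variable X : choiceType.

Definition freeab : zmodType := dsum (fun _ : X => int).

Definition fgen (x : X) : freeab := din (fun _ : X => int) x 1.

Lemma freeab_ext (C : zmodType) (f g : {additive freeab -> C}) :
  (forall x, f (fgen x) = g (fgen x)) -> f =1 g.
Proof.
move=> fg; apply: dsum_ext => x n.
have -> : din (fun _ : X => int) x n = fgen x *~ n by rewrite -raddfMz intz.
by rewrite !raddfMz fg.
Qed.

Section Lift.
Variables (C : zmodType) (c : X -> C).

Fact zmul_is_zmod_morphism (a : C) : zmod_morphism (fun n : int => a *~ n).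
Proof. by move=> m n; rewrite mulrzBr. Qed.

Definition freeab_lift : {additive freeab -> C} :=
  dsum_lift (fun x => additive_of (zmul_is_zmod_morphism (c x))).

Lemma freeab_liftE x : freeab_lift (fgen x) = c x.
Proof. by rewrite /freeab_lift dsum_liftE. Qed.

End Lift.
End FreeAbelian.

Definition freeab_map (X Y : choiceType) (f : X -> Y) :
    {additive freeab X -> freeab Y} :=
  freeab_lift (fun x => fgen (f x)).

Lemma freeab_mapE (X Y : choiceType) (f : X -> Y) x :
  freeab_map f (fgen x) = fgen (f x).
Proof. exact: freeab_liftE. Qed.

Definition is_free_abelian (A : zmodType) : Prop :=
  exists X : choiceType, zmod_iso (freeab X) A.

Section Tensor.
Variables A B : zmodType.

Definition tensor_gen (a : A) (b : B) : freeab (A * B)%type := fgen (a, b).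

Inductive bilinear_relation : freeab (A * B)%type -> Prop :=
| bilinear_l a a' b :
    bilinear_relation (tensor_gen (a + a') b - tensor_gen a b - tensor_gen a' b)
| bilinear_r a b b' :
    bilinear_relation (tensor_gen a (b + b') - tensor_gen a b - tensor_gen a b').

Definition tensor : zmodType := {ideal_quot generated bilinear_relation}.

Definition pure (a : A) (b : B) : tensor :=
  quot_pi (generated bilinear_relation) (tensor_gen a b).

Lemma pureDl a a' b : pure (a + a') b = pure a b + pure a' b.
Proof.
apply/eqP; rewrite -subr_eq0 opprD addrA -!raddfB; apply/eqP/quot_eq0.
exact/generated_incl/bilinear_l.
Qed.

Lemma pureDr a b b' : pure a (b + b') = pure a b + pure a b'.
Proof.
apply/eqP; rewrite -subr_eq0 opprD addrA -!raddfB; apply/eqP/quot_eq0.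
exact/generated_incl/bilinear_r.
Qed.

Lemma tensor_ext (C : zmodType) (f g : {additive tensor -> C}) :
  (forall a b, f (pure a b) = g (pure a b)) -> f =1 g.
Proof.
move=> fg q; have [x <-] := quot_piP q.
pose pi := quot_pi (generated bilinear_relation).
apply: (freeab_ext (f := add_comp f pi) (g := add_comp g pi)) => -[a b]; exact: fg.
Qed.

Lemma pure0l b : pure 0 b = 0.
Proof. by apply: (addrI (pure 0 b)); rewrite -pureDl !addr0. Qed.

Section Lift.
Variables (C : zmodType) (f : A -> B -> C).
Hypothesis fDl : forall a a' b, f (a + a') b = f a b + f a' b.
Hypothesis fDr : forall a b b', f a (b + b') = f a b + f a b'.

Fact tensor_lift_subproof x : x \in generated bilinear_relation ->
  freeab_lift (fun ab : A * B => f ab.1 ab.2) x = 0.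
Proof.
set g := freeab_lift _ => /(generated_min (S := kernel g)) Hx.
apply/kernelP/Hx => y [] *; apply/kernelP;
by rewrite !raddfB /g /tensor_gen !freeab_liftE /= ?fDl ?fDr addrAC addrK subrr.
Qed.

Definition tensor_lift : {additive tensor -> C} := quot_lift tensor_lift_subproof.

Lemma tensor_liftE a b : tensor_lift (pure a b) = f a b.
Proof. by rewrite /tensor_lift quot_liftE freeab_liftE. Qed.

End Lift.
End Tensor.

Section TensorMap.
Variables (A A' B B' : zmodType) (f : {additive A -> A'}) (g : {additive B -> B'}).

Fact tensor_mapDl a a' b : pure (f (a + a')) (g b) = pure (f a) (g b) + pure (f a') (g b).
Proof. by rewrite raddfD pureDl. Qed.

Fact tensor_mapDr a b b' : pure (f a) (g (b + b')) = pure (f a) (g b) + pure (f a) (g b').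
Proof. by rewrite raddfD pureDr. Qed.

Definition tensor_map : {additive tensor A B -> tensor A' B'} :=
  tensor_lift tensor_mapDl tensor_mapDr.

Lemma tensor_mapE a b : tensor_map (pure a b) = pure (f a) (g b).
Proof. by rewrite /tensor_map tensor_liftE. Qed.

End TensorMap.

Section Presheaves.
Context {d : Order.disp_t}.
Variable P : porderType d.

Record presheaf := Presheaf {
  pob :> P -> zmodType;
  pres : forall x y : P, (x <= y)%O -> {additive pob y -> pob x};
  pres_id : forall (x : P) (h : (x <= x)%O) a, pres h a = a;
  pres_comp : forall (x y z : P) (hxy : (x <= y)%O) (hyz : (y <= z)%O)
    (hxz : (x <= z)%O) a, pres hxy (pres hyz a) = pres hxz a }.

Record copresheaf := Copresheaf {
  cob :> P -> zmodType;
  cmap : forall x y : P, (x <= y)%O -> {additive cob x -> cob y};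
  cmap_id : forall (x : P) (h : (x <= x)%O) a, cmap h a = a;
  cmap_comp : forall (x y z : P) (hxy : (x <= y)%O) (hyz : (y <= z)%O)
    (hxz : (x <= z)%O) a, cmap hyz (cmap hxy a) = cmap hxz a }.

Definition free_copresheaf (G : copresheaf) : Prop :=
  forall x, is_free_abelian (G x).

Definition constant_copresheaf (A : zmodType) : copresheaf :=
  @Copresheaf (fun _ => A) (fun _ _ _ => add_id A) (fun _ _ _ => erefl)
    (fun _ _ _ _ _ _ _ => erefl).

End Presheaves.

Arguments pres {d P} p {x y} h.
Arguments cmap {d P} c {x y} h.
Arguments constant_copresheaf {d} P A.

Section Pullback.
Context {d d' : Order.disp_t} {Q : porderType d} {P : porderType d'}.
Variable f : {omorphism Q -> P}.

Definition pullback_presheaf (F : presheaf P) : presheaf Q :=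
  @Presheaf d Q (fun q => F (f q)) (fun x y h => pres F (omorph_le f h))
    (fun x h => pres_id (omorph_le f h))
    (fun x y z hxy hyz hxz => pres_comp (omorph_le f hxy)
       (omorph_le f hyz) (omorph_le f hxz)).

Definition pullback_copresheaf (G : copresheaf P) : copresheaf Q :=
  @Copresheaf d Q (fun q => G (f q)) (fun x y h => cmap G (omorph_le f h))
    (fun x h => cmap_id (omorph_le f h))
    (fun x y z hxy hyz hxz => cmap_comp (omorph_le f hxy)
       (omorph_le f hyz) (omorph_le f hxz)).

(* A morphism over [f] from [E] to [F] is a morphism [E -> f^*F] of
   (co)presheaves on [Q]. *)
Record pmor (E : presheaf Q) (F : presheaf P) := PMor {
  pmor_fun :> forall q, {additive E q -> F (f q)};
  pmor_nat : forall (x y : Q) (h : (x <= y)%O) (h' : (f x <= f y)%O) a,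
    pmor_fun x (pres E h a) = pres F h' (pmor_fun y a) }.

Record cmor (E : copresheaf Q) (F : copresheaf P) := CMor {
  cmor_fun :> forall q, {additive E q -> F (f q)};
  cmor_nat : forall (x y : Q) (h : (x <= y)%O) (h' : (f x <= f y)%O) a,
    cmor_fun y (cmap E h a) = cmap F h' (cmor_fun x a) }.

Fact constant_cmor_nat (A : zmodType) (x y : Q) (h : (x <= y)%O)
    (h' : (f x <= f y)%O) (a : A) :
  add_id A (cmap (constant_copresheaf Q A) h a) =
  cmap (constant_copresheaf P A) h' (add_id A a).
Proof. by []. Qed.

Definition constant_cmor (A : zmodType) :
    cmor (constant_copresheaf Q A) (constant_copresheaf P A) :=
  @CMor (constant_copresheaf Q A) (constant_copresheaf P A)
    (fun=> add_id A) (@constant_cmor_nat A).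

End Pullback.

Section Morphisms.
Context {d : Order.disp_t} {P : porderType d}.

Definition psh_hom (E F : presheaf P) := pmor idfun E F.

Fact pmor_id_nat (F : presheaf P) (x y : P) (h : (x <= y)%O)
  (h' : (idfun x <= idfun y)%O) a : add_id _ (pres F h a) = pres F h' (add_id (F y) a).
Proof. by rewrite (eq_irrelevance h h'). Qed.

Definition pmor_id (F : presheaf P) : psh_hom F F :=
  @PMor _ _ P P idfun F F (fun x => add_id (F x)) (@pmor_id_nat F).

Fact cmor_id_nat (F : copresheaf P) (x y : P) (h : (x <= y)%O)
  (h' : (idfun x <= idfun y)%O) a : add_id _ (cmap F h a) = cmap F h' (add_id (F x) a).
Proof. by rewrite (eq_irrelevance h h'). Qed.

Definition cmor_id (F : copresheaf P) : cmor idfun F F :=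
  @CMor _ _ P P idfun F F (fun x => add_id (F x)) (@cmor_id_nat F).

End Morphisms.

Section Composition.
Context {d d' d'' : Order.disp_t}.
Context {R : porderType d} {Q : porderType d'} {P : porderType d''}.
Variables (f : {omorphism R -> Q}) (g : {omorphism Q -> P}).
Variables (D : presheaf R) (E : presheaf Q) (F : presheaf P).
Variables (phi : pmor f D E) (psi : pmor g E F).

Fact pmor_comp_nat (x y : R) (h : (x <= y)%O) (h' : ((g \o f) x <= (g \o f) y)%O) a :
  add_comp (psi (f x)) (phi x) (pres D h a) = pres F h' (add_comp (psi (f y)) (phi y) a).
Proof. by rewrite !add_compE (pmor_nat phi h (omorph_le f h)); apply: pmor_nat. Qed.

Definition pmor_comp : pmor (g \o f) D F :=
  PMor (f := g \o f) (pmor_fun := fun x => add_comp (psi (f x)) (phi x)) pmor_comp_nat.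

End Composition.

Section HomComposition.
Context {d : Order.disp_t} {P : porderType d}.
Variables (D E F : presheaf P) (phi : psh_hom D E) (psi : psh_hom E F).

Fact psh_comp_nat (x y : P) (h : (x <= y)%O) (h' : (idfun x <= idfun y)%O) a :
  add_comp (psi x) (phi x) (pres D h a) = pres F h' (add_comp (psi y) (phi y) a).
Proof. by rewrite !add_compE (pmor_nat phi h h); apply: pmor_nat. Qed.

Definition psh_comp : psh_hom D F :=
  @PMor _ _ P P idfun D F (fun x => add_comp (psi x) (phi x)) psh_comp_nat.

End HomComposition.

Lemma pmor_eq d d' (Q : porderType d) (P : porderType d') (f : {omorphism Q -> P})
    (E : presheaf Q) (F : presheaf P) (phi psi : pmor f E F) :
  (forall q a, phi q a = psi q a) -> phi = psi.
Proof.
case: phi psi => phi phin [psi psin] /= E1.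
have {}E1 : phi = psi.
  apply: functional_extensionality_dep => q.
  have := E1 q; case: (phi q) (psi q) => [u [[uh]]] [v [[vh]]] /= uv.
  have {}uv : u = v by exact: funext.
  by subst v; rewrite (Prop_irrelevance uh vh).
by subst psi; congr PMor; exact: Prop_irrelevance.
Qed.

Lemma omor_eq d d' (Q : porderType d) (P : porderType d') (f g : {omorphism Q -> P}) :
  f =1 g -> f = g.
Proof.
case: f g => [u [[uh]]] [v [[vh]]] /= uv.
have {}uv : u = v by exact: funext.
by subst v; rewrite (Prop_irrelevance uh vh).
Qed.

(* Equality of morphisms over two order preserving maps that agree only
   propositionally. *)
Definition pmor_pair d d' (Q : porderType d) (P : porderType d')
    (E : presheaf Q) (F : presheaf P) (f : {omorphism Q -> P}) (phi : pmor f E F) :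
    {f : {omorphism Q -> P} & pmor f E F} :=
  existT (fun f : {omorphism Q -> P} => pmor f E F) f phi.

Definition germ d (P : porderType d) (F : presheaf P) (p : P) (a : F p) :
    {p : P & F p} := Tagged (pob F) a.

Lemma germ_inj d (P : porderType d) (F : presheaf P) (p : P) (a b : F p) :
  germ a = germ b -> a = b.
Proof. by move=> /eqP; rewrite /germ eq_Tagged => /eqP. Qed.

Lemma pmor_pair_eq d d' (Q : porderType d) (P : porderType d')
    (f g : {omorphism Q -> P}) (E : presheaf Q) (F : presheaf P)
    (phi : pmor f E F) (psi : pmor g E F) :
  (forall q a, germ (phi q a) = germ (psi q a)) -> pmor_pair phi = pmor_pair psi.
Proof.
move=> H; have fg : f = g by apply: omor_eq => q; exact: (congr1 tag (H q 0)).
by subst g; congr pmor_pair; apply: pmor_eq => q a; apply: germ_inj.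
Qed.

(* Epimorphisms of presheaves are the pointwise surjective morphisms, so this is
   projectivity in the category of presheaves. *)

Section Projective.
Context {d : Order.disp_t} {P : porderType d}.

Definition projective (R : presheaf P) : Prop :=
  forall (M N : presheaf P) (e : psh_hom M N) (g : psh_hom R N),
    (forall x b, exists a, e x a = b) ->
    exists g' : psh_hom R M, forall x r, e x (g' x r) = g x r.

Record proj_resolution (F : presheaf P) := ProjResolution {
  res_ob :> nat -> presheaf P;
  res_diff : forall n, psh_hom (res_ob n.+1) (res_ob n);
  res_aug : psh_hom (res_ob 0) F;
  res_projective : forall n, projective (res_ob n);
  res_aug_surj : forall x a, exists b, res_aug x b = a;
  res_aug_exact : forall x b, res_aug x b = 0 <-> exists c, res_diff 0 x c = b;
  res_diff_exact : forall n x b,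
    res_diff n x b = 0 <-> exists c, res_diff n.+1 x c = b }.

End Projective.

(* The projective cover [cover F]: the direct sum, over all [p : P] and
   [s : F p], of the free presheaves [x |-> Z[Hom(x, p)]].  Its counit sends the
   generator [(p, s)] at [x <= p] to the restriction of [s] to [x]. *)

Section Cover.
Context {d : Order.disp_t} {P : porderType d}.
Variable F : presheaf P.

Record cover_gen (x : P) := CoverGen {
  gen_pt : P;
  gen_elt : F gen_pt;
  gen_le : (x <= gen_pt)%O }.

HB.instance Definition _ x := gen_eqMixin (cover_gen x).
HB.instance Definition _ x := gen_choiceMixin (cover_gen x).

Lemma cover_gen_eq (x : P) (s t : cover_gen x) :
  germ (gen_elt s) = germ (gen_elt t) -> s = t.
Proof.
case: s t => p a h [q b h'] /= e.
have pq : p = q := congr1 tag e.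
by subst q; rewrite (germ_inj e) (eq_irrelevance h h').
Qed.

Definition restrict_gen (x y : P) (h : (x <= y)%O) (s : cover_gen y) : cover_gen x :=
  CoverGen (gen_elt s) (le_trans h (gen_le s)).

Notation cover_ob x := (freeab (cover_gen x)).

Definition cover_res (x y : P) (h : (x <= y)%O) :
  {additive cover_ob y -> cover_ob x} := freeab_map (restrict_gen h).

Lemma cover_resE (x y : P) (h : (x <= y)%O) s :
  cover_res h (fgen s) = fgen (restrict_gen h s).
Proof. exact: freeab_mapE. Qed.

Fact cover_res_id (x : P) (h : (x <= x)%O) a : cover_res h a = a.
Proof.
apply: (freeab_ext (f := cover_res h) (g := add_id _)) => s.
rewrite cover_resE.
by congr fgen; apply: cover_gen_eq.
Qed.

Fact cover_res_comp (x y z : P) (hxy : (x <= y)%O) (hyz : (y <= z)%O)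
  (hxz : (x <= z)%O) a : cover_res hxy (cover_res hyz a) = cover_res hxz a.
Proof.
apply: (freeab_ext (f := add_comp (cover_res hxy) (cover_res hyz)) (g := cover_res hxz)) => s.
by rewrite add_compE !cover_resE; congr fgen; apply: cover_gen_eq.
Qed.

Definition cover : presheaf P := Presheaf cover_res_id cover_res_comp.

Definition counit_fun (x : P) : {additive cover x -> F x} :=
  freeab_lift (fun s : cover_gen x => pres F (gen_le s) (gen_elt s)).

Fact counit_nat (x y : P) (h : (x <= y)%O) (h' : (idfun x <= idfun y)%O) a :
  counit_fun x (pres cover h a) = pres F h' (counit_fun y a).
Proof.
apply: (freeab_ext (f := add_comp (counit_fun x) (pres cover h))
                   (g := add_comp (pres F h') (counit_fun y))) => s.
rewrite !add_compE [pres cover h _]cover_resE !freeab_liftE.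
exact/esym/pres_comp.
Qed.

Definition counit : psh_hom cover F := @PMor _ _ P P idfun cover F counit_fun counit_nat.

Lemma counitE (x p : P) (a : F p) (h : (x <= p)%O) :
  counit x (fgen (CoverGen a h)) = pres F h a.
Proof.
exact: freeab_liftE.
Qed.

Lemma counit_surj (x : P) (a : F x) : exists b, counit x b = a.
Proof. by exists (fgen (CoverGen (gen_pt := x) a (lexx x))); rewrite counitE pres_id. Qed.

Lemma cover_projective : projective cover.
Proof.
move=> M N e g e_surj.
pose unit_gen (s : {p : P & F p}) : cover (tag s) := fgen (CoverGen (tagged s) (lexx _)).
have lift0 (s : {p : P & F p}) : {m : M (tag s) | e _ m = g _ (unit_gen s)}.
  exact/cid/e_surj.
pose lift p (a : F p) : M p := sval (lift0 (germ a)).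
have liftP p (a : F p) : e p (lift p a) = g p (unit_gen (germ a)).
  exact: (svalP (lift0 (germ a))).
pose l x : {additive cover x -> M x} :=
  freeab_lift (fun s : cover_gen x => pres M (gen_le s) (lift _ (gen_elt s))).
have l_nat (x y : P) (h : (x <= y)%O) (h' : (idfun x <= idfun y)%O) a :
    l x (pres cover h a) = pres M h' (l y a).
  apply: (freeab_ext (f := add_comp (l x) (pres cover h))
                     (g := add_comp (pres M h') (l y))) => s.
  rewrite !add_compE [pres cover h _]cover_resE !freeab_liftE.
  exact/esym/pres_comp.
exists (@PMor _ _ P P idfun cover M l l_nat) => x r.
apply: (freeab_ext (f := add_comp (e x) (l x)) (g := g x)) => s.
rewrite add_compE freeab_liftE (pmor_nat e (gen_le s) (gen_le s)) liftP.
rewrite -(pmor_nat g (gen_le s) (gen_le s)) [pres cover _ _]cover_resE.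
by congr (g x (fgen _)); apply: cover_gen_eq.
Qed.

End Cover.

Section KernelPresheaf.
Context {d : Order.disp_t} {P : porderType d}.
Variables (E F : presheaf P) (phi : psh_hom E F).

Fact ker_psh_subproof (x y : P) (h : (x <= y)%O) a :
  a \in kernel (phi y) -> pres E h a \in kernel (phi x).
Proof. by move=> /kernelP pa; apply/kernelP; rewrite (pmor_nat phi h h) pa raddf0. Qed.

Definition ker_psh_res (x y : P) (h : (x <= y)%O) :
    {additive sub_of (kernel (phi y)) -> sub_of (kernel (phi x))} :=
  sub_map (ker_psh_subproof h).

Fact ker_psh_id (x : P) (h : (x <= x)%O) a : ker_psh_res h a = a.
Proof. by apply: val_inj; apply: pres_id. Qed.

Fact ker_psh_comp (x y z : P) (hxy : (x <= y)%O) (hyz : (y <= z)%O)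
  (hxz : (x <= z)%O) a : ker_psh_res hxy (ker_psh_res hyz a) = ker_psh_res hxz a.
Proof. by apply: val_inj; apply: pres_comp. Qed.

Definition ker_psh : presheaf P := Presheaf ker_psh_id ker_psh_comp.

Fact ker_incl_nat (x y : P) (h : (x <= y)%O) (h' : (idfun x <= idfun y)%O)
    (a : ker_psh y) :
  sub_val (pres ker_psh h a) = pres E h' (sub_val a).
Proof. by rewrite (eq_irrelevance h h'). Qed.

Definition ker_incl : psh_hom ker_psh E :=
  @PMor _ _ P P idfun ker_psh E (fun x => @sub_val (E x) (kernel (phi x))) ker_incl_nat.

End KernelPresheaf.

(* The standard resolution  ... -> cover K_1 -> cover K_0 -> F  with [K_0 = F]
   and [K_(n+1)] the kernel of the counit [cover K_n -> K_n]. *)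
Section StandardResolution.
Context {d : Order.disp_t} {P : porderType d}.
Variable F : presheaf P.

Fixpoint syzygy (n : nat) : presheaf P :=
  if n is n'.+1 then ker_psh (counit (syzygy n')) else F.

Definition std_ob (n : nat) : presheaf P := cover (syzygy n).

Definition std_diff (n : nat) : psh_hom (std_ob n.+1) (std_ob n) :=
  psh_comp (counit (syzygy n.+1)) (ker_incl (counit (syzygy n))).

Definition std_aug : psh_hom (std_ob 0) F := counit F.

Lemma std_diffE n x b : std_diff n x b = sub_val (counit (syzygy n.+1) x b).
Proof. by []. Qed.

Fact std_aug_exact x b : std_aug x b = 0 <-> exists c, std_diff 0 x c = b.
Proof.
split=> [b0|[c <-]]; last by apply/kernelP; exact: sub_valP.
have bK : b \in kernel (counit (syzygy 0) x) by apply/kernelP.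
by have [c cE] := counit_surj (F := syzygy 1) (SubOf bK); exists c; rewrite std_diffE cE.
Qed.

Fact std_diff_exact n x b :
  std_diff n x b = 0 <-> exists c, std_diff n.+1 x c = b.
Proof.
have E c : std_diff n x c = 0 <-> counit (syzygy n.+1) x c = 0.
  rewrite std_diffE; split=> [c0|->]; last exact: raddf0.
  by apply: val_inj; rewrite raddf0.
split=> [/E b0|[c <-]]; last by apply/E/kernelP; exact: sub_valP.
have bK : b \in kernel (counit (syzygy n.+1) x) by apply/kernelP.
have [c cE] := counit_surj (F := syzygy n.+2) (SubOf bK).
by exists c; rewrite std_diffE cE.
Qed.

Definition std_resolution : proj_resolution F :=
  ProjResolution (fun n => @cover_projective d P (syzygy n)) (counit_surj (F := F))
    std_aug_exact std_diff_exact.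

End StandardResolution.

Section CoverMap.
Context {d d' : Order.disp_t} {Q : porderType d} {P : porderType d'}.
Variables (f : {omorphism Q -> P}) (E : presheaf Q) (F : presheaf P).
Variable phi : pmor f E F.

Definition gen_map (q : Q) (s : cover_gen E q) : cover_gen F (f q) :=
  CoverGen (phi _ (gen_elt s)) (omorph_le f (gen_le s)).

Definition cover_map_fun (q : Q) : {additive cover E q -> cover F (f q)} :=
  freeab_map (@gen_map q).

Fact cover_map_nat (x y : Q) (h : (x <= y)%O) (h' : (f x <= f y)%O) a :
  cover_map_fun x (pres (cover E) h a) = pres (cover F) h' (cover_map_fun y a).
Proof.
apply: (freeab_ext (f := add_comp (cover_map_fun x) (pres (cover E) h))
                   (g := add_comp (pres (cover F) h') (cover_map_fun y))) => s.
rewrite !add_compE [pres (cover E) h _]cover_resE !freeab_mapE.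
by congr fgen; apply: cover_gen_eq.
Qed.

Definition cover_map : pmor f (cover E) (cover F) := PMor cover_map_nat.

Lemma cover_mapE q (s : cover_gen E q) : cover_map q (fgen s) = fgen (gen_map s).
Proof. exact: freeab_mapE. Qed.

Lemma counit_cover_map q a : phi q (counit E q a) = counit F (f q) (cover_map q a).
Proof.
apply: (freeab_ext (f := add_comp (phi q) (counit E q))
                   (g := add_comp (counit F (f q)) (cover_map q))) => s.
rewrite !add_compE cover_mapE [counit E q _]freeab_liftE [counit F _ _]freeab_liftE.
exact: pmor_nat.
Qed.

End CoverMap.

Section KernelMap.
Context {d d' : Order.disp_t} {Q : porderType d} {P : porderType d'}.
Variables (f : {omorphism Q -> P}) (E E' : presheaf Q) (F F' : presheaf P).
Variables (u : psh_hom E E') (v : psh_hom F F').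
Variables (phi : pmor f E F) (phi' : pmor f E' F').
Hypothesis comm : forall q a, phi' q (u q a) = v (f q) (phi q a).

Fact ker_map_subproof q a : a \in kernel (u q) -> phi q a \in kernel (v (f q)).
Proof. by move=> /kernelP ua; apply/kernelP; rewrite -comm ua raddf0. Qed.

Definition ker_map_fun q : {additive ker_psh u q -> ker_psh v (f q)} :=
  sub_map (@ker_map_subproof q).

Fact ker_map_nat (x y : Q) (h : (x <= y)%O) (h' : (f x <= f y)%O) a :
  ker_map_fun x (pres (ker_psh u) h a) = pres (ker_psh v) h' (ker_map_fun y a).
Proof. by apply: val_inj; apply: (pmor_nat phi). Qed.

Definition ker_map : pmor f (ker_psh u) (ker_psh v) := PMor ker_map_nat.

Lemma ker_mapE q a : sub_val (ker_map q a) = phi q (sub_val a).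
Proof. by []. Qed.

End KernelMap.

Section StandardMap.
Context {d d' : Order.disp_t} {Q : porderType d} {P : porderType d'}.
Variables (f : {omorphism Q -> P}) (E : presheaf Q) (F : presheaf P).
Variable phi : pmor f E F.

Fixpoint syz_map (n : nat) : pmor f (syzygy E n) (syzygy F n) :=
  if n is n'.+1 then ker_map (counit_cover_map (syz_map n')) else phi.

Definition std_map (n : nat) : pmor f (std_ob E n) (std_ob F n) :=
  cover_map (syz_map n).

Lemma std_map_diff n q a :
  std_map n q (std_diff E n q a) = std_diff F n (f q) (std_map n.+1 q a).
Proof.
exact: (congr1 (@sub_val _ (kernel (counit (syzygy F n) (f q))))
  (counit_cover_map (syz_map n.+1) a)).
Qed.

End StandardMap.

Section StandardMapFunctor.
Context {d d' d'' : Order.disp_t}.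
Context {R : porderType d} {Q : porderType d'} {P : porderType d''}.

Lemma syz_map_id (F : presheaf P) n q a : syz_map (pmor_id F) n q a = a.
Proof.
elim: n q a => [//|n IHn] q a; apply: val_inj.
rewrite [LHS]ker_mapE.
apply: (freeab_ext (f := cover_map (syz_map (pmor_id F) n) q) (g := add_id _)) => s.
by rewrite cover_mapE; congr fgen; apply: cover_gen_eq; rewrite /= IHn.
Qed.

Lemma std_map_id (F : presheaf P) n q a : std_map (pmor_id F) n q a = a.
Proof.
apply: (freeab_ext (f := std_map (pmor_id F) n q) (g := add_id _)) => s.
by rewrite cover_mapE; congr fgen; apply: cover_gen_eq; rewrite /= syz_map_id.
Qed.

Variables (f : {omorphism R -> Q}) (g : {omorphism Q -> P}).
Variables (D : presheaf R) (E : presheaf Q) (F : presheaf P).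
Variables (phi : pmor f D E) (psi : pmor g E F).

Lemma syz_map_comp n r a :
  syz_map (pmor_comp phi psi) n r a = syz_map psi n (f r) (syz_map phi n r a).
Proof.
elim: n r a => [//|n IHn] r a; apply: val_inj.
change (cover_map (syz_map (pmor_comp phi psi) n) r (sub_val a) =
  cover_map (syz_map psi n) (f r) (cover_map (syz_map phi n) r (sub_val a))).
apply: (freeab_ext (f := cover_map (syz_map (pmor_comp phi psi) n) r)
  (g := add_comp (cover_map (syz_map psi n) (f r)) (cover_map (syz_map phi n) r))) => s.
rewrite add_compE !cover_mapE; congr fgen; apply: cover_gen_eq.
by rewrite /= IHn.
Qed.

Lemma std_map_comp n r a :
  std_map (pmor_comp phi psi) n r a = std_map psi n (f r) (std_map phi n r a).
Proof.
apply: (freeab_ext (f := std_map (pmor_comp phi psi) n r)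
  (g := add_comp (std_map psi n (f r)) (std_map phi n r))) => s.
rewrite add_compE !cover_mapE; congr fgen; apply: cover_gen_eq.
by rewrite /= syz_map_comp.
Qed.

End StandardMapFunctor.

Section PresheafTensor.
Context {d : Order.disp_t} {P : porderType d}.
Variables (F : presheaf P) (G : copresheaf P).

(* the pairs [(x, y)] with [y <= x] *)
Definition rel_pair : choiceType := {xy : P * P | (xy.2 <= xy.1)%O}.

Definition tens_rel : zmodType :=
  dsum (fun xy : rel_pair => tensor (F (sval xy).1) (G (sval xy).2)).

Definition tens_sum : zmodType := dsum (fun p : P => tensor (F p) (G p)).

Definition tens_in (p : P) : {additive tensor (F p) (G p) -> tens_sum} :=
  din (fun p => tensor (F p) (G p)) p.

Definition tens_l : {additive tens_rel -> tens_sum} :=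
  dsum_lift (fun xy => add_comp (tens_in (sval xy).2)
                         (tensor_map (pres F (svalP xy)) (add_id _))).

Definition tens_r : {additive tens_rel -> tens_sum} :=
  dsum_lift (fun xy => add_comp (tens_in (sval xy).1)
                         (tensor_map (add_id _) (cmap G (svalP xy)))).

(* The coequalizer of [tens_l] and [tens_r]. *)
Definition psh_tensor : zmodType := {ideal_quot image_of (add_sub tens_l tens_r)}.

Definition tens_pi : {additive tens_sum -> psh_tensor} := quot_pi _.

Lemma psh_tensor_ext (C : zmodType) (u v : {additive psh_tensor -> C}) :
  (forall p a b, u (tens_pi (tens_in p (pure a b))) = v (tens_pi (tens_in p (pure a b)))) ->
  u =1 v.
Proof.
move=> uv t; have [x <-] := quot_piP t.
apply: (dsum_ext (f := add_comp u tens_pi) (g := add_comp v tens_pi)) => p y.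
apply: (tensor_ext (f := add_comp u (add_comp tens_pi (tens_in p)))
                   (g := add_comp v (add_comp tens_pi (tens_in p)))) => a b.
exact: uv.
Qed.

Lemma tens_lr z : tens_pi (tens_l z) = tens_pi (tens_r z).
Proof. by apply/quot_eqP/imageP; exists z. Qed.

Lemma tens_balance (x y : P) (h : (y <= x)%O) (a : F x) (b : G y) :
  tens_pi (tens_in y (pure (pres F h a) b)) = tens_pi (tens_in x (pure a (cmap G h b))).
Proof.
pose xy : rel_pair := exist (fun xy : P * P => (xy.2 <= xy.1)%O) (x, y) h.
have := tens_lr (din _ xy (pure a b)).
rewrite /tens_l /tens_r !dsum_liftE !add_compE !tensor_mapE /=.
by rewrite (eq_irrelevance (svalP xy) h).
Qed.

End PresheafTensor.

Section PresheafTensorMap.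
Context {d d' : Order.disp_t} {Q : porderType d} {P : porderType d'}.
Variables (f : {omorphism Q -> P}) (E : presheaf Q) (F : presheaf P).
Variables (G : copresheaf Q) (H : copresheaf P).
Variables (phi : pmor f E F) (gamma : cmor f G H).

Definition tens_sum_map : {additive tens_sum E G -> tens_sum F H} :=
  dsum_lift (fun q => add_comp (tens_in F H (f q)) (tensor_map (phi q) (gamma q))).

Lemma tens_sum_mapE q a b :
  tens_sum_map (tens_in E G q (pure a b)) = tens_in F H (f q) (pure (phi q a) (gamma q b)).
Proof. by rewrite /tens_sum_map dsum_liftE add_compE tensor_mapE. Qed.

Fact tens_map_subproof z : z \in image_of (add_sub (tens_l E G) (tens_r E G)) ->
  tens_sum_map z \in image_of (add_sub (tens_l F H) (tens_r F H)).
Proof.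
move=> /imageP[w <-]; apply/quot_eq0.
rewrite add_subE !raddfB; apply/eqP; rewrite subr_eq0; apply/eqP.
pose T := add_comp (tens_pi F H) tens_sum_map.
apply: (dsum_ext (f := add_comp T (tens_l E G)) (g := add_comp T (tens_r E G))) => xy t.
apply: (tensor_ext (f := add_comp (add_comp T (tens_l E G)) (din _ xy))
                   (g := add_comp (add_comp T (tens_r E G)) (din _ xy))) => a b.
rewrite /T !add_compE /tens_l /tens_r !dsum_liftE !add_compE !tensor_mapE.
rewrite (pmor_nat phi _ (omorph_le f (svalP xy))).
rewrite (cmor_nat gamma _ (omorph_le f (svalP xy))).
exact: tens_balance.
Qed.

Definition tens_map : {additive psh_tensor E G -> psh_tensor F H} :=
  quot_map tens_map_subproof.

Lemma tens_mapE q a b :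
  tens_map (tens_pi E G (tens_in E G q (pure a b))) =
  tens_pi F H (tens_in F H (f q) (pure (phi q a) (gamma q b))).
Proof. by rewrite -tens_sum_mapE; exact: quot_mapE. Qed.

End PresheafTensorMap.

Lemma tens_map_square d d' (Q : porderType d) (P : porderType d')
    (f : {omorphism Q -> P}) (E E' : presheaf Q) (F F' : presheaf P)
    (G : copresheaf Q) (H : copresheaf P) (u : psh_hom E E') (v : psh_hom F F')
    (phi : pmor f E F) (phi' : pmor f E' F') (gamma : cmor f G H) :
  (forall q a, phi' q (u q a) = v (f q) (phi q a)) ->
  forall x, tens_map phi' gamma (tens_map u (cmor_id G) x) =
            tens_map v (cmor_id H) (tens_map phi gamma x).
Proof.
move=> comm; pose L := add_comp (tens_map phi' gamma) (tens_map u (cmor_id G)).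
apply: (psh_tensor_ext (u := L)
  (v := add_comp (tens_map v (cmor_id H)) (tens_map phi gamma))) => q a b.
by rewrite !add_compE !tens_mapE comm.
Qed.

Record chain_complex := ChainComplex {
  ch_ob :> nat -> zmodType;
  ch_diff : forall n, {additive ch_ob n.+1 -> ch_ob n};
  ch_diff_sq : forall n x, ch_diff n (ch_diff n.+1 x) = 0 }.

Definition cycles (C : chain_complex) (n : nat) : zmodClosed (C n) :=
  if n is n'.+1 then kernel (ch_diff C n') else whole _.

Definition boundaries (C : chain_complex) (n : nat) : zmodClosed (C n) :=
  image_of (ch_diff C n).

Definition homology (C : chain_complex) (n : nat) : zmodType :=
  subquot (cycles C n) (boundaries C n).

Record chain_map (C D : chain_complex) := ChainMap {
  chm :> forall n, {additive C n -> D n};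
  chm_comm : forall n x, chm n (ch_diff C n x) = ch_diff D n (chm n.+1 x) }.

Section HomologyMap.
Variables (C D : chain_complex) (u : chain_map C D).

Fact chm_cycles n x : x \in cycles C n -> u n x \in cycles D n.
Proof.
case: n x => [//|n] x /= /kernelP xZ.
by apply/kernelP; rewrite -chm_comm xZ raddf0.
Qed.

Fact chm_boundaries n x : x \in boundaries C n -> u n x \in boundaries D n.
Proof.
by move=> /imageP[y <-]; apply/imageP; exists (u n.+1 y); rewrite chm_comm.
Qed.

Definition homology_map n : {additive homology C n -> homology D n} :=
  subquot_map (@chm_cycles n) (@chm_boundaries n).

Lemma homology_mapE n (z : sub_of (cycles C n)) :
  homology_map n (quot_pi _ z) = quot_pi _ (sub_map (@chm_cycles n) z).
Proof. exact: quot_mapE. Qed.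

End HomologyMap.

Section Tor.
Context {d : Order.disp_t} {P : porderType d}.

Fact tensor_complex_sq (F : presheaf P) (R : proj_resolution F) (G : copresheaf P) n x :
  tens_map (res_diff R n) (cmor_id G) (tens_map (res_diff R n.+1) (cmor_id G) x) = 0.
Proof.
pose D n := tens_map (res_diff R n) (cmor_id G).
apply: (psh_tensor_ext (u := add_comp (D n) (D n.+1)) (v := add_zero _ _)) => p a b.
rewrite add_compE /D !tens_mapE.
have -> : res_diff R n p (res_diff R n.+1 p a) = 0.
  by apply/res_diff_exact; exists a.
by rewrite pure0l !raddf0.
Qed.

Definition tensor_complex (F : presheaf P) (R : proj_resolution F) (G : copresheaf P) :
    chain_complex :=
  ChainComplex (@tensor_complex_sq F R G).

(* The left derived functors of [- (x)_P G], computed on the standard projective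
   resolution of [F]. *)
Definition Tor (n : nat) (F : presheaf P) (G : copresheaf P) : zmodType :=
  homology (tensor_complex (std_resolution F) G) n.

Definition poset_homology (n : nat) (F : presheaf P) : zmodType :=
  Tor n F (constant_copresheaf P int).

End Tor.

Section TorMap.
Context {d d' : Order.disp_t} {Q : porderType d} {P : porderType d'}.
Variables (f : {omorphism Q -> P}) (E : presheaf Q) (F : presheaf P).
Variables (G : copresheaf Q) (H : copresheaf P).
Variables (phi : pmor f E F) (gamma : cmor f G H).

Definition tor_chain_fun n :
  {additive tensor_complex (std_resolution E) G n ->
            tensor_complex (std_resolution F) H n} :=
  tens_map (std_map phi n) gamma.

Fact tor_chain_comm n x :
  tor_chain_fun n (ch_diff (tensor_complex (std_resolution E) G) n x) =
  ch_diff (tensor_complex (std_resolution F) H) n (tor_chain_fun n.+1 x).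
Proof.
exact: (tens_map_square gamma (std_map_diff phi (n := n))).
Qed.

Definition tor_chain_map := ChainMap tor_chain_comm.

Definition Tor_map (n : nat) : {additive Tor n E G -> Tor n F H} :=
  homology_map tor_chain_map n.

End TorMap.

Lemma homology_map_id (C : chain_complex) (u : chain_map C C) n :
  (forall x, u n x = x) -> forall z, homology_map u n z = z.
Proof.
move=> uid z; have [x <-] := quot_piP z; rewrite homology_mapE.
by congr (quot_pi _ _); apply: val_inj; apply: uid.
Qed.

Lemma homology_map_comp (C D E : chain_complex) (u : chain_map C D)
    (v : chain_map D E) (w : chain_map C E) n :
  (forall x, w n x = v n (u n x)) ->
  forall z, homology_map w n z = homology_map v n (homology_map u n z).
Proof.
move=> wuv z; have [x <-] := quot_piP z.
rewrite (homology_mapE w) (homology_mapE u) (homology_mapE v).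
by congr (quot_pi _ _); apply: val_inj; exact: (wuv (sub_val x)).
Qed.

Section PosetHomologyMap.
Context {d d' : Order.disp_t} {Q : porderType d} {P : porderType d'}.

Definition poset_homology_map (f : {omorphism Q -> P}) (E : presheaf Q)
    (F : presheaf P) (phi : pmor f E F) (n : nat) :
    {additive poset_homology n E -> poset_homology n F} :=
  Tor_map phi (constant_cmor f int) n.

Lemma poset_homology_map_eq (f g : {omorphism Q -> P}) (E : presheaf Q)
    (F : presheaf P) (phi : pmor f E F) (psi : pmor g E F) n z :
  (forall q a, germ (phi q a) = germ (psi q a)) ->
  poset_homology_map phi n z = poset_homology_map psi n z.
Proof.
move=> /pmor_pair_eq E1.
pose H (t : {f : {omorphism Q -> P} & pmor f E F}) :=
  poset_homology_map (projT2 t) n z.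
exact: (congr1 H E1).
Qed.

End PosetHomologyMap.

Lemma poset_homology_map_id d (P : porderType d) (F : presheaf P) n z :
  poset_homology_map (pmor_id F) n z = z.
Proof.
apply: homology_map_id => x.
apply: (psh_tensor_ext (u := tor_chain_fun (pmor_id F) (constant_cmor idfun int) n)
          (v := add_id _)) => p a b.
by rewrite /tor_chain_fun tens_mapE std_map_id.
Qed.

Lemma poset_homology_map_comp d d' d'' (R : porderType d) (Q : porderType d')
    (P : porderType d'') (f : {omorphism R -> Q}) (g : {omorphism Q -> P})
    (D : presheaf R) (E : presheaf Q) (F : presheaf P)
    (phi : pmor f D E) (psi : pmor g E F) n z :
  poset_homology_map (pmor_comp phi psi) n z =
  poset_homology_map psi n (poset_homology_map phi n z).
Proof.
apply: homology_map_comp => x.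
apply: (psh_tensor_ext
  (u := tor_chain_fun (pmor_comp phi psi) (constant_cmor (g \o f) int) n)
  (v := add_comp (tor_chain_fun psi (constant_cmor g int) n)
                 (tor_chain_fun phi (constant_cmor f int) n))) => r a b.
by rewrite add_compE /tor_chain_fun !tens_mapE std_map_comp.
Qed.

Definition omorphism_of d d' (Q : porderType d) (P : porderType d') (f : Q -> P)
    (h : {homo f : x y / (x <= y)%O}) : {omorphism Q -> P} :=
  HB.pack_for {omorphism Q -> P} f (Order.isOrderMorphism.Build d Q d' P f h).

(* contravariant *)
Record poset_functor d d' (B : porderType d) := PosetFunctor {
  pf_ob :> B -> porderType d';
  pf_map : forall x y : B, (x <= y)%O -> {omorphism pf_ob y -> pf_ob x};
  pf_id : forall (x : B) (h : (x <= x)%O) a, pf_map h a = a;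
  pf_comp : forall (x y z : B) (hxy : (x <= y)%O) (hyz : (y <= z)%O)
    (hxz : (x <= z)%O) a, pf_map hxy (pf_map hyz a) = pf_map hxz a }.

Arguments poset_functor {d} d' B.
Arguments pf_map {d d' B} p {x y} h.

Section TotalSpace.
Context {d d' : Order.disp_t} {B : porderType d}.
Variable Psi : poset_functor d' B.

Definition total_space : Type := {x : B & Psi x}.

HB.instance Definition _ := Choice.on total_space.

Definition total_pt (x : B) (a : Psi x) : total_space := Tagged (pf_ob Psi) a.

Definition total_le (u v : total_space) : bool :=
  `[< exists h : (tag u <= tag v)%O, (tagged u <= pf_map Psi h (tagged v))%O >].

Fact total_le_refl : reflexive total_le.
Proof. by move=> u; apply/asboolP; exists (lexx _); rewrite pf_id. Qed.

Fact total_le_anti : antisymmetric total_le.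
Proof.
move=> [x a] [y b] /andP[/asboolP[/= hxy ab] /asboolP[/= hyx ba]].
have xy : x = y by apply: le_anti; rewrite hxy.
subst y; rewrite !pf_id in ab ba.
by congr existT; apply: le_anti; rewrite ab.
Qed.

Fact total_le_trans : transitive total_le.
Proof.
move=> v u w /asboolP[huv uv] /asboolP[hvw vw]; apply/asboolP.
exists (le_trans huv hvw); apply: (le_trans uv).
by rewrite -(pf_comp huv hvw); apply: omorph_le.
Qed.

Fact total_display : Order.disp_t. Proof. exact: Order.Disp tt tt. Qed.

HB.instance Definition _ := Order.Le_isPOrder.Build total_display total_space
  total_le_refl total_le_anti total_le_trans.

Lemma total_leP (u v : total_space) : (u <= v)%O <->
  exists h : (tag u <= tag v)%O, (tagged u <= pf_map Psi h (tagged v))%O.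
Proof. by split=> /asboolP. Qed.

Fact fib_proj_homo : {homo (fun u : total_space => tag u) : u v / (u <= v)%O}.
Proof. by move=> u v /total_leP[]. Qed.

Definition fib_proj : {omorphism total_space -> B} := omorphism_of fib_proj_homo.

Fact fiber_incl_homo (x : B) : {homo @total_pt x : a b / (a <= b)%O}.
Proof. by move=> a b ab; apply/total_leP; exists (lexx x); rewrite pf_id. Qed.

Definition fiber_incl (x : B) : {omorphism Psi x -> total_space} :=
  omorphism_of (@fiber_incl_homo x).

Lemma transport_le (x y : B) (h : (x <= y)%O) (b : Psi y) :
  (total_pt (pf_map Psi h b) <= total_pt b)%O.
Proof. by apply/total_leP; exists h. Qed.

Section FiberHomology.
Variable F : presheaf total_space.

Definition fiber_presheaf (x : B) : presheaf (Psi x) :=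
  pullback_presheaf (fiber_incl x) F.

Definition fiber_res_fun (x y : B) (h : (x <= y)%O) (b : Psi y) :
    {additive fiber_presheaf y b -> fiber_presheaf x (pf_map Psi h b)} :=
  pres F (transport_le h b).

Fact fiber_res_nat (x y : B) (h : (x <= y)%O) (b c : Psi y) (k : (b <= c)%O)
    (k' : (pf_map Psi h b <= pf_map Psi h c)%O) a :
  fiber_res_fun h b (pres (fiber_presheaf y) k a) =
  pres (fiber_presheaf x) k' (fiber_res_fun h c a).
Proof.
have L : (total_pt (pf_map Psi h b) <= total_pt c)%O.
  apply: le_trans (transport_le h b) _; exact: fiber_incl_homo.
exact: etrans (pres_comp _ _ L _) (esym (pres_comp _ _ L _)).
Qed.

Definition fiber_res (x y : B) (h : (x <= y)%O) :
    pmor (pf_map Psi h) (fiber_presheaf y) (fiber_presheaf x) :=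
  PMor (fiber_res_nat (h := h)).

Lemma germ_pres_eq (x : B) (p p' : Psi x) (u : total_space)
    (k : (total_pt p <= u)%O) (k' : (total_pt p' <= u)%O) (a : F u) : p = p' ->
  germ (F := fiber_presheaf x) (p := p) (pres F k a) =
  germ (F := fiber_presheaf x) (p := p') (pres F k' a).
Proof. by move=> pp'; subst p'; rewrite (eq_irrelevance k k'). Qed.

Variable n : nat.

Definition fiber_homology_res (x y : B) (h : (x <= y)%O) :
    {additive poset_homology n (fiber_presheaf y) ->
              poset_homology n (fiber_presheaf x)} :=
  poset_homology_map (fiber_res h) n.

Fact fiber_homology_id (x : B) (h : (x <= x)%O) z : fiber_homology_res h z = z.
Proof.
rewrite -[RHS]poset_homology_map_id; apply: poset_homology_map_eq => b a.
rewrite -[in RHS](pres_id (p := F) (lexx (total_pt b)) a).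
by apply: germ_pres_eq; rewrite pf_id.
Qed.

Fact fiber_homology_comp (x y z : B) (hxy : (x <= y)%O) (hyz : (y <= z)%O)
    (hxz : (x <= z)%O) w :
  fiber_homology_res hxy (fiber_homology_res hyz w) = fiber_homology_res hxz w.
Proof.
rewrite /fiber_homology_res -poset_homology_map_comp.
apply: poset_homology_map_eq => b a.
have L : (total_pt (pf_map Psi hxy (pf_map Psi hyz b)) <= total_pt b)%O.
  exact: le_trans (transport_le _ _) (transport_le _ _).
rewrite [X in germ X = _](pres_comp _ _ L).
by apply: germ_pres_eq; exact: pf_comp.
Qed.

Definition fiber_homology : presheaf B :=
  Presheaf fiber_homology_id fiber_homology_comp.

End FiberHomology.
End TotalSpace.

(* First quadrant homological spectral sequences, starting at the second page,
   in which the fiber degree [p] comes first: the differential of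
   [page r] has bidegree [(r - 1, - r)].  It is indexed by its source [(p, q)] and its
   target [(p', q')], so that differentials entering or leaving the first
   quadrant, which are zero, are left out. *)
Record spectral_sequence_data := SpectralSequenceData {
  page :> nat -> nat -> nat -> zmodType;
  sdiff : forall r p q p' q' : nat, (p' + 1 = p + r)%N -> (q = q' + r)%N ->
    {additive page r p q -> page r p' q'} }.

Section Pages.
Variables (E : spectral_sequence_data) (r p q : nat).

Fact page_cycles_zmod_closed : zmod_closed (fun x : E r p q =>
  `[< forall p' q' (hp : (p' + 1 = p + r)%N) (hq : (q = q' + r)%N),
        sdiff E hp hq x = 0 >]).
Proof.
split=> [|x y /asboolP Hx /asboolP Hy]; apply/asboolP => p' q' hp hq.
  exact: raddf0.
by rewrite raddfB Hx Hy subrr.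
Qed.

Definition page_cycles : zmodClosed (E r p q) := subgroup_of page_cycles_zmod_closed.

Fact page_boundaries_zmod_closed : zmod_closed (fun x : E r p q =>
  `[< x = 0 \/ exists p' q' (hp : (p + 1 = p' + r)%N) (hq : (q' = q + r)%N) y,
        sdiff E hp hq y = x >]).
Proof.
split=> [|x y /asboolP Hx /asboolP Hy]; apply/asboolP; first by left.
case: Hx => [->|[p1 [q1 [hp1 [hq1 [u <-]]]]]].
  case: Hy => [->|[p2 [q2 [hp2 [hq2 [v <-]]]]]]; first by left; rewrite subrr.
  by right; exists p2, q2, hp2, hq2, (- v); rewrite raddfN sub0r.
right; case: Hy => [->|[p2 [q2 [hp2 [hq2 [v <-]]]]]].
  by exists p1, q1, hp1, hq1, u; rewrite subr0.
have e1 : p2 = p1 by apply: (@addIn r); rewrite -hp1 -hp2.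
subst p2 q1 q2; exists p1, (q + r)%N, hp1, erefl, (u - v).
by rewrite raddfB (eq_irrelevance hp2 hp1).
Qed.

Definition page_boundaries : zmodClosed (E r p q) :=
  subgroup_of page_boundaries_zmod_closed.

End Pages.

Record spectral_sequence := SpectralSequence {
  ss_data :> spectral_sequence_data;
  ss_sdiff_sq : forall (r p q p' q' p'' q'' : nat), (2 <= r)%N ->
    forall (hp : (p' + 1 = p + r)%N) (hq : (q = q' + r)%N)
      (hp' : (p'' + 1 = p' + r)%N) (hq' : (q' = q'' + r)%N) x,
      sdiff ss_data hp' hq' (sdiff ss_data hp hq x) = 0;
  ss_turn : forall r p q : nat, (2 <= r)%N ->
    zmod_iso (ss_data r.+1 p q)
      (subquot (page_cycles ss_data r p q) (page_boundaries ss_data r p q)) }.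

(* No differential of a page [r >= p + q + 2] enters or leaves position [(p, q)]. *)
Definition page_infty (E : spectral_sequence) (p q : nat) : zmodType :=
  E (p + q + 2)%N p q.

(* [Fil n k] is the step [k - 1] of the filtration of [H n], which is given by the
   degree [q] in the base. *)
Definition converges_to (E : spectral_sequence) (H : nat -> zmodType) : Prop :=
  exists Fil : forall n : nat, nat -> zmodClosed (H n),
    [/\ forall n x, x \in Fil n 0%N -> x = 0,
        forall n k x, x \in Fil n k -> x \in Fil n k.+1,
        forall n x, x \in Fil n n.+1
      & forall p q, zmod_iso (page_infty E p q)
          (subquot (Fil (p + q)%N q.+1) (Fil (p + q)%N q))].

(* Main.v *)
Require Import Defs.
From HB Require Import structures.
From mathcomp Require Import all_boot all_order all_algebra.
From mathcomp Require Import boolp zify.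
(* Again, since [finset] and [fintype] also define [cover] and [imageP]. *)
Import Defs.

(* Let [R] be the standard resolution of [F] on the total space [S], and let [Q] be the
   standard resolution of [G] by copresheaves on [B], that is, the standard
   resolution of [G] as a presheaf on [B^d].  The spectral sequence is that of the
   double complex [R_p (x)_S pi^* Q_q], filtered by [q].  For fixed [p], the rows are exact
   because [R_p] is free, so the total complex computes [Tor^S (F, pi^* G)].  For fixed
   [q], [R_p (x)_S pi^* Q_q] is [pi_! R_p (x)_B Q_q], where [pi_! R_p] has the value
   [colim R_p|Psi(x)] at [x].  Since [R|Psi(x)] is still a flat resolution of [F|Psi(x)],
   [pi_! R] has homology [H_p(Psi; F)], and tensoring with the free [Q_q] is exact, so the
   first page is [H_p(Psi; F) (x)_B Q_q].  Its homology is [Tor^B_q (H_p(Psi; F), G)] by the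
   balance of Tor. *)

Set Implicit Arguments.
Unset Strict Implicit.
Unset Printing Implicit Defensive.
Import Order.TTheory GRing.Theory.
Local Open Scope ring_scope.

(** * Subquotients and filtered complexes *)

(** The delicate point is that the identification of the first page must be natural in [x].
    [R|Psi(x)] is a flat resolution of [F|Psi(x)], but not the standard one, on which
    [fiber_homology] and its restriction maps are defined. The two are linked by an explicit chain
    map [fiber_std] that commutes strictly with the maps induced by [x <= y]; a lift chosen by
    projectivity would do so only up to homotopy. That it is an isomorphism on homology is again
    drawn from balance, applied on each fiber to the constant copresheaf. Freeness survives the
    restriction to a fiber because each [t] lying over some [y >= x] has a greatest element of
    [Psi(x)] below it. For the same reason the colimit over [Psi(x)] alone computes [pi_!] at [x].
    Most isomorphisms come from zigzags in a double complex, where no map on representatives is at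
    hand. They are therefore built from additive relations between representatives. *)

Section PropSubgroup.
Variables (A : zmodType) (X : A -> Prop).
Hypothesis X0 : X 0.
Hypothesis XB : forall x y, X x -> X y -> X (x - y).

Fact prop_zmod_closed : zmod_closed (fun x => `[< X x >]).
Proof.
by split=> [|x y /asboolP Xx /asboolP Xy]; apply/asboolP; [|exact: XB].
Qed.

Definition prop_subgroup : zmodClosed A := subgroup_of prop_zmod_closed.

Lemma prop_subgroupP x : x \in prop_subgroup <-> X x.
Proof. by split=> /asboolP. Qed.

End PropSubgroup.

Section Represents.
Variables (A : zmodType) (Z N : zmodClosed A).

(** Lets classes in a subquotient be handled through elements of the ambient group, so that no
    subgroup type or quotient map appears in the computations. *)
Definition represents (x : A) (q : subquot Z N) : Prop :=
  exists h : x \in Z, quot_pi (subquot_rel Z N) (SubOf h) = q.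

Lemma representsB x y p q :
  represents x p -> represents y q -> represents (x - y) (p - q).
Proof.
move=> [hx <-] [hy <-]; exists (rpredB hx hy).
by rewrite -raddfB; congr (quot_pi _ _); apply: val_inj.
Qed.

Lemma represents_mem x q : represents x q -> x \in Z.
Proof. by case. Qed.

Lemma represents_eq0 x q : represents x q -> (q = 0 <-> x \in N).
Proof. by move=> [h <-]; rewrite quot_eq0. Qed.

Lemma represents_ex q : exists x, represents x q.
Proof. by have [[x h] <-] := quot_piP q; exists x, h. Qed.

Lemma represents_of x : x \in Z -> exists q, represents x q.
Proof. by move=> h; eexists; exists h. Qed.

End Represents.

Lemma zmod_iso_sym (A B : zmodType) : zmod_iso A B -> zmod_iso B A.
Proof.
move=> [f [g fK gK]].
have gB : zmod_morphism g by move=> x y; apply: (can_inj fK); rewrite raddfB !gK.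
by exists (additive_of gB); exists f.
Qed.

Lemma zmod_iso_trans (A B C : zmodType) : zmod_iso A B -> zmod_iso B C -> zmod_iso A C.
Proof. by move=> [f bf] [g bg]; exists (add_comp g f); exact: bij_comp. Qed.

Lemma zmod_iso_bij (A B : zmodType) (f : {additive A -> B}) :
  (forall x, f x = 0 -> x = 0) -> (forall y, exists x, f x = y) -> zmod_iso A B.
Proof.
move=> f0 fs; exists f.
have g0 y : {x | f x = y} by exact: cid.
have fi : injective f.
  by move=> x y fxy; apply/eqP; rewrite -subr_eq0; apply/eqP/f0; rewrite raddfB fxy subrr.
by exists (fun y => sval (g0 y)) => x; [apply: fi|]; rewrite (svalP (g0 _)).
Qed.

(** An additive relation that is total on both sides and matches [N] with [N'] is the graph of an
    isomorphism once classes are taken. The image of a class is chosen arbitrarily; [f_of] shows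
    that the choice does not matter, and additivity follows from this independence. *)
Lemma zmod_iso_rel (A B : zmodType) (Z N : zmodClosed A) (Z' N' : zmodClosed B)
    (rho : A -> B -> Prop) :
  (forall x y u v, rho x u -> rho y v -> rho (x - y) (u - v)) ->
  (forall x, x \in Z -> exists2 u, u \in Z' & rho x u) ->
  (forall u, u \in Z' -> exists2 x, x \in Z & rho x u) ->
  (forall x u, x \in Z -> u \in Z' -> rho x u -> (x \in N <-> u \in N')) ->
  zmod_iso (subquot Z N) (subquot Z' N').
Proof.
move=> rhoB rho_l rho_r rhoN.
have ex (q : subquot Z N) : {q' : subquot Z' N' | exists x u,
    [/\ represents x q, represents u q' & rho x u]}.
  apply: cid; have [x xq] := represents_ex q.
  have [u uZ xu] := rho_l _ (represents_mem xq).
  by have [q' uq'] := represents_of N' uZ; exists q', x, u.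
pose f q := sval (ex q).
have f_of x u q q' : represents x q -> represents u q' -> rho x u -> f q = q'.
  move=> xq uq' xu; have [y [v [yq vq yv]]] := svalP (ex q).
  apply/eqP; rewrite -subr_eq0; apply/eqP.
  have vu := representsB vq uq'; apply/(represents_eq0 vu).
  have yx := representsB yq xq; rewrite subrr in yx.
  apply/(rhoN _ _ (represents_mem yx) (represents_mem vu) (rhoB _ _ _ _ yv xu)).
  exact/(represents_eq0 yx).
have fB : zmod_morphism f.
  move=> p q; have [x [u [xp up xu]]] := svalP (ex p).
  have [y [v [yq vq yv]]] := svalP (ex q).
  exact: f_of (representsB xp yq) (representsB up vq) (rhoB _ _ _ _ xu yv).
apply: (zmod_iso_bij (f := additive_of fB)) => [q /= fq0|q'].
  have [x [u [xq uq xu]]] := svalP (ex q).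
  apply/(represents_eq0 xq)/(rhoN _ _ (represents_mem xq) (represents_mem uq) xu).
  exact/(represents_eq0 uq).
have [u uq'] := represents_ex q'.
have [x xZ xu] := rho_r _ (represents_mem uq').
by have [q xq] := represents_of N xZ; exists q; apply: f_of xq uq' xu.
Qed.

(** * The spectral sequence of a filtered complex and its convergence *)

Section FilteredComplex.

(* [fc_fil k] is the step [k - 1] of an exhaustive filtration, and [fc_gr n] the
   part of degree [n] of an ungraded differential group, which spares us the
   transport of elements along equalities of degrees. *)
Record filtered_complex := FilteredComplex {
  fc_ob :> zmodType;
  fc_d : {additive fc_ob -> fc_ob};
  fc_gr : nat -> zmodClosed fc_ob;
  fc_fil : nat -> zmodClosed fc_ob;
  fc_dd : forall x, fc_d (fc_d x) = 0;
  fc_gr_d : forall n x, x \in fc_gr n.+1 -> fc_d x \in fc_gr n;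
  fc_gr_d0 : forall x, x \in fc_gr 0%N -> fc_d x = 0;
  fc_fil0 : forall x, x \in fc_fil 0%N -> x = 0;
  fc_filS : forall k x, x \in fc_fil k -> x \in fc_fil k.+1;
  fc_gr_fil : forall n x, x \in fc_gr n -> x \in fc_fil n.+1 }.

Variable T : filtered_complex.
Local Notation d := (fc_d T).
Local Notation gr := (fc_gr T).
Local Notation fil := (fc_fil T).

Lemma fil_le k l x : (k <= l)%N -> x \in fil k -> x \in fil l.
Proof.
by move=> /subnKC <- xk; elim: (_ - _)%N => [|m IHm]; rewrite ?addn0 ?addnS //; apply: fc_filS.
Qed.

Definition fc_cycles (n : nat) : zmodClosed T.
Proof.
apply: (@prop_subgroup T (fun x => x \in gr n /\ d x = 0)); first by rewrite rpred0 raddf0.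
by move=> x y [xg dx] [yg dy]; rewrite rpredB // raddfB dx dy subrr.
Defined.

Definition fc_boundaries (n : nat) : zmodClosed T.
Proof.
apply: (@prop_subgroup T (fun x => exists2 z, z \in gr n.+1 & d z = x)).
  by exists 0; rewrite ?rpred0 ?raddf0.
by move=> _ _ [x xg <-] [y yg <-]; exists (x - y); rewrite ?rpredB ?raddfB.
Defined.

Definition fc_homology n : zmodType := subquot (fc_cycles n) (fc_boundaries n).

Lemma fc_cyclesP n x : x \in fc_cycles n <-> x \in gr n /\ d x = 0.
Proof. exact: prop_subgroupP. Qed.

Lemma fc_boundariesP n x :
  x \in fc_boundaries n <-> exists2 z, z \in gr n.+1 & d z = x.
Proof. exact: prop_subgroupP. Qed.

Section PageSubgroups.
Variables r p q : nat.

(** The usual group [Z^r]: with [F_k] for [fil k.+1], elements of [F_q] whose differential lies in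
    [F_(q-r)]. For [r > q] the truncated subtraction gives [fil 0], so the condition becomes
    [d x = 0]. *)
Definition fc_page_num : zmodClosed T.
Proof.
apply: (@prop_subgroup T (fun x =>
  [/\ x \in gr (p + q)%N, x \in fil q.+1 & d x \in fil (q.+1 - r)%N])).
  by rewrite raddf0 !rpred0.
by move=> x y [xg xf xd] [yg yf yd]; rewrite raddfB; split; apply: rpredB.
Defined.

(** The usual [Z^(r-1)_(q-1) + d Z^(r-1)_(q+r-1)], without the conditions on [d y] and [d z]. These
    are automatic when [x = y + d z] lies in [fc_page_num]: then [d y = d x] and [d z = x - y]. *)
Definition fc_page_den : zmodClosed T.
Proof.
apply: (@prop_subgroup T (fun x => exists y z, [/\ y \in gr (p + q)%N, y \in fil q,
  z \in gr (p + q).+1, z \in fil (q + r)%N & x = y + d z])).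
  by exists 0, 0; rewrite raddf0 !rpred0 addr0.
move=> _ _ [y [z [yg yf zg zf ->]]] [y' [z' [yg' yf' zg' zf' ->]]].
exists (y - y'), (z - z'); rewrite raddfB opprD addrACA.
by split=> //; apply: rpredB.
Defined.

Lemma fc_page_numP x : x \in fc_page_num <->
  [/\ x \in gr (p + q)%N, x \in fil q.+1 & d x \in fil (q.+1 - r)%N].
Proof. exact: prop_subgroupP. Qed.

Lemma fc_page_denP x : x \in fc_page_den <->
  exists y z, [/\ y \in gr (p + q)%N, y \in fil q,
    z \in gr (p + q).+1, z \in fil (q + r)%N & x = y + d z].
Proof. exact: prop_subgroupP. Qed.

End PageSubgroups.

Definition fc_page r p q : zmodType := subquot (fc_page_num r p q) (fc_page_den r p q).

Section Differential.
Variables (r p q p' q' : nat) (hp : (p' + 1 = p + r)%N) (hq : (q = q' + r)%N).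

Fact fc_sdiff_num x : x \in fc_page_num r p q -> d x \in fc_page_num r p' q'.
Proof.
move=> /fc_page_numP[xg _ xd]; apply/fc_page_numP; rewrite fc_dd rpred0; split=> //.
  by apply: fc_gr_d; move: xg; have -> : (p + q = (p' + q').+1)%N by lia.
by move: xd; have -> : (q.+1 - r = q'.+1)%N by lia.
Qed.

Fact fc_sdiff_den x : x \in fc_page_den r p q -> d x \in fc_page_den r p' q'.
Proof.
move=> /fc_page_denP[y [z [yg yf zg zf ->]]]; apply/fc_page_denP.
have e : (p + q = (p' + q').+1)%N by lia.
by exists 0, y; rewrite !rpred0 add0r raddfD fc_dd addr0 -e -hq; split.
Qed.

Definition fc_sdiff : {additive fc_page r p q -> fc_page r p' q'} :=
  subquot_map fc_sdiff_num fc_sdiff_den.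

Lemma fc_sdiff_represents x e : represents x e -> represents (d x) (fc_sdiff e).
Proof.
move=> [h <-]; exists (fc_sdiff_num h); rewrite /fc_sdiff /subquot_map quot_mapE.
by congr (quot_pi _ _); apply: val_inj.
Qed.

End Differential.

Definition fc_ss_data : spectral_sequence_data :=
  SpectralSequenceData fc_sdiff.

Fact fc_sdiff_sq (r p q p' q' p'' q'' : nat) : (2 <= r)%N ->
  forall (hp : (p' + 1 = p + r)%N) (hq : (q = q' + r)%N)
    (hp' : (p'' + 1 = p' + r)%N) (hq' : (q' = q'' + r)%N) x,
    sdiff fc_ss_data hp' hq' (sdiff fc_ss_data hp hq x) = 0.
Proof.
move=> _ hp hq hp' hq' e; have [x xe] := represents_ex e.
have := fc_sdiff_represents hp' hq' (fc_sdiff_represents hp hq xe).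
by move=> /represents_eq0 [_]; apply; rewrite fc_dd rpred0.
Qed.

Fact fc_turn (r p q : nat) : (2 <= r)%N ->
  zmod_iso (fc_ss_data r.+1 p q)
    (subquot (page_cycles fc_ss_data r p q) (page_boundaries fc_ss_data r p q)).
Proof.
move=> r2; apply: (zmod_iso_rel (rho := fun x e => represents x (e : fc_page r p q))).
- by move=> *; apply: representsB.
- move=> x /fc_page_numP[xg xf xd].
  have xZ : x \in fc_page_num r p q.
    by apply/fc_page_numP; split=> //; apply: fil_le xd; lia.
  have [e xe] := represents_of (fc_page_den r p q) xZ.
  exists e => //; apply/asboolP => p' q' hp hq.
  apply/(represents_eq0 (fc_sdiff_represents hp hq xe))/fc_page_denP.
  have g : (p + q = (p' + q').+1)%N by lia.
  exists (d x), 0; rewrite raddf0 addr0 !rpred0; split=> //.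
    by apply: fc_gr_d; rewrite -g.
  by move: xd; have -> : (q.+1 - r.+1 = q')%N by lia.
- move=> e /asboolP eZ; have [x xe] := represents_ex e.
  have /fc_page_numP[xg xf xd] := represents_mem xe.
  (* For [q < r] no differential leaves [(p, q)], and the conditions on [d x] for [r] and for
     [r + 1] both say that it is zero. *)
  have [qr|rq] := ltnP q r.
    exists x => //; apply/fc_page_numP; split=> //.
    by move: xd; have -> : (q.+1 - r = q.+1 - r.+1)%N by lia.
  have hq : (q = (q - r) + r)%N by lia.
  have hp : (((p + r).-1) + 1 = p + r)%N by lia.
  have /represents_eq0 [+ _] := fc_sdiff_represents hp hq xe.
  move=> /(_ (eZ _ _ hp hq)) /fc_page_denP[y [z [yg yf zg zf dx]]].
  have gE : ((p + r).-1 + (q - r)).+1 = (p + q)%N by lia.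
  rewrite gE in zg; rewrite -hq in zf.
  (* Here [z] lies in [fil q], so it represents zero at [(p, q)]; subtracting it leaves
     [d (x - z) = y], which is one filtration step lower than required on page [r]. *)
  have xz : x - z \in fc_page_num r.+1 p q.
    apply/fc_page_numP; split; [exact: rpredB | by apply: rpredB => //; apply: fc_filS |].
    by rewrite raddfB dx addrK subSS.
  exists (x - z) => //.
  have zN : z \in fc_page_den r p q.
    by apply/fc_page_denP; exists z, 0; rewrite raddf0 addr0 !rpred0.
  have zZ : z \in fc_page_num r p q.
    have -> : z = x - (x - z) by rewrite opprB addrC subrK.
    apply: rpredB (represents_mem xe) _.
    move: xz => /fc_page_numP[? ? ?]; apply/fc_page_numP; split=> //.
    by apply: (@fil_le (q.+1 - r.+1)) => //; lia.
  have [z' zz'] := represents_of (fc_page_den r p q) zZ.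
  rewrite -[e]subr0 -((represents_eq0 zz').2 zN); exact: representsB.
move=> x e /fc_page_numP[xg xf xd] _ xe; split.
  move=> /fc_page_denP[y [z [yg yf zg zf xE]]]; apply/asboolP.
  (* For [p + 1 < r] no differential enters [(p, q)]. Then [z], being of degree [p + q + 1], lies in
     [fil (p + q + 2)] and hence in [fil (q + r)], so [x] already represents zero on page [r].
     Otherwise [z] itself represents the element that hits [x]. *)
  have [pr|rp] := ltnP p.+1 r.
    left; apply/(represents_eq0 xe)/fc_page_denP; exists y, z; split=> //.
    by have := fc_gr_fil zg; apply: fil_le; lia.
  right; have hp : (p + 1 = (p.+1 - r) + r)%N by lia.
  have dzE : d z = x - y by rewrite xE addrC addKr.
  have zZ : z \in fc_page_num r (p.+1 - r) (q + r).
    apply/fc_page_numP.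
    have -> : (p.+1 - r + (q + r) = (p + q).+1)%N by lia.
    split=> //; first by rewrite -addnS.
    have -> : ((q + r).+1 - r = q.+1)%N by lia.
    by rewrite dzE; apply: rpredB => //; apply: fc_filS.
  have [u zu] := represents_of (fc_page_den r (p.+1 - r) (q + r)) zZ.
  exists (p.+1 - r)%N, (q + r)%N, hp, erefl, u; apply/eqP; rewrite -subr_eq0; apply/eqP.
  have du := representsB (fc_sdiff_represents hp erefl zu) xe.
  apply/(represents_eq0 du)/fc_page_denP; exists (- y), 0.
  by rewrite !rpredN raddf0 !rpred0 addr0 xE opprD addrCA subrr addr0; split.
move=> /asboolP xN; apply/fc_page_denP.
case: xN => [e0|[p1 [q1 [hp [hq [u ue]]]]]].
  have /fc_page_denP[y [z [yg yf zg zf xE]]] := (represents_eq0 xe).1 e0.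
  by exists y, z; split=> //; rewrite addnS fc_filS.
have [w wu] := represents_ex u.
have := representsB xe (fc_sdiff_represents hp hq wu).
move=> /represents_eq0 [+ _]; rewrite -ue subrr => /(_ erefl).
move=> /fc_page_denP[y [z [yg yf zg zf xE]]].
have /fc_page_numP[wg wf _] := represents_mem wu.
exists y, (z + w); rewrite addnS raddfD addrA -xE subrK; split=> //.
  by apply: rpredD => //; have <- : (p1 + q1 = (p + q).+1)%N by lia.
by apply: rpredD; [exact: fc_filS|rewrite -hq].
Qed.

Definition fc_spectral_sequence : spectral_sequence :=
  SpectralSequence fc_sdiff_sq fc_turn.

(** The filtration on [H n] consists of the classes that have a cycle in [fil k] as representative.
    On page [p + q + 2] the numerator asks for genuine cycles, as [d x] must lie in [fil 0], and the
    bound on [z] in the denominator holds for every element of degree [p + q + 1]. This leaves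
    exactly the graded pieces. *)
Lemma fc_converges (H : nat -> zmodType) :
  (forall n, zmod_iso (fc_homology n) (H n)) -> converges_to fc_spectral_sequence H.
Proof.
move=> iso.
have iso' n : {f : {additive fc_homology n -> H n} | bijective f} by apply: cid; exact: iso.
pose f n := sval (iso' n).
have f0 n q : f n q = 0 -> q = 0.
  by rewrite -{1}(raddf0 (f n)); apply: (bij_inj (svalP (iso' n))).
pose rho n (x : T) (y : H n) :=
  exists2 q, @represents _ (fc_cycles n) (fc_boundaries n) x q & f n q = y.
have rhoB n x y u v : rho n x u -> rho n y v -> rho n (x - y) (u - v).
  by move=> [q xq <-] [q' yq' <-]; exists (q - q'); [exact: representsB | exact: raddfB].
have rho_fst n x y : rho n x y -> x \in fc_cycles n by case=> q /represents_mem.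
have rho0 n x y : rho n x y -> (y = 0 <-> x \in fc_boundaries n).
  move=> [q xq <-]; rewrite -(represents_eq0 xq).
  by split=> [/f0|->]; last exact: raddf0.
have rho_of n x : x \in fc_cycles n -> exists y, rho n x y.
  by move=> /(represents_of (fc_boundaries n))[q xq]; exists (f n q), q.
have rho_ex n y : exists x, rho n x y.
  have [g _ gK] := svalP (iso' n); have [x xq] := represents_ex (g y).
  by exists x, (g y) => //; exact: gK.
have rho00 n : rho n 0 0.
  have [y y0] := rho_of n 0 (rpred0 _).
  by have := rhoB _ _ _ _ _ y0 y0; rewrite !subrr.
have F0 n k : exists2 x, x \in fil k & rho n x 0 by exists 0; rewrite ?rpred0.
have FB n k y v : (exists2 x, x \in fil k & rho n x y) ->
    (exists2 x, x \in fil k & rho n x v) -> exists2 x, x \in fil k & rho n x (y - v).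
  move=> [x xf xy] [u uf uv]; exists (x - u); [exact: rpredB|exact: rhoB].
pose Fil n k : zmodClosed (H n) := prop_subgroup (F0 n k) (FB n k).
have FilP n k y : y \in Fil n k <-> exists2 x, x \in fil k & rho n x y.
  exact: prop_subgroupP.
exists Fil; split.
- move=> n y /FilP[x /fc_fil0 -> /rho0 [_]]; apply; exact: rpred0.
- by move=> n k y /FilP[x xf xy]; apply/FilP; exists x => //; apply: fc_filS.
- move=> n y; have [x xy] := rho_ex n y; apply/FilP; exists x => //.
  by have /fc_cyclesP[/fc_gr_fil] := rho_fst _ _ _ xy.
move=> p q; apply: (zmod_iso_rel (rho := rho (p + q)%N)) ; first exact: rhoB.
- move=> x /fc_page_numP[xg xf xd].
  have [y xy] : exists y, rho (p + q)%N x y.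
    apply: rho_of; apply/fc_cyclesP; split=> //; apply: fc_fil0.
    by move: xd; have -> : (q.+1 - (p + q + 2) = 0)%N by lia.
  exists y => //; apply/FilP; by exists x.
- move=> y /FilP[x xf xy]; exists x => //; apply/fc_page_numP.
  by have /fc_cyclesP[xg ->] := rho_fst _ _ _ xy; rewrite rpred0.
move=> x y /fc_page_numP[_ xf _] _ xy; have /fc_cyclesP[xg dx] := rho_fst _ _ _ xy.
split.
  move=> /fc_page_denP[u [z [ug uf zg zf xE]]].
  have du : d u = 0 by move: dx; rewrite xE raddfD fc_dd addr0.
  have [v uv] : exists v, rho (p + q)%N u v by apply: rho_of; apply/fc_cyclesP.
  have /rho0[_] := rhoB _ _ _ _ _ xy uv.
  rewrite xE addrC addKr => yv; apply/FilP; exists u => //.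
  have /eqP : y - v = 0 by apply: yv; apply/fc_boundariesP; exists z.
  by rewrite subr_eq0 => /eqP ->.
move=> /FilP[u uf uy]; apply/fc_page_denP.
have /fc_cyclesP[ug du] := rho_fst _ _ _ uy.
have /rho0[+ _] := rhoB _ _ _ _ _ xy uy.
rewrite subrr => /(_ erefl) /fc_boundariesP[z zg zE].
exists u, z; rewrite zE addrC subrK; split=> //.
by have := fc_gr_fil zg; apply: fil_le; lia.
Qed.

End FilteredComplex.

(** * Double complexes *)

Section Bifamily.
Variable D : nat -> nat -> zmodType.

(** No finiteness is imposed: only homogeneous elements enter the homology, and these live on a
    finite antidiagonal. *)
Record bifamily := Bifamily { bif_val :> forall p q, D p q }.

Lemma bifP (x y : bifamily) : (forall p q, x p q = y p q) -> x = y.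
Proof.
case: x y => [x] [y] /= xy; congr Bifamily.
apply: functional_extensionality_dep => p.
exact: functional_extensionality_dep.
Qed.

HB.instance Definition _ := gen_eqMixin bifamily.
HB.instance Definition _ := gen_choiceMixin bifamily.

Definition bif0 := Bifamily (fun p q => 0).
Definition bifN (x : bifamily) := Bifamily (fun p q => - x p q).
Definition bifD (x y : bifamily) := Bifamily (fun p q => x p q + y p q).

Fact bifDA : associative bifD.
Proof. by move=> x y z; apply: bifP => p q /=; rewrite addrA. Qed.
Fact bifDC : commutative bifD.
Proof. by move=> x y; apply: bifP => p q /=; rewrite addrC. Qed.
Fact bif0D : left_id bif0 bifD.
Proof. by move=> x; apply: bifP => p q /=; rewrite add0r. Qed.
Fact bifND : left_inverse bif0 bifN bifD.
Proof. by move=> x; apply: bifP => p q /=; rewrite addNr. Qed.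

HB.instance Definition _ := GRing.isZmodule.Build bifamily bifDA bifDC bif0D bifND.

Lemma bifDE (x y : bifamily) p q : (x + y) p q = x p q + y p q. Proof. by []. Qed.
Lemma bifBE (x y : bifamily) p q : (x - y) p q = x p q - y p q. Proof. by []. Qed.

Definition bif_single p q (u : D p q) : bifamily :=
  Bifamily (fun i j =>
    dfwith (fun ij : nat * nat => 0 : D ij.1 ij.2) (i := (p, q)) u (i, j)).

Lemma bif_singleE p q (u : D p q) : bif_single u p q = u.
Proof. exact: (dfwith_in _ (i := (p, q))). Qed.

Lemma bif_single0 p q (u : D p q) i j : (i != p) || (j != q) -> bif_single u i j = 0.
Proof.
move=> ij; rewrite /= (@dfwith_out _ (fun ij : nat * nat => D ij.1 ij.2) (fun=> 0)
  (p, q) u (i, j)) //.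
by apply: contraTneq ij => -[-> ->]; rewrite !eqxx.
Qed.

End Bifamily.

Section Sign.
Variable A : zmodType.

Definition signed (n : nat) (x : A) : A := if odd n then - x else x.

Fact signed_is_zmod_morphism n : zmod_morphism (signed n).
Proof. by move=> x y; rewrite /signed; case: odd => //; rewrite opprD. Qed.

HB.instance Definition _ n :=
  GRing.isZmodMorphism.Build A A (signed n) (signed_is_zmod_morphism n).

Lemma signedD m n x : signed (m + n) x = signed m (signed n x).
Proof. by rewrite /signed oddD; do 2!case: odd; rewrite /= ?opprK. Qed.

Lemma signedK n : involutive (signed n).
Proof. by move=> x; rewrite /signed; case: odd; rewrite ?opprK. Qed.

Lemma signedS n x : signed n.+1 x = - signed n x.
Proof. by rewrite /signed /=; case: odd; rewrite ?opprK. Qed.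

End Sign.

Lemma raddf_signed (A B : zmodType) (f : {additive A -> B}) n x :
  f (signed n x) = signed n (f x).
Proof. by rewrite /signed; case: odd; rewrite ?raddfN. Qed.

Record double_complex := DoubleComplex {
  dc_ob :> nat -> nat -> zmodType;
  dc_h : forall p q, {additive dc_ob p.+1 q -> dc_ob p q};
  dc_v : forall p q, {additive dc_ob p q.+1 -> dc_ob p q};
  dc_hh : forall p q x, dc_h p q (dc_h p.+1 q x) = 0;
  dc_vv : forall p q x, dc_v p q (dc_v p q.+1 x) = 0;
  dc_hv : forall p q x, dc_h p q (dc_v p.+1 q x) = dc_v p q (dc_h p q.+1 x) }.

Section TotalComplex.
Variable D : double_complex.
Local Notation T := (bifamily D).

Definition tot_d_fun (x : T) : T :=
  Bifamily (fun p q => dc_h D p q (x p.+1 q) + signed p (dc_v D p q (x p q.+1))).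

Fact tot_d_is_zmod_morphism : zmod_morphism tot_d_fun.
Proof.
by move=> x y; apply: bifP => p q; rewrite bifBE /= !raddfB opprD addrACA.
Qed.

Definition tot_d : {additive T -> T} := additive_of tot_d_is_zmod_morphism.

Lemma tot_dE (x : T) p q :
  tot_d x p q = dc_h D p q (x p.+1 q) + signed p (dc_v D p q (x p q.+1)).
Proof. by []. Qed.

Definition tot_gr (n : nat) : zmodClosed T.
Proof.
apply: (@prop_subgroup T (fun x => forall i j, (i + j)%N <> n -> x i j = 0)) => //.
by move=> x y x0 y0 i j ij; rewrite bifBE x0 // y0 // subrr.
Defined.

Definition tot_fil (k : nat) : zmodClosed T.
Proof.
apply: (@prop_subgroup T (fun x => forall i j, (k <= j)%N -> x i j = 0)) => //.
by move=> x y x0 y0 i j ij; rewrite bifBE x0 // y0 // subrr.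
Defined.

Lemma tot_grP n x : x \in tot_gr n <-> forall i j, (i + j)%N <> n -> x i j = 0.
Proof. exact: prop_subgroupP. Qed.

Lemma tot_filP k x : x \in tot_fil k <-> forall i j, (k <= j)%N -> x i j = 0.
Proof. exact: prop_subgroupP. Qed.

Fact tot_dd x : tot_d (tot_d x) = 0.
Proof.
apply: bifP => p q; rewrite !tot_dE !raddfD dc_hh add0r /=.
rewrite !raddf_signed dc_vv !raddf0 addr0 signedS.
by rewrite dc_hv addNr.
Qed.

Fact tot_gr_d n x : x \in tot_gr n.+1 -> tot_d x \in tot_gr n.
Proof.
move=> /tot_grP x0; apply/tot_grP => i j ij; rewrite tot_dE.
by rewrite x0 ?x0 ?raddf0 ?raddf0 ?addr0 //; lia.
Qed.

Fact tot_gr_d0 x : x \in tot_gr 0 -> tot_d x = 0.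
Proof.
move=> /tot_grP x0; apply: bifP => i j; rewrite tot_dE.
by rewrite x0 ?x0 ?raddf0 ?raddf0 ?addr0 //; lia.
Qed.

Fact tot_fil0 x : x \in tot_fil 0 -> x = 0.
Proof. by move=> /tot_filP x0; apply: bifP => i j; apply: x0. Qed.

Fact tot_filS k x : x \in tot_fil k -> x \in tot_fil k.+1.
Proof. by move=> /tot_filP x0; apply/tot_filP => i j kj; apply: x0; lia. Qed.

Fact tot_gr_fil n x : x \in tot_gr n -> x \in tot_fil n.+1.
Proof. by move=> /tot_grP x0; apply/tot_filP => i j nj; apply: x0; lia. Qed.

Definition tot : filtered_complex :=
  FilteredComplex tot_dd tot_gr_d tot_gr_d0 tot_fil0 tot_filS tot_gr_fil.

Lemma bif_single_gr p q (u : D p q) n : (p + q)%N = n -> bif_single u \in tot_gr n.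
Proof.
by move=> pq; apply/tot_grP => i j ij; apply: bif_single0; lia.
Qed.

Definition hcycle p q : D p q -> Prop :=
  if p is p'.+1 then fun x => dc_h D p' q x = 0 else fun=> True.

Lemma hcycle_signed p q (x : D p q) n : hcycle x -> hcycle (signed n x).
Proof. by case: p x => [//|p] x /= x0; rewrite raddf_signed x0 raddf0. Qed.

Lemma hcycleP p q (x : D p q) i : hcycle x -> dc_h D i q (bif_single x i.+1 q) = 0.
Proof.
have [ip|ip _] := eqVneq i.+1 p; last by rewrite bif_single0 ?ip ?raddf0.
by subst p; rewrite bif_singleE.
Qed.

End TotalComplex.

Arguments tot_d {D}.

Lemma boundariesP (C : chain_complex) n (x : C n) :
  x \in boundaries C n <-> exists y, ch_diff C n y = x.
Proof. exact: imageP. Qed.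

(* [al] presents the cycles of the column [p] and [be] their homology classes. *)
Section SecondPage.
Variables (D : double_complex) (V : chain_complex) (W : nat -> zmodType) (p : nat).
Variables (wd : forall q, {additive W q.+1 -> W q}).
Variables (al : forall q, {additive W q -> D p q}) (be : forall q, {additive W q -> V q}).
Hypothesis al_wd : forall q w, al q (wd q w) = dc_v D p q (al q.+1 w).
Hypothesis be_wd : forall q w, be q (wd q w) = ch_diff V q (be q.+1 w).
Hypothesis al_im : forall q x, hcycle x <-> exists w, al q w = x.
Hypothesis be_surj : forall q v, exists w, be q w = v.
Hypothesis be_ker : forall q w, be q w = 0 <-> exists y, dc_h D p q y = al q w.

(** An element [x] of the numerator corresponds to the class of its leading entry [x p q]. The
    components of [tot_d x] at [(p - 1, q)] and [(p, q - 1)] vanish: the first makes this entry a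
    horizontal cycle, the second makes its class a cycle of [V]. *)
Lemma second_page q : zmod_iso (fc_page (tot D) 2 p q) (homology V q).
Proof.
apply: (zmod_iso_rel (rho := fun (x : tot D) v => exists2 w, al q w = x p q & be q w = v)).
- move=> x y u v [w wx <-] [w' wy <-]; exists (w - w'); last exact: raddfB.
  by rewrite bifBE raddfB wx wy.
- move=> x /fc_page_numP[/tot_grP xg /tot_filP xf /tot_filP xd].
  have [w wx] : exists w, al q w = x p q.
    apply/al_im; case: (p) xf xd => [//|p'] xf xd /=.
    have := xd p' q; rewrite tot_dE (xf p' q.+1) // !raddf0 addr0.
    by apply; lia.
  exists (be q w); last by exists w.
  case: q => [//|q'] in x xg xf xd w wx *.
  apply/kernelP; rewrite -be_wd; apply/be_ker.
  (* The witness is read off from the component of [tot_d x] at [(p, q')], which is zero. *)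
  exists (- signed p (x p.+1 q')); rewrite raddfN al_wd wx raddf_signed.
  have /eqP : tot_d x p q' = 0 by apply: xd; lia.
  rewrite tot_dE addr_eq0 => /eqP ->.
  by rewrite (raddfN (signed p)) opprK; apply: signedK.
- move=> v vZ; have [w wv] := be_surj v.
  have h0 : hcycle (al q w) by apply/al_im; exists w.
  case: q => [|q'] in v vZ w wv h0 *.
    exists (bif_single (al 0%N w)); last by exists w; rewrite ?bif_singleE.
    apply/fc_page_numP; split; first exact: bif_single_gr.
      by apply/tot_filP => i j j1; apply: bif_single0; lia.
    apply/tot_filP => i j _; rewrite tot_dE (@bif_single0 _ p 0%N _ i j.+1) ?orbT //.
    rewrite !raddf0 addr0; case: j => [|j]; first exact: hcycleP.
    by rewrite bif_single0 ?orbT ?raddf0.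
  have /be_ker[y yE] : be q' (wd q' w) = 0 by rewrite be_wd wv; apply/kernelP.
  rewrite al_wd in yE.
  have e : (p.+1 + q' = p + q'.+1)%N by lia.
  (* The second entry, at [(p + 1, q')], cancels the vertical differential of the leading one, so
     that the differential of the whole has no component with second index at least [q']. *)
  exists (bif_single (al q'.+1 w) - bif_single (signed p y) : tot D); last first.
    by exists w => //; rewrite bifBE bif_singleE bif_single0 ?subr0 //; lia.
  apply/fc_page_numP; split.
  + by rewrite rpredB // bif_single_gr.
  + by apply/tot_filP => i j ij; rewrite bifBE !bif_single0 ?subr0 //; lia.
  apply/tot_filP => i j ij; rewrite tot_dE !bifBE !raddfB.
  have {ij}[->|qj] : j = q' \/ (q' < j)%N by lia.
    rewrite (@bif_single0 _ p q'.+1 _ i.+1); last lia.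
    rewrite (@bif_single0 _ p.+1 q' _ i q'.+1); last lia.
    have [->|ip] := eqVneq i p.
      by rewrite !bif_singleE raddf_signed yE !raddf0 sub0r addr0 addNr.
    by rewrite !bif_single0 ?raddf0 ?subr0 ?addr0 //; lia.
  rewrite (@bif_single0 _ p.+1 q' _ i.+1 j); last lia.
  rewrite (@bif_single0 _ p.+1 q' _ i j.+1); last lia.
  rewrite (@bif_single0 _ p q'.+1 _ i j.+1); last lia.
  rewrite !raddf0 !addr0; have [->|qj'] := eqVneq j q'.+1; first exact: hcycleP.
  by rewrite bif_single0 ?qj' ?orbT ?raddf0.
move=> x v /fc_page_numP[xg /tot_filP xf xd] vZ [w wx wv]; split.
  move=> /fc_page_denP[y [z [_ /tot_filP yf _ /tot_filP zf xE]]].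
  have [w1 w1z] : exists w1, al q.+1 w1 = z p q.+1.
    apply/al_im; case: (p) xf yf zf xE => [//|p'] xf yf zf xE /=.
    have := xf p' q.+1 (leqnn _); rewrite xE bifDE yf // add0r tot_dE (zf p' q.+2) ?addn2 //.
    by rewrite !raddf0 addr0.
  apply/boundariesP; exists (be q.+1 (signed p w1)); rewrite -be_wd -wv.
  apply/eqP; rewrite eq_sym -subr_eq0 -raddfB; apply/eqP/be_ker; exists (z p.+1 q).
  rewrite raddfB wx xE bifDE yf // add0r tot_dE al_wd raddf_signed w1z raddf_signed.
  by rewrite addrK.
move=> /boundariesP[v1 v1E]; have [w1 w1v] := be_surj v1.
have /be_ker[y yE] : be q (w - wd q w1) = 0 by rewrite raddfB be_wd wv w1v v1E subrr.
have h1 : hcycle (al q.+1 w1) by apply/al_im; exists w1.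
(* The entries, at [(p, q + 1)] and [(p + 1, q)], are chosen so that [tot_d z] agrees with [x] at
   [(p, q)]: there [al (wd w1)] and [dc_h y = al (w - wd w1)] add up to [al w]. *)
pose z : tot D := bif_single (signed p (al q.+1 w1)) + bif_single y.
have zg : z \in fc_gr (tot D) (p + q).+1.
  by rewrite rpredD // bif_single_gr //; lia.
have zf : z \in fc_fil (tot D) (q + 2).
  by apply/tot_filP => i j ij; rewrite bifDE !bif_single0 ?addr0 //; lia.
apply/fc_page_denP; exists (x - fc_d (tot D) z), z; rewrite subrK; split=> //.
  by apply: rpredB => //; apply: tot_gr_d.
apply/tot_filP => i j; rewrite bifBE tot_dE !bifDE leq_eqVlt => /orP[/eqP <-|qj].
  rewrite (@bif_single0 _ p q.+1 _ i.+1 q); last lia.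
  rewrite (@bif_single0 _ p.+1 q _ i q.+1); last lia.
  have [->|ip] := eqVneq i p.
    rewrite !bif_singleE add0r addr0 yE !raddf_signed raddfB al_wd wx signedK.
    by rewrite subrK subrr.
  rewrite !bif_single0; try lia; rewrite !addr0 !raddf0 addr0.
  rewrite subr0; by move/tot_grP: xg; apply; lia.
rewrite xf // (@bif_single0 _ p.+1 q _ i.+1 j); last lia.
rewrite (@bif_single0 _ p.+1 q _ i j.+1); last lia.
rewrite (@bif_single0 _ p q.+1 _ i j.+1); last lia.
rewrite !addr0 (raddf0 (dc_v D i j)) raddf0 addr0; have [->|qj'] := eqVneq j q.+1.
  by rewrite hcycleP ?subrr //; apply: hcycle_signed.
by rewrite bif_single0 ?qj' ?orbT // raddf0 subr0.
Qed.

End SecondPage.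

(** * Double complexes with exact augmented rows *)

Section RowAugmentation.
Variables (D : double_complex) (A : chain_complex).
Variable eps : forall p, {additive D p 0%N -> A p}.

Record row_augmentation : Prop := RowAugmentation {
  raug_surj : forall p a, exists x, eps p x = a;
  raug_exact : forall p x, eps p x = 0 <-> exists y, dc_v D p 0 y = x;
  raug_v_exact : forall p q x, dc_v D p q x = 0 -> exists y, dc_v D p q.+1 y = x;
  raug_h : forall p x, eps p (dc_h D p 0 x) = ch_diff A p (eps p.+1 x) }.

Hypothesis H : row_augmentation.

Lemma raug_v p y : eps p (dc_v D p 0 y) = 0.
Proof. by apply/(raug_exact H); exists y. Qed.

Lemma raug_tot_d n (z : tot D) :
  eps n (tot_d z n 0%N) = ch_diff A n (eps n.+1 (z n.+1 0%N)).
Proof. by rewrite tot_dE raddfD raddf_signed raug_v raddf0 addr0 raug_h. Qed.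

(* Peel off the entry with the largest [p]. *)
Lemma raug_acyclic k n (x : tot D) : x \in fc_cycles (tot D) n ->
  (forall i j, (k <= i)%N -> x i j = 0) -> eps n (x n 0%N) = 0 ->
  exists2 z : tot D, z \in tot_gr D n.+1 &
    tot_d z = x /\ forall i j, (k <= i)%N -> z i j = 0.
Proof.
elim: k x => [|k IHk] x /fc_cyclesP[/tot_grP xg xd] xk xe.
  by exists 0; rewrite ?rpred0 ?raddf0 //; split=> //; apply: bifP => i j; rewrite xk.
have [nk|kn] := ltnP n k.
  have [||z zg [zd zk]] := IHk x _ _ xe; first by apply/fc_cyclesP; split=> //; apply/tot_grP.
    move=> i j; rewrite leq_eqVlt => /orP[/eqP <-|]; last exact: xk.
    by apply: xg; lia.
  by exists z => //; split=> // i j ki; apply: zk; lia.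
have [j nE] : exists j, n = (k + j)%N by exists (n - k)%N; lia.
(* The entry at [(k, j)] is the one with largest first index. If [j = 0] then [k = n], and [eps]
   kills it by hypothesis; otherwise the component of [tot_d x = 0] at [(k, j - 1)] reduces to its
   vertical differential, because [x k.+1] vanishes. *)
have [y yE] : exists y, dc_v D k j y = x k j.
  case: j nE => [|j] nE.
    by apply/(raug_exact H); move: xe; rewrite nE addn0.
  apply: (raug_v_exact H).
  have := congr1 (fun z : tot D => z k j) xd.
  by rewrite tot_dE xk // raddf0 add0r => /(congr1 (signed k)); rewrite signedK raddf0.
pose u : tot D := bif_single (signed k y).
have ug : u \in tot_gr D n.+1 by apply: bif_single_gr; lia.
have uk i l : (k < i)%N -> u i l = 0 by move=> ki; apply: bif_single0; lia.
have [|||z zg [zd zk]] := IHk (x - tot_d u).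
- apply/fc_cyclesP; split; last by rewrite raddfB xd sub0r [fc_d _ _]tot_dd oppr0.
  by apply: rpredB; [apply/tot_grP|apply: tot_gr_d].
- move=> i l ki; rewrite bifBE tot_dE uk // raddf0 add0r.
  move: ki; rewrite leq_eqVlt => /orP[/eqP <-|ki]; last first.
    by rewrite xk // uk // !raddf0 addr0.
  have [->|lj] := eqVneq l j; first by rewrite bif_singleE raddf_signed signedK yE subrr.
  rewrite /u bif_single0 ?eqSS ?lj ?orbT // !raddf0 addr0 xg //; by move/eqP: lj; lia.
- by rewrite bifBE raddfB xe raug_tot_d uk // !raddf0 addr0.
exists (z + u); first exact: rpredD.
split; first by rewrite raddfD zd subrK.
by move=> i l ki; rewrite bifDE zk ?uk ?addr0 // ltnW.
Qed.

Lemma raug_cycles n (x : tot D) :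
  x \in fc_cycles (tot D) n -> eps n (x n 0%N) \in cycles A n.
Proof.
move=> /fc_cyclesP[_ xd]; case: n => [//|n]; apply/kernelP.
by rewrite -raug_tot_d [tot_d x]xd raddf0.
Qed.

Lemma raug_lift n a : a \in cycles A n ->
  exists2 x, x \in fc_cycles (tot D) n & eps n (x n 0%N) = a.
Proof.
have [b <-] := raug_surj H a; pose x : tot D := bif_single b.
have xg : x \in tot_gr D n by apply: bif_single_gr; rewrite addn0.
case: n => [|n] in a b x xg * => bZ.
  exists x; last by rewrite bif_singleE.
  by apply/fc_cyclesP; split=> //; apply: tot_gr_d0.
(* The bound on the support of [z] matters: [z] has no entry at [(n.+1, 0)], so correcting [x] by
   [z] does not change its image in [A]. *)
have [|||z zg [zd zk]] := @raug_acyclic n.+1 n (tot_d x).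
- by apply/fc_cyclesP; split; [exact: tot_gr_d | exact: tot_dd].
- move=> i j ni; rewrite tot_dE /x !bif_single0; try lia.
  by rewrite !raddf0 addr0.
- by rewrite raug_tot_d bif_singleE; apply/kernelP.
exists (x - z : tot D); last by rewrite bifBE zk // bif_singleE subr0.
apply/fc_cyclesP; split; first exact: rpredB.
by rewrite raddfB [fc_d _ z]zd subrr.
Qed.

Lemma raug_boundaries n (x : tot D) : x \in fc_cycles (tot D) n ->
  (x \in fc_boundaries (tot D) n <-> eps n (x n 0%N) \in boundaries A n).
Proof.
move=> xZ; split.
  move=> /fc_boundariesP[z zg <-]; apply/boundariesP.
  by exists (eps n.+1 (z n.+1 0%N)); rewrite -raug_tot_d.
move=> /boundariesP[b bE]; have [u uE] := raug_surj H b.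
pose y : tot D := bif_single u.
have yg : y \in tot_gr D n.+1 by apply: bif_single_gr; rewrite addn0.
have /fc_cyclesP[xg xd] := xZ.
have [|||z zg [zd _]] := @raug_acyclic n.+1 n (x - tot_d y).
- apply/fc_cyclesP; split; last by rewrite raddfB xd sub0r [fc_d _ _]tot_dd oppr0.
  by apply: rpredB => //; apply: tot_gr_d.
- move=> i j ni; rewrite bifBE tot_dE /y !bif_single0; try lia.
  rewrite !raddf0 addr0 subr0; move/tot_grP: xg; apply; lia.
- by rewrite bifBE raddfB raug_tot_d bif_singleE uE bE subrr.
apply/fc_boundariesP; exists (z + y); first exact: rpredD.
by rewrite raddfD [fc_d _ z]zd subrK.
Qed.

Lemma raug_iso n : zmod_iso (fc_homology (tot D) n) (homology A n).
Proof.
apply: (zmod_iso_rel (rho := fun (x : tot D) a => eps n (x n 0%N) = a)).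
- by move=> x y _ _ <- <-; rewrite bifBE raddfB.
- by move=> x xZ; exists (eps n (x n 0%N)) => //; apply: raug_cycles.
- by move=> a /raug_lift.
by move=> x _ xZ _ <-; apply: raug_boundaries.
Qed.

End RowAugmentation.

(** * Transposition and balance *)

Section Transpose.
Variable D : double_complex.

Definition transpose : double_complex :=
  @DoubleComplex (fun p q => D q p) (fun p q => dc_v D q p) (fun p q => dc_h D q p)
    (fun p q => dc_vv (p := q) (q := p)) (fun p q => dc_hh (p := q) (q := p))
    (fun p q x => esym (dc_hv x)).

End Transpose.

Section TransposeTotal.
Variable D : double_complex.

(** The sign [(-1)^(pq)] reconciles the conventions: [tot_d] twists the vertical differential by the
    first index, and after transposition this twist falls on the other differential. *)
Definition tot_tr (x : tot D) : tot (transpose D) :=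
  @Bifamily (transpose D) (fun p q => signed (q * p) (x q p)).

Lemma tot_tr_d x : tot_tr (tot_d x) = tot_d (tot_tr x).
Proof.
apply: bifP => p q /=.
rewrite (raddf_signed (dc_v D q p)) (raddf_signed (dc_h D q p)) (raddfD (signed _)) /=.
rewrite -!signedD addrC mulnS [(q + _)%N]addnC mulSn addnA addnn.
by rewrite (signedD p.*2) /(signed p.*2) odd_double.
Qed.

Lemma tot_tr_gr n x : x \in tot_gr D n -> tot_tr x \in tot_gr (transpose D) n.
Proof.
move=> /tot_grP xg; apply/tot_grP => i j ij /=.
by rewrite xg ?raddf0 //; lia.
Qed.

End TransposeTotal.

Lemma tot_trK D x : tot_tr (tot_tr x) = x :> tot D.
Proof. by apply: bifP => p q; rewrite /= mulnC signedK. Qed.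

Lemma tot_tr_cycles D n (x : tot D) :
  x \in fc_cycles (tot D) n -> tot_tr x \in fc_cycles (tot (transpose D)) n.
Proof.
move=> /fc_cyclesP[xg xd]; apply/fc_cyclesP; split; first exact: tot_tr_gr.
rewrite -[fc_d _ _]tot_tr_d [tot_d x]xd.
by apply: bifP => p q; rewrite /= raddf0.
Qed.

Lemma tot_tr_boundaries D n (x : tot D) :
  x \in fc_boundaries (tot D) n -> tot_tr x \in fc_boundaries (tot (transpose D)) n.
Proof.
move=> /fc_boundariesP[z zg <-]; apply/fc_boundariesP.
by exists (tot_tr z); [exact: tot_tr_gr | rewrite -[fc_d _ _]tot_tr_d].
Qed.

Section Balance.
Variables (D : double_complex) (A A' : chain_complex).
Variable eps : forall p, {additive D p 0%N -> A p}.
Variable eps' : forall q, {additive D 0%N q -> A' q}.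
Hypothesis H : row_augmentation eps.
Hypothesis H' : row_augmentation (D := transpose D) eps'.

(** The zigzag relation of the classical balance argument: [a] and [c] are the two ends of one total
    cycle. Each end is a boundary exactly when that total cycle is one, whence
    [balanced_boundaries]. *)
Definition balanced n (a : A n) (c : A' n) : Prop :=
  exists2 x, x \in fc_cycles (tot D) n & eps n (x n 0%N) = a /\ eps' n (x 0%N n) = c.

Lemma balancedB n (a b : A n) (c e : A' n) :
  balanced a c -> balanced b e -> balanced (a - b) (c - e).
Proof.
move=> [x xZ [<- <-]] [y yZ [<- <-]]; exists (x - y : tot D); first exact: rpredB.
by rewrite !bifBE !raddfB.
Qed.

Lemma balanced_l n (a : A n) : a \in cycles A n ->
  exists2 c, c \in cycles A' n & balanced a c.
Proof.
move=> /(raug_lift H)[x xZ xa]; exists (eps' n (x 0%N n)); last by exists x.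
exact: (raug_cycles H' (tot_tr_cycles xZ)).
Qed.

Lemma balanced_r n (c : A' n) : c \in cycles A' n ->
  exists2 a, a \in cycles A n & balanced a c.
Proof.
move=> /(raug_lift H')[x xZ xc].
have yZ := tot_tr_cycles xZ; exists (eps n (tot_tr x n 0%N)).
  exact: (raug_cycles H yZ).
by exists (tot_tr x) => //; split=> //; rewrite /= muln0.
Qed.

Lemma balanced_boundaries n (a : A n) (c : A' n) : balanced a c ->
  (a \in boundaries A n <-> c \in boundaries A' n).
Proof.
move=> [x xZ [<- <-]]; rewrite -(raug_boundaries H xZ).
have e : eps' n (x 0%N n) = eps' n (tot_tr x n 0%N) by [].
rewrite e -(raug_boundaries H' (tot_tr_cycles xZ)).
split=> [|/tot_tr_boundaries]; first exact: tot_tr_boundaries.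
by rewrite [tot_tr _](tot_trK x).
Qed.

Lemma balanced_iso n : zmod_iso (homology A n) (homology A' n).
Proof.
apply: (zmod_iso_rel (@balancedB n)) => [a|c|a c _ _].
- exact: balanced_l.
- exact: balanced_r.
- exact: balanced_boundaries.
Qed.

End Balance.

(** * Exactness of tensor products and balance of Tor *)

Section PureTensors.
Context {d : Order.disp_t} {P : porderType d}.
Variables (F : presheaf P) (G : copresheaf P).

Definition ptens (p : P) (a : F p) (b : G p) : psh_tensor F G :=
  tens_pi F G (tens_in F G p (pure a b)).

Lemma ptensDl p (a a' : F p) (b : G p) : ptens (a + a') b = ptens a b + ptens a' b.
Proof. by rewrite /ptens pureDl !raddfD. Qed.

Lemma ptensDr p (a : F p) (b b' : G p) : ptens a (b + b') = ptens a b + ptens a b'.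
Proof. by rewrite /ptens pureDr !raddfD. Qed.

Fact ptensl_is_zmod_morphism p (b : G p) : zmod_morphism (fun a : F p => ptens a b).
Proof. by move=> a a'; apply/(addIr (ptens a' b)); rewrite -ptensDl !subrK. Qed.

Fact ptensr_is_zmod_morphism p (a : F p) : zmod_morphism (fun b : G p => ptens a b).
Proof. by move=> b b'; apply/(addIr (ptens a b')); rewrite -ptensDr !subrK. Qed.

Definition ptensl p (b : G p) : {additive F p -> psh_tensor F G} :=
  additive_of (ptensl_is_zmod_morphism b).

Definition ptensr p (a : F p) : {additive G p -> psh_tensor F G} :=
  additive_of (ptensr_is_zmod_morphism a).

Lemma ptens_balance (x y : P) (h : (y <= x)%O) (a : F x) (b : G y) :
  ptens (pres F h a) b = ptens a (cmap G h b).
Proof. exact: tens_balance. Qed.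

(** The quotient map by [S] vanishes on pure tensors, hence is zero. *)
Lemma psh_tensor_ind (S : zmodClosed (psh_tensor F G)) :
  (forall p (a : F p) (b : G p), ptens a b \in S) -> forall t, t \in S.
Proof.
move=> HS t; apply/quot_eq0.
apply: (psh_tensor_ext (u := quot_pi S) (v := add_zero _ _)) => p a b.
exact/quot_eq0/HS.
Qed.

Section Lift.
Variables (C : zmodType) (f : forall p, F p -> G p -> C).
Hypothesis fDl : forall p a a' b, f (p := p) (a + a') b = f a b + f a' b.
Hypothesis fDr : forall p a b b', f (p := p) a (b + b') = f a b + f a b'.
Hypothesis f_balance : forall (x y : P) (h : (y <= x)%O) (a : F x) (b : G y),
  f (pres F h a) b = f a (cmap G h b).

Definition tens_sum_lift : {additive tens_sum F G -> C} :=
  dsum_lift (fun p => tensor_lift (@fDl p) (@fDr p)).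

Fact psh_tensor_lift_subproof z :
  z \in image_of (add_sub (tens_l F G) (tens_r F G)) -> tens_sum_lift z = 0.
Proof.
move=> /imageP[w <-]; rewrite add_subE raddfB; apply/eqP; rewrite subr_eq0; apply/eqP.
apply: (dsum_ext (f := add_comp tens_sum_lift (tens_l F G))
                 (g := add_comp tens_sum_lift (tens_r F G))) => xy t.
apply: (tensor_ext (f := add_comp (add_comp tens_sum_lift (tens_l F G)) (din _ xy))
          (g := add_comp (add_comp tens_sum_lift (tens_r F G)) (din _ xy))) => a b.
rewrite !add_compE /tens_l /tens_r !dsum_liftE !tensor_mapE !tensor_liftE.
exact: f_balance.
Qed.

Definition psh_tensor_lift : {additive psh_tensor F G -> C} :=
  quot_lift psh_tensor_lift_subproof.

Lemma psh_tensor_liftE p (a : F p) (b : G p) : psh_tensor_lift (ptens a b) = f a b.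
Proof.
rewrite /psh_tensor_lift /ptens quot_liftE /tens_sum_lift /tens_in dsum_liftE.
exact: tensor_liftE.
Qed.

End Lift.
End PureTensors.

Arguments ptens {d P} F G {p} a b.
Arguments ptensl {d P} F G {p} b.
Arguments ptensr {d P} F G {p} a.

Lemma ptens_map d d' (Q : porderType d) (P : porderType d') (f : {omorphism Q -> P})
    (E : presheaf Q) (F : presheaf P) (G : copresheaf Q) (H : copresheaf P)
    (phi : pmor f E F) (gamma : cmor f G H) q (a : E q) (b : G q) :
  tens_map phi gamma (ptens E G a b) = ptens F H (phi q a) (gamma q b).
Proof. exact: tens_mapE. Qed.

Section TensorMapExactness.
Context {d : Order.disp_t} {P : porderType d}.

Lemma tens_map_surj (E F : presheaf P) (G H : copresheaf P)
    (phi : psh_hom E F) (gamma : cmor idfun G H) :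
  (forall p a, exists a', phi p a' = a) -> (forall p b, exists b', gamma p b' = b) ->
  forall t, exists s, tens_map phi gamma s = t.
Proof.
move=> phis gammas t; apply/imageP; apply: psh_tensor_ind => p a b.
have [a' <-] := phis p a; have [b' <-] := gammas p b.
by apply/imageP; exists (ptens E G a' b'); rewrite ptens_map.
Qed.

(** Exactness in the middle, with only the inclusion of the kernel in the image assumed and
    concluded. Taking [u] to be zero gives preservation of injectivity, as in [coflat_inj] for the
    dual notion. *)
Definition flat (R : presheaf P) : Prop :=
  forall (G1 G2 G3 : copresheaf P) (u : cmor idfun G1 G2) (v : cmor idfun G2 G3),
  (forall p y, v p y = 0 -> exists x, u p x = y) ->
  forall t, tens_map (pmor_id R) v t = 0 -> exists s, tens_map (pmor_id R) u s = t.

Definition coflat (Q : copresheaf P) : Prop :=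
  forall (M1 M2 M3 : presheaf P) (u : psh_hom M1 M2) (v : psh_hom M2 M3),
  (forall p y, v p y = 0 -> exists x, u p x = y) ->
  forall t, tens_map v (cmor_id Q) t = 0 -> exists s, tens_map u (cmor_id Q) s = t.

End TensorMapExactness.

(** * Free presheaves are flat *)

Section FreeBasis.
Context {d : Order.disp_t} {P : porderType d}.

(* [fb_ext] says that the restrictions of the [fb_elt i] generate [R p], and
   [fb_coef] that they are independent. *)
Record free_basis (R : presheaf P) := FreeBasis {
  fb_ix :> choiceType;
  fb_pt : fb_ix -> P;
  fb_elt : forall i, R (fb_pt i);
  fb_coef : forall p, {additive R p -> freeab fb_ix};
  fb_coefE : forall p i (h : (p <= fb_pt i)%O), fb_coef p (pres R h (fb_elt i)) = fgen i;
  fb_ext : forall p (C : zmodType) (u v : {additive R p -> C}),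
    (forall i (h : (p <= fb_pt i)%O),
       u (pres R h (fb_elt i)) = v (pres R h (fb_elt i))) -> u =1 v }.

(** The type of [fb_coef] does not record that the basis elements occurring in [R p] sit at points
    above [p]; the extension by zero spares carrying this inequality. *)
Definition cmap0 (G : copresheaf P) (p q : P) : {additive G p -> G q} :=
  if pselect (p <= q)%O is left h then cmap G h else add_zero _ _.

Lemma cmap0E (G : copresheaf P) (p q : P) (h : (p <= q)%O) : cmap0 G p q = cmap G h.
Proof. by rewrite /cmap0; case: pselect => [h'|] //; rewrite (eq_irrelevance h h'). Qed.

Variables (R : presheaf P) (b : free_basis R).

Section Coordinates.
Variable G : copresheaf P.

(** By the Yoneda lemma, tensoring the free presheaf [Z[Hom(-, p)]] with [G] gives [G p]. So this
    sum is a model of the tensor product of [R] and [G], and flatness reduces to exactness at each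
    point. *)
Definition basis_sum : zmodType := dsum (fun i : b => G (fb_pt i)).

Definition basis_in i : {additive G (fb_pt i) -> basis_sum} :=
  din (fun i : b => G (fb_pt i)) i.

Definition coord_bilin p (r : R p) (g : G p) : basis_sum :=
  freeab_lift (fun i => basis_in i (cmap0 G p (fb_pt i) g)) (fb_coef b p r).

Lemma coord_bilinE p i (h : (p <= fb_pt i)%O) (g : G p) :
  coord_bilin (pres R h (fb_elt i)) g = basis_in i (cmap G h g).
Proof. by rewrite /coord_bilin fb_coefE freeab_liftE (cmap0E _ h). Qed.

Fact coord_bilinB p g : zmod_morphism (fun r : R p => coord_bilin r g).
Proof. by move=> r r'; rewrite /coord_bilin !raddfB. Qed.

Definition coordl p g : {additive R p -> basis_sum} := additive_of (@coord_bilinB p g).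

Fact coord_bilinDl p (r r' : R p) g :
  coord_bilin (r + r') g = coord_bilin r g + coord_bilin r' g.
Proof. exact: (raddfD (coordl g)). Qed.

Fact coord_bilinDr p (r : R p) g g' :
  coord_bilin r (g + g') = coord_bilin r g + coord_bilin r g'.
Proof.
apply: (fb_ext (f := b) (u := coordl (g + g')) (v := coordl g \+ coordl g')) => i h /=.
by rewrite !coord_bilinE !raddfD.
Qed.

Fact coord_bilin_balance (x y : P) (h : (y <= x)%O) (r : R x) (g : G y) :
  coord_bilin (pres R h r) g = coord_bilin r (cmap G h g).
Proof.
apply: (fb_ext (f := b) (u := add_comp (coordl g) (pres R h)) (v := coordl (cmap G h g))) => i k /=.
rewrite (pres_comp h k (le_trans h k)) !coord_bilinE.
by rewrite (cmap_comp h k (le_trans h k)).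
Qed.

Definition coord : {additive psh_tensor R G -> basis_sum} :=
  psh_tensor_lift coord_bilinDl coord_bilinDr coord_bilin_balance.

Lemma coordE p (r : R p) (g : G p) : coord (ptens R G r g) = coord_bilin r g.
Proof. exact: psh_tensor_liftE. Qed.

Definition uncoord : {additive basis_sum -> psh_tensor R G} :=
  dsum_lift (fun i => ptensr R G (fb_elt i)).

Lemma uncoordE i g : uncoord (basis_in i g) = ptens R G (fb_elt i) g.
Proof. by rewrite /uncoord /basis_in dsum_liftE. Qed.

Lemma coordK : cancel coord uncoord.
Proof.
apply: (psh_tensor_ext (u := add_comp uncoord coord) (v := add_id _)) => p r g.
change (uncoord (coord (ptens R G r g)) = ptens R G r g); rewrite coordE.
apply: (fb_ext (f := b) (u := add_comp uncoord (coordl g))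
  (v := ptensl R G g)) => i h.
by rewrite -[RHS]/(ptens R G _ g) add_compE -[coordl g _]/(coord_bilin _ g)
  coord_bilinE uncoordE ptens_balance.
Qed.

End Coordinates.

Lemma coord_natural (G H : copresheaf P) (u : cmor idfun G H) t i :
  coord H (tens_map (pmor_id R) u t) i = u _ (coord G t i).
Proof.
pose proj (K : copresheaf P) : {additive basis_sum K -> K (fb_pt i)} :=
  @additive_of (basis_sum K) _ (fun x => x i) (fun _ _ => erefl).
apply: (psh_tensor_ext
  (u := add_comp (proj H) (add_comp (coord H) (tens_map (pmor_id R) u)))
  (v := add_comp (u _) (add_comp (proj G) (coord G)))) => p r g.
rewrite !add_compE tens_mapE !coordE.
apply: (fb_ext (f := b) (u := add_comp (proj H) (coordl (u p g)))
  (v := add_comp (u _) (add_comp (proj G) (coordl g)))) => j h.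
change (coord_bilin (pres R h (fb_elt j)) (u p g) i =
  u _ (coord_bilin (pres R h (fb_elt j)) g i)).
rewrite !coord_bilinE -(cmor_nat u h) /= /din_val.
have [ij|ij] := eqVneq j i; first by subst j; rewrite !dfwith_in.
by rewrite !dfwith_out // raddf0.
Qed.

(** Preimages under [u] are chosen coordinate by coordinate, on the finite support of [coord t], and
    reassembled by [uncoord]. *)
Lemma free_basis_flat : flat R.
Proof.
move=> G1 G2 G3 u v uv t vt0.
have c0 i : {x | u _ x = coord G2 t i}.
  by apply/cid/uv; rewrite -coord_natural vt0 raddf0.
have [s us ts] := dsum_support (coord G2 t).
exists (\sum_(i <- s) ptens R G1 (fb_elt i) (sval (c0 i))).
rewrite raddf_sum -[RHS]coordK {2}(dsum_sum_din us ts) raddf_sum.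
apply: eq_bigr => i _; rewrite ptens_map (svalP (c0 i)).
by rewrite [RHS]uncoordE.
Qed.

End FreeBasis.

Section CoverBasis.
Context {d : Order.disp_t} {P : porderType d}.
Variable K : presheaf P.

Definition cover_germ p (s : cover_gen K p) : {p : P & K p} := germ (gen_elt s).

Definition cover_elt (i : {p : P & K p}) : cover K (tag i) :=
  fgen (CoverGen (tagged i) (lexx _)).

Lemma cover_gen_ind p (s : cover_gen K p) (h : (p <= tag (cover_germ s))%O) :
  pres (cover K) h (cover_elt (cover_germ s)) = fgen s.
Proof. by rewrite [LHS]cover_resE; congr fgen; apply: cover_gen_eq. Qed.

Fact cover_coefE p (i : {p : P & K p}) (h : (p <= tag i)%O) :
  freeab_map (@cover_germ p) (pres (cover K) h (cover_elt i)) = fgen i.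
Proof. by rewrite [pres _ _ _]cover_resE freeab_mapE; case: i h. Qed.

Fact cover_fb_ext p (C : zmodType) (u v : {additive cover K p -> C}) :
  (forall i (h : (p <= tag i)%O), u (pres (cover K) h (cover_elt i)) =
     v (pres (cover K) h (cover_elt i))) -> u =1 v.
Proof.
move=> uv; apply: freeab_ext => s.
by rewrite -(cover_gen_ind (gen_le s : (p <= tag (cover_germ s))%O)) uv.
Qed.

Definition cover_basis : free_basis (cover K) :=
  @FreeBasis _ _ (cover K) {p : P & K p} tag cover_elt
    (fun p => freeab_map (@cover_germ p)) cover_coefE cover_fb_ext.

End CoverBasis.

Section Resolutions.
Context {d : Order.disp_t} {P : porderType d}.

(** Exactness alone, so that the restriction of a standard resolution to a fiber is covered;
    flatness is asked for separately. *)
Record presheaf_resolution (F : presheaf P) := PresheafResolution {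
  pr_ob :> nat -> presheaf P;
  pr_diff : forall n, psh_hom (pr_ob n.+1) (pr_ob n);
  pr_aug : psh_hom (pr_ob 0%N) F;
  pr_aug_surj : forall x a, exists b, pr_aug x b = a;
  pr_aug_exact : forall x b, pr_aug x b = 0 <-> exists c, pr_diff 0 x c = b;
  pr_diff_exact : forall n x b,
    pr_diff n x b = 0 <-> exists c, pr_diff n.+1 x c = b }.

Definition std_presheaf_resolution (F : presheaf P) : presheaf_resolution F :=
  PresheafResolution (counit_surj (F := F)) (std_aug_exact (F := F))
    (std_diff_exact (F := F)).

Record copresheaf_resolution (G : copresheaf P) := CopresheafResolution {
  cr_ob :> nat -> copresheaf P;
  cr_diff : forall n, cmor idfun (cr_ob n.+1) (cr_ob n);
  cr_aug : cmor idfun (cr_ob 0%N) G;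
  cr_aug_surj : forall x a, exists b, cr_aug x b = a;
  cr_aug_exact : forall x b, cr_aug x b = 0 <-> exists c, cr_diff 0 x c = b;
  cr_diff_exact : forall n x b,
    cr_diff n x b = 0 <-> exists c, cr_diff n.+1 x c = b }.

Variables (F : presheaf P) (G : copresheaf P).
Variables (R : presheaf_resolution F) (Q : copresheaf_resolution G).

Lemma pr_diff_sq n x b : pr_diff R n x (pr_diff R n.+1 x b) = 0.
Proof. by apply/pr_diff_exact; exists b. Qed.

Lemma cr_diff_sq n x b : cr_diff Q n x (cr_diff Q n.+1 x b) = 0.
Proof. by apply/cr_diff_exact; exists b. Qed.

Lemma tens_map_comp0l (E1 E2 E3 : presheaf P) (H : copresheaf P)
    (u : psh_hom E1 E2) (v : psh_hom E2 E3) :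
  (forall p a, v p (u p a) = 0) ->
  forall x, tens_map v (cmor_id H) (tens_map u (cmor_id H) x) = 0.
Proof.
move=> vu; apply: (psh_tensor_ext
  (u := add_comp (tens_map v (cmor_id H)) (tens_map u (cmor_id H))) (v := add_zero _ _)).
by move=> p a b; rewrite add_compE !tens_mapE vu; exact: (raddf0 (ptensl E3 H _)).
Qed.

Lemma tens_map_comp0r (E : presheaf P) (H1 H2 H3 : copresheaf P)
    (u : cmor idfun H1 H2) (v : cmor idfun H2 H3) :
  (forall p a, v p (u p a) = 0) ->
  forall x, tens_map (pmor_id E) v (tens_map (pmor_id E) u x) = 0.
Proof.
move=> vu; apply: (psh_tensor_ext
  (u := add_comp (tens_map (pmor_id E) v) (tens_map (pmor_id E) u)) (v := add_zero _ _)).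
by move=> p a b; rewrite add_compE !tens_mapE vu; exact: (raddf0 (ptensr E H3 _)).
Qed.

Lemma tens_map_interchange (E1 E2 : presheaf P) (H1 H2 : copresheaf P)
    (u : psh_hom E1 E2) (v : cmor idfun H1 H2) x :
  tens_map u (cmor_id H2) (tens_map (pmor_id E1) v x) =
  tens_map (pmor_id E2) v (tens_map u (cmor_id H1) x).
Proof.
apply: (psh_tensor_ext
  (u := add_comp (tens_map u (cmor_id H2)) (tens_map (pmor_id E1) v))
  (v := add_comp (tens_map (pmor_id E2) v) (tens_map u (cmor_id H1)))) => p a b.
by rewrite !add_compE !tens_mapE.
Qed.

Definition tens_double_complex : double_complex :=
  @DoubleComplex (fun p q => psh_tensor (R p) (Q q))
    (fun p q => tens_map (pr_diff R p) (cmor_id (Q q)))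
    (fun p q => tens_map (pmor_id (R p)) (cr_diff Q q))
    (fun p q => tens_map_comp0l (pr_diff_sq (n := p)))
    (fun p q => tens_map_comp0r (cr_diff_sq (n := q)))
    (fun p q => tens_map_interchange (pr_diff R p) (cr_diff Q q)).

Definition tens_resolution_l : chain_complex :=
  @ChainComplex (fun n => psh_tensor (R n) G) (fun n => tens_map (pr_diff R n) (cmor_id G))
    (fun n => tens_map_comp0l (pr_diff_sq (n := n))).

Definition tens_resolution_r : chain_complex :=
  @ChainComplex (fun n => psh_tensor F (Q n)) (fun n => tens_map (pmor_id F) (cr_diff Q n))
    (fun n => tens_map_comp0r (cr_diff_sq (n := n))).

Lemma tens_row_augmentation : (forall p, flat (R p)) ->
  row_augmentation (D := tens_double_complex) (A := tens_resolution_l)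
    (fun p => tens_map (pmor_id (R p)) (cr_aug Q)).
Proof.
move=> Rflat; split=> [p|p x|p q x|p x].
- by apply: tens_map_surj => [x a|]; [exists a | exact: cr_aug_surj].
- split=> [|[y <-]]; first by apply: Rflat => z y /cr_aug_exact.
  by apply: tens_map_comp0r => z y'; apply/cr_aug_exact; exists y'.
- by apply: Rflat => z y /cr_diff_exact.
exact: (esym (tens_map_interchange (pr_diff R p) (cr_aug Q) x)).
Qed.

Lemma tens_col_augmentation : (forall q, coflat (Q q)) ->
  row_augmentation (D := transpose tens_double_complex) (A := tens_resolution_r)
    (fun q => tens_map (pr_aug R) (cmor_id (Q q))).
Proof.
move=> Qflat; split=> [p|p x|p q x|p x].
- by apply: tens_map_surj => [|x a]; [exact: pr_aug_surj | exists a].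
- split=> [|[y <-]]; first by apply: Qflat => z y /pr_aug_exact.
  by apply: tens_map_comp0l => z y'; apply/pr_aug_exact; exists y'.
- by apply: Qflat => z y /pr_diff_exact.
exact: (tens_map_interchange (pr_aug R) (cr_diff Q p) x).
Qed.

End Resolutions.

(** * Duality between presheaves and copresheaves *)

Section Duality.
Context {d : Order.disp_t} {P : porderType d}.

Definition op_presheaf (G : copresheaf P) : presheaf P^d :=
  @Presheaf _ P^d G (fun (x y : P^d) (h : (x <= y)%O) => cmap G (h : ((y : P) <= x)%O))
    (fun x h => cmap_id (h : ((x : P) <= x)%O))
    (fun x y z hxy hyz hxz => cmap_comp (c := G) (hyz : ((z : P) <= y)%O) hxy hxz).

Definition op_copresheaf (F : presheaf P) : copresheaf P^d :=
  @Copresheaf _ P^d F (fun (x y : P^d) (h : (x <= y)%O) => pres F (h : ((y : P) <= x)%O))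
    (fun x h => pres_id (h : ((x : P) <= x)%O))
    (fun x y z hxy hyz hxz => pres_comp (p := F) (hyz : ((z : P) <= y)%O) hxy hxz).

Definition unop_copresheaf (R : presheaf P^d) : copresheaf P :=
  @Copresheaf _ P R (fun (x y : P) (h : (x <= y)%O) => pres R (h : ((y : P^d) <= x)%O))
    (fun x h => pres_id (h : ((x : P^d) <= x)%O))
    (fun x y z hxy hyz hxz => pres_comp (p := R) (hyz : ((z : P^d) <= y)%O) hxy hxz).

End Duality.

Section Swap.
Context {d : Order.disp_t} {P : porderType d}.
Variable R : presheaf P^d.

Section SwapIso.
Variable M : presheaf P.

Definition swap : {additive psh_tensor M (unop_copresheaf R) -> psh_tensor R (op_copresheaf M)} :=
  psh_tensor_lift (F := M) (G := unop_copresheaf R)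
    (f := fun p a b => ptens R (op_copresheaf M) (p := p) b a)
    (fun p a a' b => ptensDr (F := R) (G := op_copresheaf M) b a a')
    (fun p a b b' => ptensDl (F := R) (G := op_copresheaf M) b b' a)
    (fun x y h a b => esym (ptens_balance (F := R) (G := op_copresheaf M) (h : (x : P^d) <= y)%O
       b a)).

Definition unswap : {additive psh_tensor R (op_copresheaf M) -> psh_tensor M (unop_copresheaf R)} :=
  psh_tensor_lift (F := R) (G := op_copresheaf M)
    (f := fun p b a => ptens M (unop_copresheaf R) (p := p) a b)
    (fun p b b' a => ptensDr (F := M) (G := unop_copresheaf R) a b b')
    (fun p b a a' => ptensDl (F := M) (G := unop_copresheaf R) a a' b)
    (fun x y h b a => esym (ptens_balance (F := M) (G := unop_copresheaf R) (h : (x : P) <= y)%O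
       a b)).

Lemma swapE p (a : M p) (b : R p) :
  swap (ptens M (unop_copresheaf R) (p := p) a b) = ptens R (op_copresheaf M) (p := p) b a.
Proof. exact: psh_tensor_liftE. Qed.

Lemma unswapE p (a : M p) (b : R p) :
  unswap (ptens R (op_copresheaf M) (p := p) b a) = ptens M (unop_copresheaf R) (p := p) a b.
Proof. exact: psh_tensor_liftE. Qed.

Lemma swapK : cancel swap unswap.
Proof.
apply: (psh_tensor_ext (u := add_comp unswap swap) (v := add_id _)) => p a b.
exact: etrans (congr1 unswap (swapE a b)) (unswapE a b).
Qed.

Lemma unswapK : cancel unswap swap.
Proof.
apply: (psh_tensor_ext (u := add_comp swap unswap) (v := add_id _)) => p b a.
exact: etrans (congr1 swap (unswapE a b)) (swapE a b).
Qed.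

End SwapIso.

Definition op_cmor (M N : presheaf P) (u : psh_hom M N) :
    cmor idfun (op_copresheaf M) (op_copresheaf N) :=
  @CMor _ _ P^d P^d idfun (op_copresheaf M) (op_copresheaf N) (fun p => u p)
    (fun x y h h' => pmor_nat u (h : ((y : P) <= x)%O) h').

Lemma swap_natural (M N : presheaf P) (u : psh_hom M N) t :
  swap N (tens_map u (cmor_id _) t) = tens_map (pmor_id R) (op_cmor u) (swap M t).
Proof.
apply: (psh_tensor_ext (u := add_comp (swap N) (tens_map u (cmor_id _)))
  (v := add_comp (tens_map (pmor_id R) (op_cmor u)) (swap M))) => p a b.
rewrite !add_compE tens_mapE [swap N _]swapE.
by rewrite [swap M _]swapE ptens_map.
Qed.

(** The symmetry [swap] turns tensoring over [P] with the copresheaf into tensoring over [P^d] with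
    [R], naturally in the other factor. *)
Lemma flat_coflat : flat R -> coflat (unop_copresheaf R).
Proof.
move=> Rflat M1 M2 M3 u v uv t vt0.
have [|s sE] := Rflat _ _ _ (op_cmor u) (op_cmor v) uv (swap M2 t).
  by rewrite -swap_natural vt0 raddf0.
exists (unswap M1 s); apply: (can_inj (@swapK M2)).
by rewrite swap_natural unswapK sE.
Qed.

End Swap.

Section StandardCoresolution.
Context {d : Order.disp_t} {P : porderType d}.

Definition unop_cmor (R R' : presheaf P^d) (u : psh_hom R R') :
    cmor idfun (unop_copresheaf R) (unop_copresheaf R') :=
  @CMor _ _ P P idfun (unop_copresheaf R) (unop_copresheaf R') (fun p => u p)
    (fun x y h h' => pmor_nat u (h : ((y : P^d) <= x)%O) h').

Variable G : copresheaf P.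

Definition costd_aug : cmor idfun (unop_copresheaf (std_ob (op_presheaf G) 0)) G :=
  @CMor _ _ P P idfun (unop_copresheaf (std_ob (op_presheaf G) 0)) G
    (fun p => std_aug (op_presheaf G) p)
    (fun x y h h' => pmor_nat (std_aug (op_presheaf G)) (h : ((y : P^d) <= x)%O) h').

Definition costd_resolution : copresheaf_resolution G :=
  @CopresheafResolution _ P G (fun n => unop_copresheaf (std_ob (op_presheaf G) n))
    (fun n => unop_cmor (std_diff (op_presheaf G) n)) costd_aug
    (counit_surj (F := op_presheaf G)) (std_aug_exact (F := op_presheaf G))
    (std_diff_exact (F := op_presheaf G)).

Lemma costd_coflat n : coflat (costd_resolution n).
Proof. exact/flat_coflat/free_basis_flat/cover_basis. Qed.

End StandardCoresolution.

Lemma std_flat d (P : porderType d) (F : presheaf P) n : flat (std_ob F n).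
Proof. exact/free_basis_flat/cover_basis. Qed.

Lemma Tor_balanced d (P : porderType d) (F : presheaf P) (G : copresheaf P) n :
  zmod_iso (Tor n F G) (homology (tens_resolution_r F (costd_resolution G)) n).
Proof.
exact: (balanced_iso
  (tens_row_augmentation (R := std_presheaf_resolution F) (costd_resolution G)
    (fun p => @std_flat _ _ F p))
  (tens_col_augmentation (std_presheaf_resolution F) (@costd_coflat _ _ G))).
Qed.

(** * Comparison of flat resolutions through balance *)

Section ResolutionComparison.
Context {d : Order.disp_t} {P : porderType d}.
Variables (F : presheaf P) (G : copresheaf P).
Variables (R R' : presheaf_resolution F).
Hypothesis Rflat : forall n, flat (R n).
Hypothesis Rflat' : forall n, flat (R' n).
Variable w : forall n, psh_hom (R n) (R' n).
Hypothesis w_diff : forall n p a, w n p (pr_diff R n p a) = pr_diff R' n p (w n.+1 p a).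
Hypothesis w_aug : forall p a, pr_aug R' p (w 0%N p a) = pr_aug R p a.

Let Q := costd_resolution G.

Let bal n a c := balanced (D := tens_double_complex R Q)
  (A := tens_resolution_l G R) (A' := tens_resolution_r F Q)
  (fun p => tens_map (pmor_id (R p)) (cr_aug Q))
  (fun q => tens_map (pr_aug R) (cmor_id (Q q))) (n := n) a c.

Let bal' n a c := balanced (D := tens_double_complex R' Q)
  (A := tens_resolution_l G R') (A' := tens_resolution_r F Q)
  (fun p => tens_map (pmor_id (R' p)) (cr_aug Q))
  (fun q => tens_map (pr_aug R') (cmor_id (Q q))) (n := n) a c.

Let H := tens_row_augmentation Q Rflat.
Let H' := tens_row_augmentation Q Rflat'.
Let K := tens_col_augmentation R (@costd_coflat _ _ G).
Let K' := tens_col_augmentation R' (@costd_coflat _ _ G).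

Lemma comparison_square (E : copresheaf P) n x :
  tens_map (w n) (cmor_id E) (tens_map (pr_diff R n) (cmor_id E) x) =
  tens_map (pr_diff R' n) (cmor_id E) (tens_map (w n.+1) (cmor_id E) x).
Proof. exact: tens_map_square (@w_diff n) x. Qed.

(** Applying [w] to every entry of the total cycle moves its end over [G] by [w] and fixes its end
    over [F], because [w] lies over the identity of [F]. Both homologies are thus identified with
    that of [F] tensored with [Q], compatibly with [w], and no homotopy inverse of [w] has to be
    built. *)
Lemma comparison_balanced n a c : bal a c -> bal' (tens_map (w n) (cmor_id G) a) c.
Proof.
move=> [x /fc_cyclesP[/tot_grP xg xd] [<- <-]].
pose y : tot (tens_double_complex R' Q) :=
  Bifamily (D := tens_double_complex R' Q) (fun p q => tens_map (w p) (cmor_id (Q q)) (x p q)).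
exists y.
  apply/fc_cyclesP; split.
    apply/tot_grP => i j ij.
    exact: etrans (congr1 _ (xg i j ij)) (raddf0 (tens_map (w i) (cmor_id (Q j)))).
  apply: bifP => p q.
  have -> : tot_d y p q = tens_map (w p) (cmor_id (Q q)) (tot_d x p q).
    rewrite [LHS]tot_dE [in RHS]tot_dE raddfD raddf_signed; congr (_ + signed _ _).
      exact/esym/comparison_square.
    exact: (esym (tens_map_interchange (w p) (cr_diff Q q) (x p q.+1))).
  by rewrite [tot_d x]xd raddf0.
split; first exact: (esym (tens_map_interchange (w n) (cr_aug Q) (x n 0%N))).
pose L := add_comp (tens_map (pr_aug R') (cmor_id (Q n)))
  (tens_map (w 0%N) (cmor_id (Q n))).
apply: (psh_tensor_ext (u := L) (v := tens_map (pr_aug R) (cmor_id (Q n)))) => p r b.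
by rewrite /L add_compE !tens_mapE w_aug.
Qed.

(** Choose [a] balanced with the same [e] as [c]: then [c] minus the image of [a] is balanced with
    zero. *)
Lemma comparison_surj n c : c \in cycles (tens_resolution_l G R') n ->
  exists2 a, a \in cycles (tens_resolution_l G R) n &
    c - tens_map (w n) (cmor_id G) a \in boundaries (tens_resolution_l G R') n.
Proof.
move=> /(balanced_l H' K')[e eZ ce].
have [a aZ ae] := balanced_r H K eZ.
exists a => //; have := balancedB ce (comparison_balanced ae).
by move=> /(balanced_boundaries H' K') ->; rewrite subrr rpred0.
Qed.

Lemma comparison_inj n a : a \in cycles (tens_resolution_l G R) n ->
  tens_map (w n) (cmor_id G) a \in boundaries (tens_resolution_l G R') n ->
  a \in boundaries (tens_resolution_l G R) n.
Proof.
move=> /(balanced_l H K)[e eZ ae].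
move=> /(balanced_boundaries H' K' (comparison_balanced ae)).
by move=> /(balanced_boundaries H K ae).
Qed.

End ResolutionComparison.

(** * Restriction to the fibers *)

Section FiberColimit.
Context {d d' : Order.disp_t} {B : porderType d} {Psi : poset_functor d' B}.
Local Notation S := (total_space Psi).
Local Notation Zc x := (constant_copresheaf (Psi x) int).

(** Two restrictions of one element agree in the colimit over the fiber. The inequality [p' <= p]
    also serves where [p] and [p'] are equal by a functor law of [Psi], so that no transport along
    that equality is needed. *)
Lemma fiber_ptens_pres_eq (R : presheaf S) (x : B) (p p' : Psi x) (u : S)
    (k : (total_pt p <= u)%O) (k' : (total_pt p' <= u)%O) (r : R u) (n : int) :
  (p' <= p)%O ->
  ptens (fiber_presheaf R x) (Zc x) (p := p) (pres R k r) n =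
  ptens (fiber_presheaf R x) (Zc x) (p := p') (pres R k' r) n.
Proof.
move=> pp'; rewrite -[RHS](congr1 (fun a => ptens (fiber_presheaf R x) (Zc x) (p := p') a n)
  (pres_comp (omorph_le (fiber_incl Psi x) pp') k k' r)).
exact/esym/(ptens_balance (F := fiber_presheaf R x) (G := Zc x) pp').
Qed.

Section Ob.
Variable R : presheaf S.

Definition fib_colim_ob (x : B) : zmodType := psh_tensor (fiber_presheaf R x) (Zc x).

Definition fib_colim_res (x y : B) (h : (x <= y)%O) :
    {additive fib_colim_ob y -> fib_colim_ob x} :=
  tens_map (fiber_res R h) (constant_cmor (pf_map Psi h) int).

Lemma fib_colim_resE (x y : B) (h : (x <= y)%O) (b : Psi y) (r : R (total_pt b)) (n : int) :
  fib_colim_res h (ptens (fiber_presheaf R y) (Zc y) (p := b) r n) =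
  ptens (fiber_presheaf R x) (Zc x) (p := pf_map Psi h b) (pres R (transport_le h b) r) n.
Proof. exact: ptens_map. Qed.

Fact fib_colim_id (x : B) (h : (x <= x)%O) t : fib_colim_res h t = t.
Proof.
apply: (psh_tensor_ext (u := fib_colim_res h) (v := add_id _)) => b r n.
rewrite [LHS]fib_colim_resE.
rewrite (fiber_ptens_pres_eq _ (lexx (total_pt b))) ?pf_id //.
by rewrite pres_id.
Qed.

Fact fib_colim_comp (x y z : B) (hxy : (x <= y)%O) (hyz : (y <= z)%O)
  (hxz : (x <= z)%O) t : fib_colim_res hxy (fib_colim_res hyz t) = fib_colim_res hxz t.
Proof.
apply: (psh_tensor_ext (u := add_comp (fib_colim_res hxy) (fib_colim_res hyz))
  (v := fib_colim_res hxz)) => b r n.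
rewrite add_compE [fib_colim_res hyz _]fib_colim_resE fib_colim_resE.
rewrite [RHS]fib_colim_resE.
have L : (total_pt (pf_map Psi hxy (pf_map Psi hyz b)) <= total_pt b)%O.
  exact: le_trans (transport_le _ _) (transport_le _ _).
rewrite (pres_comp _ _ L); apply: fiber_ptens_pres_eq.
by rewrite (pf_comp hxy hyz hxz).
Qed.

Definition fib_colim : presheaf B := Presheaf fib_colim_id fib_colim_comp.

End Ob.

Section Map.
Variables (R R' : presheaf S) (u : psh_hom R R').

Fact fiber_hom_nat (x : B) (a b : Psi x) (h : (a <= b)%O) (h' : (idfun a <= idfun b)%O) r :
  u (total_pt a) (pres (fiber_presheaf R x) h r) =
  pres (fiber_presheaf R' x) h' (u (total_pt b) r).
Proof. exact: pmor_nat. Qed.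

Definition fiber_hom (x : B) : psh_hom (fiber_presheaf R x) (fiber_presheaf R' x) :=
  @PMor _ _ (Psi x) (Psi x) idfun (fiber_presheaf R x) (fiber_presheaf R' x)
    (fun a => u (total_pt a)) (@fiber_hom_nat x).

Definition fib_colim_map_fun (x : B) : {additive fib_colim R x -> fib_colim R' x} :=
  tens_map (fiber_hom x) (cmor_id (Zc x)).

Fact fib_colim_map_nat (x y : B) (h : (x <= y)%O) (h' : (idfun x <= idfun y)%O) t :
  fib_colim_map_fun x (pres (fib_colim R) h t) =
  pres (fib_colim R') h' (fib_colim_map_fun y t).
Proof.
rewrite (eq_irrelevance h' h).
apply: (psh_tensor_ext (u := add_comp (fib_colim_map_fun x) (fib_colim_res R h))
  (v := add_comp (fib_colim_res R' h) (fib_colim_map_fun y))) => b r n.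
rewrite !add_compE [fib_colim_res R h _]fib_colim_resE.
rewrite [fib_colim_map_fun y _]ptens_map [RHS]fib_colim_resE [LHS]ptens_map.
exact: (congr1 (fun r' => ptens (fiber_presheaf R' x) (Zc x) (p := pf_map Psi h b) r' n)
  (pmor_nat u (transport_le h b) (transport_le h b) r)).
Qed.

Definition fib_colim_map : psh_hom (fib_colim R) (fib_colim R') :=
  @PMor _ _ B B idfun (fib_colim R) (fib_colim R') fib_colim_map_fun fib_colim_map_nat.

End Map.

(* [R (x)_S pi^* G] is isomorphic to [pi_! R (x)_B G], with [pi_! R = fib_colim R]. *)
Section Projection.
Variables (R : presheaf S) (G : copresheaf B).
Local Notation pG := (pullback_copresheaf (fib_proj Psi) G).

Definition fib_pure (s : S) : R s -> fib_colim R (tag s) :=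
  let: existT x b := s in
  fun r => ptens (fiber_presheaf R x) (Zc x) (p := b) r (1 : int).

Fact fib_pureD s (r r' : R s) : fib_pure (r + r') = fib_pure r + fib_pure r'.
Proof. by case: s r r' => x b r r'; apply: ptensDl. Qed.

Fact proj_tens_Dl (s : S) (r r' : R s) (g : pG s) :
  ptens (fib_colim R) G (fib_pure (r + r')) g =
  ptens (fib_colim R) G (fib_pure r) g + ptens (fib_colim R) G (fib_pure r') g.
Proof. by rewrite fib_pureD ptensDl. Qed.

Fact proj_tens_Dr (s : S) (r : R s) (g g' : pG s) :
  ptens (fib_colim R) G (fib_pure r) (g + g') =
  ptens (fib_colim R) G (fib_pure r) g + ptens (fib_colim R) G (fib_pure r) g'.
Proof. exact: ptensDr. Qed.

(** A relation [t <= s] is a transport along the base followed by an inequality in the fiber. The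
    first is balanced over [B]; the second is invisible in the colimit. *)
Fact proj_tens_balance (s t : S) (h : (t <= s)%O) (r : R s) (g : pG t) :
  ptens (fib_colim R) G (fib_pure (pres R h r)) g =
  ptens (fib_colim R) G (fib_pure r) (cmap pG h g).
Proof.
have /total_leP[k] := h.
case: s t h r g k => [x b] [y a] h r g /= k ab.
have -> : cmap pG h g = cmap G k g by rewrite (eq_irrelevance k (omorph_le (fib_proj Psi) h)).
rewrite -(ptens_balance (F := fib_colim R) (G := G) k).
congr (ptens _ _ _ _); rewrite [RHS]fib_colim_resE.
exact/esym/fiber_ptens_pres_eq.
Qed.

Definition proj_tens : {additive psh_tensor R pG -> psh_tensor (fib_colim R) G} :=
  psh_tensor_lift proj_tens_Dl proj_tens_Dr proj_tens_balance.

Lemma proj_tensE s (r : R s) (g : pG s) :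
  proj_tens (ptens R pG r g) = ptens (fib_colim R) G (fib_pure r) g.
Proof. exact: psh_tensor_liftE. Qed.

Section Inverse.
Variables (x : B) (g : G x).

Definition unproj_bilin (b : Psi x) (r : fiber_presheaf R x b) (n : Zc x b) :
    psh_tensor R pG :=
  ptens R pG (p := total_pt b) (r *~ (n : int)) g.

Fact unproj_bilinDl b (r r' : fiber_presheaf R x b) n :
  unproj_bilin (r + r') n = unproj_bilin r n + unproj_bilin r' n.
Proof. by rewrite /unproj_bilin mulrzDl ptensDl. Qed.

Fact unproj_bilinDr b (r : fiber_presheaf R x b) n n' :
  unproj_bilin r (n + n') = unproj_bilin r n + unproj_bilin r n'.
Proof. by rewrite /unproj_bilin mulrzDr ptensDl. Qed.

Fact unproj_bilin_balance (a b : Psi x) (h : (b <= a)%O) (r : fiber_presheaf R x a) (n : Zc x b) :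
  unproj_bilin (pres (fiber_presheaf R x) h r) n = unproj_bilin r (cmap (Zc x) h n).
Proof.
rewrite /unproj_bilin -[_ *~ _](raddfMz (pres R (omorph_le (fiber_incl Psi x) h))).
rewrite [LHS](ptens_balance (F := R) (G := pG)); congr (ptens _ _ _ _).
exact: (cmap_id (c := G) (omorph_le (fib_proj Psi) (omorph_le (fiber_incl Psi x) h)) g).
Qed.

Definition unproj_tensr : {additive fib_colim R x -> psh_tensor R pG} :=
  psh_tensor_lift unproj_bilinDl unproj_bilinDr unproj_bilin_balance.

Lemma unproj_tensrE b (r : fiber_presheaf R x b) n :
  unproj_tensr (ptens (fiber_presheaf R x) (Zc x) r n) = unproj_bilin r n.
Proof. exact: psh_tensor_liftE. Qed.

End Inverse.

Fact unproj_Dl (x : B) (t t' : fib_colim R x) (g : G x) :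
  unproj_tensr g (t + t') = unproj_tensr g t + unproj_tensr g t'.
Proof. exact: raddfD. Qed.

Fact unproj_Dr (x : B) (t : fib_colim R x) (g g' : G x) :
  unproj_tensr (g + g') t = unproj_tensr g t + unproj_tensr g' t.
Proof.
apply: (psh_tensor_ext (u := unproj_tensr (g + g'))
  (v := unproj_tensr g \+ unproj_tensr g')) => b r n.
rewrite [LHS]unproj_tensrE -[RHS]/(unproj_tensr g _ + unproj_tensr g' _).
rewrite [X in _ = X + _]unproj_tensrE [X in _ = _ + X]unproj_tensrE.
exact: ptensDr.
Qed.

Fact unproj_balance (x y : B) (h : (y <= x)%O) (t : fib_colim R x) (g : G y) :
  unproj_tensr g (pres (fib_colim R) h t) = unproj_tensr (cmap G h g) t.
Proof.
apply: (psh_tensor_ext (u := add_comp (unproj_tensr g) (fib_colim_res R h))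
  (v := unproj_tensr (cmap G h g))) => b r n.
rewrite add_compE [fib_colim_res R h _]fib_colim_resE.
rewrite [LHS]unproj_tensrE [RHS]unproj_tensrE /unproj_bilin -raddfMz.
rewrite [LHS](ptens_balance (F := R) (G := pG)); congr (ptens _ _ _ _).
exact: (congr1 (fun k => cmap G k g)
  (eq_irrelevance (omorph_le (fib_proj Psi) (transport_le h b)) h)).
Qed.

Definition unproj_tens : {additive psh_tensor (fib_colim R) G -> psh_tensor R pG} :=
  psh_tensor_lift unproj_Dl unproj_Dr unproj_balance.

Lemma unproj_tensE (x : B) (b : Psi x) (r : R (total_pt b)) (n : int) (g : G x) :
  unproj_tens (ptens (fib_colim R) G (p := x)
    (ptens (fiber_presheaf R x) (Zc x) (p := b) r n) g) =
  ptens R pG (p := total_pt b) (r *~ n) g.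
Proof. exact: etrans (psh_tensor_liftE _ _ _ _ _) (unproj_tensrE _ _ _). Qed.

Lemma proj_tensK : cancel proj_tens unproj_tens.
Proof.
apply: (psh_tensor_ext (u := add_comp unproj_tens proj_tens) (v := add_id _)).
move=> [x b] r g; rewrite add_compE [proj_tens _]proj_tensE.
exact: (unproj_tensE (b := b) r 1 g).
Qed.

Fact ptens_int (x : B) (b : Psi x) (r : R (total_pt b)) (n : int) :
  ptens (fiber_presheaf R x) (Zc x) (p := b) (r *~ n) (1 : int) =
  ptens (fiber_presheaf R x) (Zc x) (p := b) r n.
Proof.
have nE : (1 : int) *~ n = n by rewrite intz.
rewrite -[in RHS]nE.
exact: etrans (raddfMz (ptensl (fiber_presheaf R x) (Zc x) (p := b) (1 : int)) n r)
  (esym (raddfMz (ptensr (fiber_presheaf R x) (Zc x) (p := b) r) n (1 : int))).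
Qed.

Lemma unproj_tensK : cancel unproj_tens proj_tens.
Proof.
apply: (psh_tensor_ext (u := add_comp proj_tens unproj_tens) (v := add_id _)) => x t g.
apply: (psh_tensor_ext
  (u := add_comp (add_comp proj_tens unproj_tens)
          (ptensl (fib_colim R) G g))
  (v := ptensl (fib_colim R) G g)) => b r n.
have := congr1 proj_tens (unproj_tensE r n g).
rewrite [RHS](proj_tensE (s := total_pt b)) => E; apply: (etrans E).
exact: (congr1 (fun t => ptens (fib_colim R) G t g) (ptens_int r n)).
Qed.

End Projection.

Fact pull_cmor_nat (G H : copresheaf B) (v : cmor idfun G H) (s t : S) (h : (s <= t)%O)
    (h' : (idfun s <= idfun t)%O) g :
  v (tag t) (cmap (pullback_copresheaf (fib_proj Psi) G) h g) =
  cmap (pullback_copresheaf (fib_proj Psi) H) h' (v (tag s) g).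
Proof. exact: cmor_nat. Qed.

Definition pull_cmor (G H : copresheaf B) (v : cmor idfun G H) :
    cmor idfun (pullback_copresheaf (fib_proj Psi) G) (pullback_copresheaf (fib_proj Psi) H) :=
  @CMor _ _ S S idfun (pullback_copresheaf (fib_proj Psi) G)
    (pullback_copresheaf (fib_proj Psi) H) (fun s => v (tag s)) (@pull_cmor_nat G H v).

Lemma proj_tens_natural_l (R R' : presheaf S) (G : copresheaf B) (u : psh_hom R R') t :
  proj_tens R' G (tens_map u (cmor_id _) t) =
  tens_map (fib_colim_map u) (cmor_id G) (proj_tens R G t).
Proof.
apply: (psh_tensor_ext (u := add_comp (proj_tens R' G) (tens_map u (cmor_id _)))
  (v := add_comp (tens_map (fib_colim_map u) (cmor_id G)) (proj_tens R G))).
move=> s r g; rewrite !add_compE tens_mapE [proj_tens R' G _]proj_tensE.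
rewrite [proj_tens R G _]proj_tensE ptens_map; congr (ptens _ _ _ _).
by case: s r g => x b r g; apply/esym/ptens_map.
Qed.

Lemma proj_tens_natural_r (R : presheaf S) (G H : copresheaf B) (v : cmor idfun G H) t :
  proj_tens R H (tens_map (pmor_id R) (pull_cmor v) t) =
  tens_map (pmor_id (fib_colim R)) v (proj_tens R G t).
Proof.
apply: (psh_tensor_ext (u := add_comp (proj_tens R H) (tens_map (pmor_id R) (pull_cmor v)))
  (v := add_comp (tens_map (pmor_id (fib_colim R)) v) (proj_tens R G))).
move=> s r g; rewrite !add_compE tens_mapE [proj_tens R H _]proj_tensE.
by rewrite [proj_tens R G _]proj_tensE ptens_map.
Qed.

Lemma unproj_tens_natural_l (R R' : presheaf S) (G : copresheaf B) (u : psh_hom R R') t :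
  unproj_tens R' G (tens_map (fib_colim_map u) (cmor_id G) t) =
  tens_map u (cmor_id _) (unproj_tens R G t).
Proof.
apply: (can_inj (@proj_tensK R' G)).
by rewrite unproj_tensK proj_tens_natural_l unproj_tensK.
Qed.

Lemma unproj_tens_natural_r (R : presheaf S) (G H : copresheaf B) (v : cmor idfun G H) t :
  unproj_tens R H (tens_map (pmor_id (fib_colim R)) v t) =
  tens_map (pmor_id R) (pull_cmor v) (unproj_tens R G t).
Proof.
apply: (can_inj (@proj_tensK R H)).
by rewrite unproj_tensK proj_tens_natural_r unproj_tensK.
Qed.

Definition pull_resolution (G : copresheaf B) (Q : copresheaf_resolution G) :
    copresheaf_resolution (pullback_copresheaf (fib_proj Psi) G) :=
  @CopresheafResolution _ S _ (fun n => pullback_copresheaf (fib_proj Psi) (Q n))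
    (fun n => pull_cmor (cr_diff Q n)) (pull_cmor (cr_aug Q))
    (fun s => @cr_aug_surj _ _ _ Q (tag s)) (fun s => @cr_aug_exact _ _ _ Q (tag s))
    (fun n s => @cr_diff_exact _ _ _ Q n (tag s)).

End FiberColimit.

(** * The standard resolution restricted to a fiber *)

Section FiberProjection.
Context {d d' : Order.disp_t} {B : porderType d} {Psi : poset_functor d' B}.
Local Notation S := (total_space Psi).

(** The greatest element of [Psi x] below [t], as [fiber_proj_le] and [fiber_proj_ge] show: the
    right adjoint of the inclusion of the fiber among the points lying over elements above [x]. *)
Definition fiber_proj (x : B) (t : S) (h : (x <= tag t)%O) : Psi x :=
  pf_map Psi h (tagged t).

Lemma fiber_proj_le (x : B) (t : S) (h : (x <= tag t)%O) :
  (total_pt (fiber_proj h) <= t)%O.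
Proof. by case: t h => y b h; apply: transport_le. Qed.

Lemma fiber_proj_ge (x : B) (t : S) (h : (x <= tag t)%O) (b : Psi x) :
  (total_pt b <= t)%O -> (b <= fiber_proj h)%O.
Proof. by move=> /total_leP[k]; rewrite (eq_irrelevance h k). Qed.

Lemma total_le_tag (x : B) (b : Psi x) (t : S) : (total_pt b <= t)%O -> (x <= tag t)%O.
Proof. exact: fib_proj_homo. Qed.

Section FiberBasis.
Variables (K : presheaf S) (x : B).

(** The free presheaf on [t] restricts to the free presheaf on [fiber_proj t] if [x <= tag t], and
    to zero otherwise, so exactly these generators of the cover survive. *)
Definition fiber_ix : choiceType := {i : {t : S & K t} | (x <= tag (tag i))%O}.

Definition fiber_pt (i : fiber_ix) : Psi x := fiber_proj (svalP i).

Definition fiber_elt (i : fiber_ix) : fiber_presheaf (cover K) x (fiber_pt i) :=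
  fgen (CoverGen (tagged (sval i)) (fiber_proj_le (svalP i))).

Definition fiber_germ (b : Psi x) (s : cover_gen K (total_pt b)) : fiber_ix :=
  exist _ (germ (gen_elt s)) (total_le_tag (gen_le s)).

Definition fiber_coef (b : Psi x) :
    {additive fiber_presheaf (cover K) x b -> freeab fiber_ix} :=
  freeab_map (@fiber_germ b).

Fact fiber_coefE (b : Psi x) (i : fiber_ix) (h : (b <= fiber_pt i)%O) :
  fiber_coef b (pres (fiber_presheaf (cover K) x) h (fiber_elt i)) = fgen i.
Proof.
rewrite [pres _ _ _]cover_resE [LHS]freeab_mapE; congr fgen.
by apply: val_inj; case: i h => -[t e] k h.
Qed.

Fact fiber_fb_ext (b : Psi x) (C : zmodType)
    (u v : {additive fiber_presheaf (cover K) x b -> C}) :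
  (forall (i : fiber_ix) (h : (b <= fiber_pt i)%O),
     u (pres (fiber_presheaf (cover K) x) h (fiber_elt i)) =
     v (pres (fiber_presheaf (cover K) x) h (fiber_elt i))) -> u =1 v.
Proof.
move=> uv; apply: freeab_ext => s.
have h : (b <= fiber_pt (fiber_germ s))%O by apply: fiber_proj_ge (gen_le s).
have := uv (fiber_germ s) h.
by rewrite ![pres _ _ _]cover_resE (_ : restrict_gen _ _ = s) //; apply: cover_gen_eq.
Qed.

Definition fiber_basis : free_basis (fiber_presheaf (cover K) x) :=
  @FreeBasis _ _ (fiber_presheaf (cover K) x) fiber_ix fiber_pt fiber_elt fiber_coef
    fiber_coefE fiber_fb_ext.

End FiberBasis.

Section FiberCoverMap.
Variables (K : presheaf S) (x : B) (K' : presheaf (Psi x)).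
Variable w : psh_hom (fiber_presheaf K x) K'.

(** A generator at [t] goes to the generator at [fiber_proj t] given by its restriction to that
    point. Being canonical, this choice is compatible with changing [x]. *)
Definition fiber_gen_map (b : Psi x) (s : cover_gen K (total_pt b)) : cover_gen K' b :=
  CoverGen (w _ (pres K (fiber_proj_le (total_le_tag (gen_le s))) (gen_elt s)))
    (fiber_proj_ge (total_le_tag (gen_le s)) (gen_le s)).

Definition fiber_cover_map_fun (b : Psi x) :
    {additive fiber_presheaf (cover K) x b -> cover K' b} :=
  freeab_map (@fiber_gen_map b).

Lemma fiber_cover_mapE (b : Psi x) (s : cover_gen K (total_pt b)) :
  fiber_cover_map_fun b (fgen s) = fgen (fiber_gen_map s).
Proof. exact: freeab_mapE. Qed.

Lemma fiber_gen_map_eq (b : Psi x) (s : cover_gen K (total_pt b)) (s' : cover_gen K' b)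
    (h : (x <= tag (gen_pt s))%O) :
  germ (gen_elt s') = germ (w _ (pres K (fiber_proj_le h) (gen_elt s))) ->
  s' = fiber_gen_map s.
Proof.
by move=> e; apply: cover_gen_eq; rewrite e /= (eq_irrelevance h (total_le_tag (gen_le s))).
Qed.

Fact fiber_cover_map_nat (a b : Psi x) (h : (a <= b)%O) (h' : (idfun a <= idfun b)%O) r :
  fiber_cover_map_fun a (pres (fiber_presheaf (cover K) x) h r) =
  pres (cover K') h' (fiber_cover_map_fun b r).
Proof.
apply: (freeab_ext
  (f := add_comp (fiber_cover_map_fun a) (pres (fiber_presheaf (cover K) x) h))
  (g := add_comp (pres (cover K') h') (fiber_cover_map_fun b))) => s.
rewrite !add_compE.
apply: etrans (congr1 (fiber_cover_map_fun a) (cover_resE (omorph_le (fiber_incl Psi x) h) s)) _.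
rewrite !fiber_cover_mapE.
rewrite [RHS]cover_resE; congr fgen; apply/esym.
by apply: (fiber_gen_map_eq (s := restrict_gen (omorph_le (fiber_incl Psi x) h) s)
  (h := total_le_tag (gen_le s))).
Qed.

Definition fiber_cover_map : psh_hom (fiber_presheaf (cover K) x) (cover K') :=
  @PMor _ _ (Psi x) (Psi x) idfun (fiber_presheaf (cover K) x) (cover K')
    fiber_cover_map_fun fiber_cover_map_nat.

Lemma counit_fiber_cover_map (b : Psi x) (r : cover K (total_pt b)) :
  w b (counit K (total_pt b) r) = counit K' b (fiber_cover_map b r).
Proof.
apply: (freeab_ext (f := add_comp (w b) (counit K (total_pt b)))
  (g := add_comp (counit K' b) (fiber_cover_map b))) => s.
rewrite !add_compE [fiber_cover_map b _]fiber_cover_mapE.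
rewrite [counit K _ _]freeab_liftE [counit K' _ _]freeab_liftE /=.
rewrite -(pmor_nat w (fiber_proj_ge (total_le_tag (gen_le s)) (gen_le s))).
exact: (congr1 (w b) (esym (pres_comp (omorph_le (fiber_incl Psi x)
  (fiber_proj_ge (total_le_tag (gen_le s)) (gen_le s))) _ (gen_le s) (gen_elt s)))).
Qed.

End FiberCoverMap.

Section Naturality.
Variables (K : presheaf S) (x y : B) (h : (x <= y)%O).
Variables (Ky : presheaf (Psi y)) (Kx : presheaf (Psi x)).
Variables (wy : psh_hom (fiber_presheaf K y) Ky) (wx : psh_hom (fiber_presheaf K x) Kx).
Variable phi : pmor (pf_map Psi h) Ky Kx.
Hypothesis comm : forall (b : Psi y) (a : K (total_pt b)),
  phi b (wy b a) = wx (pf_map Psi h b) (fiber_res K h b a).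

Lemma fiber_germ_eq (p p' : Psi x) (t : S) (k : (total_pt p <= t)%O)
    (k' : (total_pt p' <= t)%O) (e : K t) : p = p' ->
  germ (F := Kx) (wx p (pres K k e)) = germ (F := Kx) (wx p' (pres K k' e)).
Proof. by move=> pp'; subst p'; rewrite (eq_irrelevance k k'). Qed.

Lemma fiber_cover_map_natural (b : Psi y) (r : cover K (total_pt b)) :
  cover_map phi b (fiber_cover_map wy b r) =
  fiber_cover_map wx (pf_map Psi h b) (fiber_res (cover K) h b r).
Proof.
apply: (freeab_ext (f := add_comp (cover_map phi b) (fiber_cover_map wy b))
  (g := add_comp (fiber_cover_map wx (pf_map Psi h b)) (fiber_res (cover K) h b))) => s.
rewrite !add_compE [fiber_cover_map wy b _]fiber_cover_mapE cover_mapE.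
apply/esym; apply: etrans (congr1 (fiber_cover_map wx (pf_map Psi h b))
  (cover_resE (transport_le h b) s)) _.
apply: etrans (fiber_cover_mapE _ _) _; congr fgen; apply/esym.
(* The two generators sit at the projections of [gen_pt s] to [Psi x], taken through [Psi y] and
   directly; these agree by functoriality of [Psi]. *)
have hx : (x <= tag (gen_pt s))%O := le_trans h (total_le_tag (gen_le s)).
apply: (fiber_gen_map_eq (s := restrict_gen (transport_le h b) s) (h := hx)) => /=.
rewrite comm.
have L : (total_pt (pf_map Psi h (fiber_proj (total_le_tag (gen_le s)))) <= gen_pt s)%O.
  exact: le_trans (transport_le _ _) (fiber_proj_le _).
rewrite [fiber_res K h _ _](pres_comp _ _ L); apply: fiber_germ_eq.
exact: pf_comp.
Qed.

End Naturality.

Section FiberStandard.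
Variable F : presheaf S.

Section AtPoint.
Variable x : B.
Local Notation Fx := (fiber_presheaf F x).

Section KernelStep.
Variables (n : nat) (w : psh_hom (fiber_presheaf (syzygy F n) x) (syzygy Fx n)).

Fact fiber_syz_subproof (b : Psi x) a :
  a \in kernel (counit (syzygy F n) (total_pt b)) ->
  fiber_cover_map w b a \in kernel (counit (syzygy Fx n) b).
Proof.
by move=> /kernelP a0; apply/kernelP; rewrite -counit_fiber_cover_map a0 raddf0.
Qed.

Definition fiber_syz_fun (b : Psi x) :
    {additive fiber_presheaf (syzygy F n.+1) x b -> syzygy Fx n.+1 b} :=
  sub_map (@fiber_syz_subproof b).

Fact fiber_syz_nat (a b : Psi x) (h : (a <= b)%O) (h' : (idfun a <= idfun b)%O) r :
  fiber_syz_fun a (pres (fiber_presheaf (syzygy F n.+1) x) h r) =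
  pres (syzygy Fx n.+1) h' (fiber_syz_fun b r).
Proof. by apply: val_inj; apply: (pmor_nat (fiber_cover_map w)). Qed.

Definition fiber_syz_step : psh_hom (fiber_presheaf (syzygy F n.+1) x) (syzygy Fx n.+1) :=
  @PMor _ _ (Psi x) (Psi x) idfun (fiber_presheaf (syzygy F n.+1) x) (syzygy Fx n.+1)
    fiber_syz_fun fiber_syz_nat.

End KernelStep.

(** The comparison is carried through the syzygies by covers and kernels alone, without lifting
    along epimorphisms. This is what yields the strict naturality [fiber_std_natural]. *)
Fixpoint fiber_syz (n : nat) : psh_hom (fiber_presheaf (syzygy F n) x) (syzygy Fx n) :=
  if n is n'.+1 then fiber_syz_step (fiber_syz n') else pmor_id Fx.

Definition fiber_std (n : nat) : psh_hom (fiber_presheaf (std_ob F n) x) (std_ob Fx n) :=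
  fiber_cover_map (fiber_syz n).

Lemma fiber_std_diff n (b : Psi x) a :
  fiber_std n b (std_diff F n (total_pt b) a) = std_diff Fx n b (fiber_std n.+1 b a).
Proof.
exact: (congr1 (@sub_val _ (kernel (counit (syzygy Fx n) b)))
  (counit_fiber_cover_map (fiber_syz n.+1) a)).
Qed.

Definition fiber_resolution : presheaf_resolution Fx :=
  @PresheafResolution _ _ Fx (fun n => fiber_presheaf (std_ob F n) x)
    (fun n => fiber_hom (std_diff F n) x) (fiber_hom (std_aug F) x)
    (fun b => @counit_surj _ _ F (total_pt b)) (fun b => @std_aug_exact _ _ F (total_pt b))
    (fun n b => @std_diff_exact _ _ F n (total_pt b)).

Lemma fiber_resolution_flat n : flat (fiber_resolution n).
Proof. exact/free_basis_flat/fiber_basis. Qed.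

End AtPoint.

Lemma fiber_syz_natural (x y : B) (h : (x <= y)%O) n (b : Psi y) a :
  syz_map (fiber_res F h) n b (fiber_syz y n b a) =
  fiber_syz x n (pf_map Psi h b) (fiber_res (syzygy F n) h b a).
Proof.
elim: n b a => [//|n IHn] b a; apply: val_inj.
exact: (fiber_cover_map_natural IHn (sub_val a)).
Qed.

Lemma fiber_std_natural (x y : B) (h : (x <= y)%O) n (b : Psi y) a :
  std_map (fiber_res F h) n b (fiber_std y n b a) =
  fiber_std x n (pf_map Psi h b) (fiber_res (std_ob F n) h b a).
Proof. exact: (fiber_cover_map_natural (@fiber_syz_natural x y h n)). Qed.

End FiberStandard.
End FiberProjection.

(** * The spectral sequence of a fibration *)

Section CoflatInjective.
Context {d : Order.disp_t} {P : porderType d}.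

Fact zero_hom_nat (E F : presheaf P) (x y : P) (h : (x <= y)%O)
    (h' : (idfun x <= idfun y)%O) (a : E y) :
  add_zero (E x) (F x) (pres E h a) = pres F h' (add_zero (E y) (F y) a).
Proof. exact/esym/raddf0. Qed.

Definition zero_hom (E F : presheaf P) : psh_hom E F :=
  @PMor _ _ P P idfun E F (fun x => add_zero (E x) (F x)) (@zero_hom_nat E F).

Lemma tens_map_zero (E F : presheaf P) (G : copresheaf P) t :
  tens_map (zero_hom E F) (cmor_id G) t = 0.
Proof.
apply: (psh_tensor_ext (u := tens_map (zero_hom E F) (cmor_id G)) (v := add_zero _ _)).
by move=> p a b; rewrite tens_mapE; apply: (raddf0 (ptensl F G _)).
Qed.

Lemma coflat_inj (Q : copresheaf P) (M N : presheaf P) (u : psh_hom M N) :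
  coflat Q -> (forall p a, u p a = 0 -> a = 0) ->
  forall t, tens_map u (cmor_id Q) t = 0 -> t = 0.
Proof.
move=> Qflat u0 t /(Qflat _ _ _ (zero_hom M M) u) [p a /u0 ->|s <-].
  by exists 0.
exact: tens_map_zero.
Qed.

Lemma tens_map_psh_comp (M1 M2 M3 : presheaf P) (Q : copresheaf P)
    (u : psh_hom M1 M2) (v : psh_hom M2 M3) (w : psh_hom M1 M3) :
  (forall p a, w p a = v p (u p a)) ->
  forall t, tens_map w (cmor_id Q) t = tens_map v (cmor_id Q) (tens_map u (cmor_id Q) t).
Proof.
move=> wE; apply: (psh_tensor_ext (u := tens_map w (cmor_id Q))
  (v := add_comp (tens_map v (cmor_id Q)) (tens_map u (cmor_id Q)))) => p a b.
by rewrite add_compE !tens_mapE wE.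
Qed.

End CoflatInjective.

(** * Fiber homology as the homology of the complex of fiberwise colimits *)

Section ColumnHomology.
Context {d d' : Order.disp_t} {B : porderType d} {Psi : poset_functor d' B}.
Variable F : presheaf (total_space Psi).
Local Notation Zc x := (constant_copresheaf (Psi x) int).
Local Notation L n := (fib_colim (std_ob F n)).
Local Notation dL n := (fib_colim_map (std_diff F n)).

(** The value at [x] of the complex [fib_colim (std_ob F n)], up to conversion. In this form the
    comparison of resolutions on the fiber applies; the other form carries the presheaf structure on
    [B]. *)
Definition colim_complex (x : B) : chain_complex :=
  tens_resolution_l (Zc x) (fiber_resolution F x).

Definition colim_comparison n (x : B) :
    {additive colim_complex x n -> tensor_complex (std_resolution (fiber_presheaf F x)) (Zc x) n} :=
  tens_map (fiber_std F x n) (cmor_id (Zc x)).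

Fact colim_comparison_diff n (x : B) t :
  colim_comparison n x (ch_diff (colim_complex x) n t) =
  ch_diff (tensor_complex (std_resolution (fiber_presheaf F x)) (Zc x)) n
    (colim_comparison n.+1 x t).
Proof.
exact: (tens_map_square (u := fiber_hom (std_diff F n) x)
  (v := std_diff (fiber_presheaf F x) n) (cmor_id (Zc x)) (@fiber_std_diff _ _ _ _ F x n)).
Qed.

Definition colim_comparison_map (x : B) : chain_map _ _ :=
  ChainMap (fun n => @colim_comparison_diff n x).

Fact colim_res_cycles n (x y : B) (h : (x <= y)%O) t :
  t \in cycles (colim_complex y) n -> pres (L n) h t \in cycles (colim_complex x) n.
Proof.
case: n t => [//|n] t /kernelP t0; apply/kernelP.
apply: etrans (pmor_nat (dL n) h h t) _.
exact: etrans (congr1 (pres (L n) h) t0) (raddf0 _).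
Qed.

Lemma colim_comparison_natural n (x y : B) (h : (x <= y)%O) t :
  colim_comparison n x (pres (L n) h t) =
  tor_chain_fun (fiber_res F h) (constant_cmor (pf_map Psi h) int) n (colim_comparison n y t).
Proof.
apply: (psh_tensor_ext (u := add_comp (colim_comparison n x) (fib_colim_res (std_ob F n) h))
  (v := add_comp (tor_chain_fun (fiber_res F h) (constant_cmor (pf_map Psi h) int) n)
          (colim_comparison n y))) => b r m.
rewrite !add_compE [fib_colim_res _ h _]fib_colim_resE.
rewrite [colim_comparison n y _]ptens_map [LHS]ptens_map [RHS]ptens_map.
exact: (congr1 (fun r => ptens (std_ob (fiber_presheaf F x) n) (Zc x) (p := pf_map Psi h b) r m)
  (esym (fiber_std_natural h r))).
Qed.

Variable n : nat.

Definition cycle_res (x y : B) (h : (x <= y)%O) :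
    {additive sub_of (cycles (colim_complex y) n) -> sub_of (cycles (colim_complex x) n)} :=
  sub_map (@colim_res_cycles n x y h).

Fact cycle_res_id (x : B) (h : (x <= x)%O) a : cycle_res h a = a.
Proof. by apply: val_inj; apply: (pres_id (p := L n)). Qed.

Fact cycle_res_comp (x y z : B) (hxy : (x <= y)%O) (hyz : (y <= z)%O)
  (hxz : (x <= z)%O) a : cycle_res hxy (cycle_res hyz a) = cycle_res hxz a.
Proof. by apply: val_inj; apply: (pres_comp (p := L n)). Qed.

Definition cycle_presheaf : presheaf B := Presheaf cycle_res_id cycle_res_comp.

Fact cycle_incl_nat (x y : B) (h : (x <= y)%O) (h' : (idfun x <= idfun y)%O)
    (a : cycle_presheaf y) :
  sub_val (pres cycle_presheaf h a) = pres (L n) h' (sub_val a).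
Proof. by rewrite (eq_irrelevance h h'). Qed.

Definition cycle_incl : psh_hom cycle_presheaf (L n) :=
  @PMor _ _ B B idfun cycle_presheaf (L n)
    (fun x => @sub_val _ (cycles (colim_complex x) n)) cycle_incl_nat.

Fact boundary_cycle (x : B) (t : L n.+1 x) : dL n x t \in cycles (colim_complex x) n.
Proof.
case: (n) t => [//|m] t; apply/kernelP; exact: (ch_diff_sq (c := colim_complex x)).
Qed.

Fact boundary_is_zmod_morphism (x : B) :
  zmod_morphism (fun t : L n.+1 x => SubOf (boundary_cycle t)).
Proof. by move=> t t'; apply: val_inj; apply: (raddfB (dL n x)). Qed.

Fact boundary_hom_nat (x y : B) (h : (x <= y)%O) (h' : (idfun x <= idfun y)%O)
    (t : L n.+1 y) :
  additive_of (@boundary_is_zmod_morphism x) (pres (L n.+1) h t) =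
  pres cycle_presheaf h' (additive_of (@boundary_is_zmod_morphism y) t).
Proof. by apply: val_inj; apply: (pmor_nat (dL n)). Qed.

Definition boundary_hom : psh_hom (L n.+1) cycle_presheaf :=
  @PMor _ _ B B idfun (L n.+1) cycle_presheaf
    (fun x => additive_of (@boundary_is_zmod_morphism x)) boundary_hom_nat.

(** Classes pass through [colim_comparison], since [fiber_homology] is computed on the standard
    resolutions of the fibers. With [boundary_hom] this gives a presentation of [fiber_homology] by
    cycles modulo boundaries, as presheaves on [B]. *)
Definition homology_class_fun (x : B) :
    {additive cycle_presheaf x -> fiber_homology F n x} :=
  add_comp (quot_pi _) (sub_map (@chm_cycles _ _ (colim_comparison_map x) n)).

Fact homology_class_nat (x y : B) (h : (x <= y)%O) (h' : (idfun x <= idfun y)%O)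
    (a : cycle_presheaf y) :
  homology_class_fun x (pres cycle_presheaf h a) =
  pres (fiber_homology F n) h' (homology_class_fun y a).
Proof.
rewrite (eq_irrelevance h' h); apply/esym.
apply: etrans (homology_mapE _ _) _; apply: congr1; apply: val_inj.
exact/esym/colim_comparison_natural.
Qed.

Definition homology_class : psh_hom cycle_presheaf (fiber_homology F n) :=
  @PMor _ _ B B idfun cycle_presheaf (fiber_homology F n) homology_class_fun
    homology_class_nat.

Let cmp_surj x := comparison_surj (G := Zc x) (@fiber_resolution_flat _ _ _ _ F x)
  (R' := std_presheaf_resolution (fiber_presheaf F x))
  (@std_flat _ _ (fiber_presheaf F x)) (@fiber_std_diff _ _ _ _ F x).

Lemma fiber_std_aug (x : B) (b : Psi x) a :
  std_aug (fiber_presheaf F x) b (fiber_std F x 0 b a) = std_aug F (total_pt b) a.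
Proof. exact/esym/(counit_fiber_cover_map (fiber_syz F x 0)). Qed.

Lemma homology_class_surj (x : B) q : exists a, homology_class x a = q.
Proof.
have [[c cZ] <-] := quot_piP q.
have [a aZ ca] := cmp_surj (@fiber_std_aug x) cZ.
exists (SubOf aZ); apply/esym/quot_eqP; exact: ca.
Qed.

Lemma homology_class_eq0 (x : B) (a : cycle_presheaf x) :
  homology_class x a = 0 <-> exists t, boundary_hom x t = a.
Proof.
have cmp_inj := comparison_inj (G := Zc x) (@fiber_resolution_flat _ _ _ _ F x)
  (R' := std_presheaf_resolution (fiber_presheaf F x))
  (@std_flat _ _ (fiber_presheaf F x)) (@fiber_std_diff _ _ _ _ F x) (@fiber_std_aug x).
split=> [/quot_eq0 a0|[t <-]].
  have /boundariesP[t tE] := cmp_inj n (sub_val a) (sub_valP a) a0.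
  by exists t; apply: val_inj.
apply/quot_eq0/boundariesP; exists (colim_comparison n.+1 x t).
exact/esym/colim_comparison_diff.
Qed.

End ColumnHomology.

Section SpectralSequence.
Context {d d' : Order.disp_t} {B : porderType d} {Psi : poset_functor d' B}.
Variables (F : presheaf (total_space Psi)) (G : copresheaf B).

Let Q := costd_resolution G.

Definition fibration_double_complex : double_complex :=
  tens_double_complex (std_presheaf_resolution F) (pull_resolution (Psi := Psi) Q).

Local Notation D := fibration_double_complex.
Local Notation L n := (fib_colim (std_ob F n)).
Local Notation dL n := (fib_colim_map (std_diff F n)).

Let Qflat q : coflat (Q q) := @costd_coflat _ _ G q.

Lemma unproj_tens_surj p q (x : D p q) :
  exists t, unproj_tens (std_ob F p) (Q q) t = x.
Proof. by exists (proj_tens (std_ob F p) (Q q) x); apply: proj_tensK. Qed.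

Lemma cycle_incl_exact p q (t : psh_tensor (L p.+1) (Q q)) :
  tens_map (dL p) (cmor_id (Q q)) t = 0 ->
  exists s, tens_map (cycle_incl F p.+1) (cmor_id (Q q)) s = t.
Proof.
apply: Qflat => x y y0.
have yZ : y \in cycles (colim_complex F x) p.+1 by apply/kernelP.
by exists (SubOf yZ).
Qed.

Definition cycle_tens p q : zmodType := psh_tensor (cycle_presheaf F p) (Q q).

Definition cycle_tens_in p q : {additive cycle_tens p q -> D p q} :=
  add_comp (unproj_tens (std_ob F p) (Q q)) (tens_map (cycle_incl F p) (cmor_id (Q q))).

Lemma cycle_tens_hcycle p q (x : D p q) :
  hcycle x <-> exists w, cycle_tens_in p q w = x.
Proof.
case: p x => [|p] x.
  split=> // _; have [t <-] := unproj_tens_surj x.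
  have [||w <-] := tens_map_surj (phi := cycle_incl F 0) (gamma := cmor_id (Q q)) _ _ t.
  - move=> y a; have aZ : a \in cycles (colim_complex F y) 0 by [].
    by exists (SubOf aZ).
  - by move=> y b; exists b.
  by exists w.
split=> [|[w <-]].
  have [t <-] := unproj_tens_surj x => x0.
  have [|w <-] := @cycle_incl_exact p q t; last by exists w.
  apply: (can_inj (@unproj_tensK _ _ _ _ (std_ob F p) (Q q))).
  rewrite raddf0; apply: etrans (unproj_tens_natural_l (std_diff F p) t) _.
  exact: x0.
apply: etrans (esym (unproj_tens_natural_l (std_diff F p) _)) _.
rewrite -[RHS](raddf0 (unproj_tens (std_ob F p) (Q q))); congr (unproj_tens _ _ _).
apply: (tens_map_comp0l (u := cycle_incl F p.+1) (v := dL p)) => y a.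
by have /kernelP := sub_valP a.
Qed.

Lemma cycle_tens_in_v p q (w : cycle_tens p q.+1) :
  cycle_tens_in p q (tens_map (pmor_id (cycle_presheaf F p)) (cr_diff Q q) w) =
  dc_v D p q (cycle_tens_in p q.+1 w).
Proof.
rewrite /cycle_tens_in !add_compE.
apply: etrans (congr1 _ (tens_map_interchange (cycle_incl F p) (cr_diff Q q) w)) _.
exact: unproj_tens_natural_r.
Qed.

(** Tensoring with [Q q] preserves the exactness of [boundary_hom] followed by [homology_class],
    which gives one direction. It also preserves the injectivity of [cycle_incl], which for the
    other direction brings an equality in the double complex back to one between tensored cycles. *)
Lemma cycle_tens_boundary p q (w : cycle_tens p q) :
  tens_map (homology_class F p) (cmor_id (Q q)) w = 0 <->
  exists y, dc_h D p q y = cycle_tens_in p q w.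
Proof.
have dLE := tens_map_psh_comp (Q := Q q) (u := boundary_hom F p) (v := cycle_incl F p)
  (w := dL p) (fun _ _ => erefl).
split=> [w0|[y yE]].
  have [|t <-] := @Qflat q _ _ _ (boundary_hom F p) (homology_class F p) _ w w0.
    by move=> x a /homology_class_eq0.
  exists (unproj_tens (std_ob F p.+1) (Q q) t).
  apply: etrans (esym (unproj_tens_natural_l (std_diff F p) t)) _.
  exact: congr1 _ (dLE t).
have [t tE] := unproj_tens_surj y.
have e : tens_map (dL p) (cmor_id (Q q)) t = tens_map (cycle_incl F p) (cmor_id (Q q)) w.
  apply: (can_inj (@unproj_tensK _ _ _ _ (std_ob F p) (Q q))).
  apply: etrans (unproj_tens_natural_l (std_diff F p) t) _.
  exact: etrans (congr1 (dc_h D p q) tE) yE.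
have <- : tens_map (boundary_hom F p) (cmor_id (Q q)) t = w.
  apply/eqP; rewrite -subr_eq0; apply/eqP.
  apply: (coflat_inj (u := cycle_incl F p) (@Qflat q)) => [x a a0|].
    by apply: val_inj; rewrite raddf0.
  by rewrite raddfB -dLE e subrr.
apply: (tens_map_comp0l (u := boundary_hom F p) (v := homology_class F p)) => x a.
by apply/homology_class_eq0; exists a.
Qed.

(** The auxiliary groups [W] are the cycles of [pi_! R] tensored with [Q q]: they map onto the
    horizontal cycles of the double complex and onto the homology tensored with [Q q]. *)
Lemma fibration_second_page p q :
  zmod_iso (fc_page (tot D) 2 p q) (Tor q (fiber_homology F p) G).
Proof.
apply: zmod_iso_trans (zmod_iso_sym (Tor_balanced (fiber_homology F p) G q)).
apply: (second_page (V := tens_resolution_r (fiber_homology F p) Q)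
  (wd := fun q => tens_map (pmor_id (cycle_presheaf F p)) (cr_diff Q q))
  (al := cycle_tens_in p)
  (be := fun q => tens_map (homology_class F p) (cmor_id (Q q)))) => {q}.
- exact: cycle_tens_in_v.
- move=> q w; exact: (tens_map_interchange (homology_class F p) (cr_diff Q q) w).
- exact: cycle_tens_hcycle.
- move=> q; apply: tens_map_surj => [x a|x b]; first exact: homology_class_surj.
  by exists b.
exact: cycle_tens_boundary.
Qed.

Lemma fibration_abutment n : zmod_iso (fc_homology (tot D) n)
  (Tor n F (pullback_copresheaf (fib_proj Psi) G)).
Proof.
exact: (raug_iso (tens_row_augmentation (R := std_presheaf_resolution F)
  (pull_resolution Q) (@std_flat _ _ F)) n).
Qed.

End SpectralSequence.

Theorem theorem3p1 (d d' : Order.disp_t) (B : porderType d)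
    (Psi : poset_functor d' B) (F : presheaf (total_space Psi)) (G : copresheaf B)
    (hG : free_copresheaf G) :
  exists E : spectral_sequence,
    (forall p q : nat, zmod_iso (E 2%N p q) (Tor q (fiber_homology F p) G)) /\
    converges_to E (fun n => Tor n F (pullback_copresheaf (fib_proj Psi) G)).
Proof.
exists (fc_spectral_sequence (tot (fibration_double_complex F G))).
split; first exact: fibration_second_page.
exact/fc_converges/fibration_abutment.
Qed.
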